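(* Suppose that $S=\bigcup_{i\in I}S_i$ is a decomposition of $S$ into disjoint non-empty subsets such that $\mathcal L_t(x,y)=0$ for all $t\ge0$, $x\in S_i$, $y\in S_j$ with $i\ne j$. Fix $t_0\ge0$, $q\in\,]6,\infty[$ and $p\in\,]\frac{4q}{q-2},q[$. Let $\omega:=\sup_{s\in[0,t_0]}\operatorname{osc}(H_s)$, let $\tilde p$ and $r$ be determined by $\tilde p^{-1}=q^{-1}+2p^{-1}$ and $p^{-1}=q^{-1}+r^{-1}$, and put $$a(p,q):=\log\max\Big(\frac{2r-1}{p-1},\ \frac{2p-2}{p-2},\ \frac{p-1}{\tilde p-1},\ \frac{2\tilde p-2}{\tilde p-2}\Big).$$ Suppose that $$N\ \ge\ 40\,\max(\tilde K_{t_0}(q),1)$$ and $$\lambda_s\ \ge\ \max\Big(\frac{p\tilde A_s}{4}+\frac{p(p+3)}{4}\,t_0\tilde B_s,\ \ \frac{17}{4}\,a(p,q)\,\omega\,\tilde\gamma_s\Big)\qquad\text{for all }s\in[0,t_0].$$ Then, for every $t\in[0,t_0]$, $$\tilde\varepsilon_t^{N,p}\ \le\ \big(2+8K_t(2)\tilde M_t^2\big)\,N^{-1}\,\big(1+16\tilde K_t(q)\tilde M_t^2\,N^{-1}\big).$$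
   Context: Setting. $S$ is a finite set and $\langle f,\nu\rangle=\sum_{x\in S}f(x)\nu(x)$ for $f:S\to\mathbb R$ and a measure $\nu$ on $S$. $(\mu_t)_{t\ge0}$ are strictly positive probability measures on $S$ of the form $\mu_t(x)=Z_t^{-1}\exp(-\mathcal U_t(x))\mu_0(x)$, with $t\mapsto\mathcal U_t(x)$ continuously differentiable for each $x$, and $H_t(x):=-\frac{\partial}{\partial t}\log\mu_t(x)$ (so $\langle H_t,\mu_t\rangle=0$). For each $t\ge0$, $\mathcal L_t$ is a generator ($Q$-matrix) on $S$, with $t\mapsto\mathcal L_t(x,y)$ continuous, satisfying detailed balance $\mu_t(x)\mathcal L_t(x,y)=\mu_t(y)\mathcal L_t(y,x)$; $(\mathcal L_tf)(x)=\sum_y\mathcal L_t(x,y)f(y)$. The constants $\lambda_t\ge0$ depend continuously on $t$. Particle system. For $N\in\mathbb N$, $X^N_t=(X^N_{t,1},\dots,X^N_{t,N})$ is, under $\mathbb P$, a right-continuous time-inhomogeneous Markov process on $S^N$ with initial distribution the $N$-fold product $\mu_0^N$ and generator at time $t$ $$\mathcal L_t^N\varphi(x)=\lambda_t\sum_{i=1}^N\mathcal L_t^{(i)}\varphi(x)+\frac1N\sum_{i,j=1}^N(H_t(x_i)-H_t(x_j))^+\big(\varphi(x^{i\to j})-\varphi(x)\big),$$ where $\mathcal L_t^{(i)}$ is $\mathcal L_t$ acting on the $i$-th component and $x^{i\to j}$ is $x$ with its $i$-th component replaced by $x_j$. Set $\eta_t^N=\frac1N\sum_{i=1}^N\delta_{X^N_{t,i}}$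 and $\nu_t^N=\exp\big(-\int_0^t\langle H_s,\eta_s^N\rangle ds\big)\eta_t^N$. Notation. $\operatorname{osc}(g)=\sup g-\inf g$. $\mu_t^i=\mu_t(\cdot\,|S_i)$ is $\mu_t$ conditioned on $S_i$; $\|f\|^\sim_{L^p(\mu_t)}=\max_{i\in I}\|f\|_{L^p(S_i,\mu_t^i)}$; $$\tilde\varepsilon_t^{N,p}=\sup\big\{\mathbb E[|\langle f,\nu_s^N\rangle-\langle f,\mu_s\rangle|^2]\ :\ s\in[0,t],\ f:S\to\mathbb R,\ \|f\|^\sim_{L^p(\mu_s)}\le1\big\};$$ $K_t(q)=\int_0^t\|H_s\|_{L^q(\mu_s)}ds$, $\tilde K_t(q)=\int_0^t\|H_s\|^\sim_{L^q(\mu_s)}ds$, $\tilde M_t=\max_{i\in I}\sup_{0\le r\le s\le t}\mu_s(S_i)/\mu_r(S_i)$. For $i\in I$ put $H_t^i=H_t-\langle H_t,\mu_t^i\rangle$ on $S_i$, $\mathcal E_t^i(f)=\frac12\sum_{x,y\in S_i}(f(y)-f(x))^2\mathcal L_t(x,y)\mu_t^i(x)$ for $f:S_i\to\mathbb R$, $\mathcal S_0^i=\{f:S_i\to\mathbb R:\langle f,\mu_t^i\rangle=0,\ f\not\equiv0\}$, $\mathcal S_1^i=\{f:S_i\to\mathbb R:\langle f^2,\mu_t^i\rangle=1,\ f\not\equiv1\}$, and $$A_t^i=\sup_{f\in\mathcal S_0^i}\frac{-\int H_t^if^2\,d\mu_t^i}{\mathcal E_t^i(f)},\quad B_t^i=\sup_{f\in\mathcal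 S_0^i}\frac{|\int H_t^if\,d\mu_t^i|^2}{\mathcal E_t^i(f)},\quad \gamma_t^i=\sup_{f\in\mathcal S_1^i}\frac{\int f^2\log|f|\,d\mu_t^i}{\mathcal E_t^i(f)};$$ $\tilde A_t=\max_iA_t^i$, $\tilde B_t=\max_iB_t^i$, $\tilde\gamma_t=\max_i\gamma_t^i$. Conventions: $0\cdot\log0=0$; a quotient with zero denominator is read as $+\infty$ if its numerator is positive and is disregarded otherwise; an empty supremum is $0$. *)

(* Defs.v *)
From HB Require Import structures.
From mathcomp Require Import all_boot all_order all_algebra.
From mathcomp Require Import all_classical all_reals all_analysis.

Set Implicit Arguments.
Unset Strict Implicit.
Unset Printing Implicit Defensive.

Import Order.TTheory GRing.Theory Num.Theory.
Import numFieldNormedType.Exports.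

Local Open Scope classical_set_scope.
Local Open Scope ring_scope.

(** Differentiability on a half-line starting at [a]: the derivative is two-sided
    for [t > a] and one-sided at [t = a], so the values of a function of time
    before time [a] are irrelevant. *)
Section HalfLine.
Context {R : realType}.
Implicit Types (a t d : R) (g : R -> R).

Definition has_derivative_from a g t d : Prop :=
  (g u - g t) / (u - t) @[u --> within `[a, +oo[ t^'] --> d.

Definition derivative_from a g t : R :=
  lim ((g u - g t) / (u - t) @[u --> within `[a, +oo[ t^']).

Definition C1_from a g : Prop :=
  (forall t, a <= t -> has_derivative_from a g t (derivative_from a g t)) /\
  {within `[a, +oo[, continuous (derivative_from a g)}.

End HalfLine.

(** A measure on the finite set [S] is encoded by its weights [S -> R]. *)
Section FiniteMeasures.
Context {R : realType} {S : finType}.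
Implicit Types (f m : S -> R) (A : {set S}).

Definition pairing f m : R := \sum_x f x * m x.

Definition mass m A : R := \sum_(x in A) m x.

Definition cond m A : S -> R := fun x => if x \in A then m x / mass m A else 0.

Definition osc f : R := sup (range f) - inf (range f).

Definition Lp_norm m (p : R) f : R :=
  (\sum_x `|f x| `^ p * m x) `^ p^-1.

(* The base value 0 of the maximum is harmless since norms are nonnegative. *)
Definition Lp_norm_max (I : finType) (Si : I -> {set S}) m (p : R) f : R :=
  \big[Num.max/0]_(i : I) Lp_norm (cond m (Si i)) p f.

Definition Qmatrix (L : S -> S -> R) : Prop :=
  (forall x y, x != y -> 0 <= L x y) /\ (forall x, \sum_y L x y = 0).

Definition gen_apply (L : S -> S -> R) f : S -> R := fun x => \sum_y L x y * f y.

End FiniteMeasures.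

(** Time-inhomogeneous Markov processes on a finite state space [T].
    The generator at time [t] is the operator [G t] on functions [T -> R]. *)
Section Markov.
Context {R : realType} {T : finType}.
Implicit Types (G : R -> (T -> R) -> T -> R) (p : R -> R -> T -> T -> R).

(* [p s t x y] is the probability of going from [x] at time [s] to [y] at time
   [t]; the last clause is Kolmogorov's forward equation
   [d/dt p_{s,t} phi = p_{s,t} (G_t phi)] for [t >= s]. *)
Definition transition_function G p : Prop :=
  [/\ (forall s t x y, 0 <= s -> s <= t -> 0 <= p s t x y),
      (forall s t x, 0 <= s -> s <= t -> \sum_y p s t x y = 1),
      (forall s x y, 0 <= s -> p s s x y = (x == y)%:R),
      (forall s t u x z, 0 <= s -> s <= t -> t <= u ->
         p s u x z = \sum_y p s t x y * p t u y z) &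
      (forall s t x (phi : T -> R), 0 <= s -> s <= t ->
         has_derivative_from s (fun u => gen_apply (p s u) phi x) t
           (gen_apply (p s t) (G t phi) x))].

Definition right_continuous_path (w : R -> T) : Prop :=
  forall t, 0 <= t -> \forall s \near t^'+, w s = w t.

Definition markov_process d (Omega : measurableType d) (P : probability Omega R)
    (X : R -> Omega -> T) (init : T -> R) G : Prop :=
  [/\ (forall t x, 0 <= t -> measurable [set w | X t w = x]),
      (forall w, right_continuous_path (fun t => X t w)) &
      exists2 p, transition_function G p &
        forall (n : nat) (t : nat -> R) (x : nat -> T),
          t 0%N = 0 ->
          (forall k, (k < n)%N -> t k <= t k.+1) ->
          P [set w | forall k, (k <= n)%N -> X (t k) w = x k] =
          (init (x 0%N) *
           \prod_(k < n) p (t k) (t k.+1) (x k) (x k.+1))%:E].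

End Markov.

Section ParticleSystem.
Context {R : realType} {S : finType} {N : nat}.

Definition state : finType := {ffun 'I_N -> S}.

Definition replace_at (x : state) (i : 'I_N) (y : S) : state :=
  [ffun k => if k == i then y else x k].

Definition product_weight (m : S -> R) (x : state) : R := \prod_i m (x i).

Definition gen_component (L : S -> S -> R) (i : 'I_N) (phi : state -> R)
    (x : state) : R :=
  gen_apply L (fun y => phi (replace_at x i y)) (x i).

Definition particle_gen (lam : R -> R) (L : R -> S -> S -> R) (H : R -> S -> R)
    (t : R) (phi : state -> R) (x : state) : R :=
  lam t * (\sum_i gen_component (L t) i phi x) +
  N%:R^-1 * \sum_i \sum_j
    Num.max (H t (x i) - H t (x j)) 0 * (phi (replace_at x i (x j)) - phi x).

Definition empirical (x : state) : S -> R :=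
  fun y => N%:R^-1 * \sum_i (x i == y)%:R.

Definition weighted_empirical (H : R -> S -> R) (X : R -> state) (t : R) :
    S -> R :=
  fun y =>
    expR (- \int[lebesgue_measure]_(s in `[0, t]) pairing (H s) (empirical (X s)))
    * empirical (X t) y.

End ParticleSystem.
Arguments state S N : clear implicits.

(** Supremum of the quotients [num f / den f] over [f] in [F], for [den >= 0]:
    a zero denominator gives [+oo] if the numerator is positive and is
    disregarded otherwise; the supremum of no quotients at all is [0]. *)
Section QuotientSup.
Context {R : realType} {V : Type}.
Implicit Types (F : set V) (num den : V -> R).

Definition quotients F num den : set (\bar R) :=
  [set z | exists2 f, F f &
     (den f != 0 /\ z = (num f / den f)%:E) \/
     [/\ den f = 0, 0 < num f & z = +oo%E]].

Definition quotient_sup F num den : \bar R :=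
  if `[< quotients F num den = set0 >] then 0%E
  else ereal_sup (quotients F num den).

End QuotientSup.

(** Constants attached to one component [A] of the decomposition, at a fixed
    time, with [m] the full measure, [H] and [L] defined on all of [S].
    Functions on [A] are represented by functions on [S] of which only the
    restriction to [A] matters. *)
Section LocalConstants.
Context {R : realType} {S : finType}.
Variables (m H : S -> R) (L : S -> S -> R) (A : {set S}).
Implicit Types f : S -> R.

Let mA := cond m A.

Definition H_loc : S -> R := fun x => H x - pairing H mA.

Definition dirichlet f : R :=
  2^-1 * \sum_(x in A) \sum_(y in A) (f y - f x) ^+ 2 * L x y * mA x.

Definition calS0 : set (S -> R) :=
  [set f | pairing f mA = 0 /\ exists2 x, x \in A & f x != 0].

Definition calS1 : set (S -> R) :=
  [set f | pairing (fun x => f x ^+ 2) mA = 1 /\ exists2 x, x \in A & f x != 1].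

Definition const_A : \bar R :=
  quotient_sup calS0 (fun f => - pairing (fun x => H_loc x * f x ^+ 2) mA) dirichlet.

Definition const_B : \bar R :=
  quotient_sup calS0 (fun f => `|pairing (fun x => H_loc x * f x) mA| ^+ 2) dirichlet.

(* The library's [ln 0 = 0] yields the convention 0 log 0 = 0. *)
Definition const_gamma : \bar R :=
  quotient_sup calS1 (fun f => pairing (fun x => f x ^+ 2 * ln `|f x|) mA) dirichlet.

End LocalConstants.

Section GlobalConstants.
Context {R : realType} {S I : finType}.
Implicit Types (mu H : R -> S -> R) (L : R -> S -> S -> R) (Si : I -> {set S}).

Definition neg_dlog mu (t : R) (x : S) : R :=
  - derivative_from 0 (fun s => ln (mu s x)) t.

(* [I] is nonempty whenever the sets [Si i] cover a nonempty [S], so the base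
   value -oo is never reached. *)
Definition tilde_A mu H L Si (t : R) : \bar R :=
  \big[maxe/-oo%E]_(i : I) const_A (mu t) (H t) (L t) (Si i).

Definition tilde_B mu H L Si (t : R) : \bar R :=
  \big[maxe/-oo%E]_(i : I) const_B (mu t) (H t) (L t) (Si i).

Definition tilde_gamma mu L Si (t : R) : \bar R :=
  \big[maxe/-oo%E]_(i : I) const_gamma (mu t) (L t) (Si i).

Definition K mu H (t q : R) : R :=
  \int[lebesgue_measure]_(s in `[0, t]) Lp_norm (mu s) q (H s).

Definition tilde_K mu H Si (t q : R) : R :=
  \int[lebesgue_measure]_(s in `[0, t]) Lp_norm_max Si (mu s) q (H s).

Definition tilde_M mu Si (t : R) : R :=
  \big[Num.max/0]_(i : I)
    sup [set z | exists r s : R,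
           [/\ 0 <= r, r <= s, s <= t & z = mass (mu s) (Si i) / mass (mu r) (Si i)]].

Definition tilde_eps N d (Omega : measurableType d) (P : probability Omega R)
    (X : R -> Omega -> state S N) mu H Si (t p : R) : \bar R :=
  ereal_sup [set z | exists s : R, exists f : S -> R,
    [/\ 0 <= s <= t, Lp_norm_max Si (mu s) p f <= 1 &
        z = ('E_P[fun w =>
              (`|pairing f (weighted_empirical H (X ^~ w) s) - pairing f (mu s)| ^+ 2)%R])%E]].

Definition sup_osc H (t0 : R) : R := sup [set osc (H s) | s in `[0, t0]].

Definition exponent_const (p ptil r : R) : R :=
  ln (Num.max (Num.max ((2 * r - 1) / (p - 1)) ((2 * p - 2) / (p - 2)))
              (Num.max ((p - 1) / (ptil - 1)) ((2 * ptil - 2) / (ptil - 2)))).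

End GlobalConstants.

(* Main.v *)
(** Let [B_s(f, g)] be the expectation of the product of the integrals of [f] and
    [g] against the weighted empirical measure at time [s], and let [g_s], [h_s]
    solve the backward equation [- g' = lam L g - H g]. By the Feynman-Kac formula
    for the particle system, [N B_s(g_s, h_s) - B_s(1, g_s h_s)] has a time
    derivative that involves only the differences [H x - H y]. It is nonpositive
    when [g] and [h] live on different blocks, so different blocks are negatively
    correlated; in general it is controlled by [B_s(|H|, g_s^2)] and
    [B_s(1, |H| g_s^2)], which split into products of means and covariances inside
    the blocks. The latter are bounded by a constant times products of L^p norms
    over a block: the constants A and B propagate the L^p norm of [g_s], and the
    logarithmic Sobolev constant improves it to the L^(2 r) norm required by
    Hoelder's inequality as soon as [s] is at distance [2 / (17 omega)] from the
    final time. As [N] is large, the resulting inequality for the best covariance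
    constant is a contraction, and solving it gives the stated bound. *)

Require Import Defs.
From HB Require Import structures.
From mathcomp Require Import all_boot all_order all_algebra.
From mathcomp Require Import all_classical all_reals all_analysis measurable_realfun.
From mathcomp Require Import ring lra.

Set Implicit Arguments.
Unset Strict Implicit.
Unset Printing Implicit Defensive.

Import Order.TTheory GRing.Theory Num.Theory.
Import numFieldNormedType.Exports.

Local Open Scope classical_set_scope.
Local Open Scope ring_scope.

(** Two obstacles shape the argument. Negative correlation of blocks is available for nonnegative
    functions only, so a signed [f] enters the cross terms through the backward solution of [|f|],
    and covariance constants refer to nonnegative functions on one block. And Hoelder's inequality
    asks for [g_s] in [L^(2 r)], which the end value does not provide: on a last window of length at
    most [2 / (17 omega)] only the crude factor [exp (2 / 17) <= 9 / 8] is used, while before it the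
    log-Sobolev rate, calibrated by 17/4, has had exactly the time it needs. The p-norms lose
    [exp (1 / 7)], from the zero-order rate [1 / ((p + 3) t0)] with [p > 4]. The other constants
    follow: the squares of [exp (1 / 7)] and [exp (2 / 17 + 1 / 7)] are below 4/3 and 17/10, the
    feedback of the covariances into themselves is [(9 / 4 + 17 / 2 K) / N], and
    [N >= 40 max (K, 1)] makes it less than 27/100. To have two-sided derivatives at time 0, all
    time-dependent data are continued to negative times. *)

(** * Calculus on the line: derivatives, increments, primitives and a geometric series bound *)

Section Calculus.
Context {R : realType}.
Implicit Types (f g : R -> R) (t a b : R).

Lemma is_derive_continuous f t a : is_derive t 1 f a -> continuous_at t f.
Proof.
move=> [df _]; apply: differentiable_continuous.
exact/derivable1_diffP.
Qed.

Lemma is_derive_add f g t a b : is_derive t 1 f a -> is_derive t 1 g b ->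
  is_derive t 1 (fun s => f s + g s) (a + b).
Proof. by move=> df dg; exact: is_deriveD. Qed.

Lemma is_derive_opp f t a : is_derive t 1 f a ->
  is_derive t 1 (fun s => - f s) (- a).
Proof. by move=> df; exact: is_deriveN. Qed.

Lemma is_derive_sub f g t a b : is_derive t 1 f a -> is_derive t 1 g b ->
  is_derive t 1 (fun s => f s - g s) (a - b).
Proof. by move=> df dg; exact: is_deriveB. Qed.

Lemma is_derive_mul f g t a b : is_derive t 1 f a -> is_derive t 1 g b ->
  is_derive t 1 (fun s => f s * g s) (a * g t + f t * b).
Proof.
move=> df dg; apply: is_derive_eq.
by rewrite /GRing.scale /= addrC [g t * _]mulrC.
Qed.

Lemma is_derive_mull f t a c : is_derive t 1 f a ->
  is_derive t 1 (fun s => c * f s) (c * a).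
Proof.
move=> df; have := is_derive_mul (is_derive_cst c t 1) df.
by rewrite mul0r add0r.
Qed.

Lemma is_derive_mulr f t a c : is_derive t 1 f a ->
  is_derive t 1 (fun s => f s * c) (a * c).
Proof.
move=> df; have := is_derive_mul df (is_derive_cst c t 1).
by rewrite mulr0 addr0.
Qed.

Lemma is_derive_bigsum (T : Type) (r : seq T) (P : pred T)
    (F : T -> R -> R) (dF : T -> R) t :
  (forall x, P x -> is_derive t 1 (F x) (dF x)) ->
  is_derive t 1 (fun s => \sum_(x <- r | P x) F x s) (\sum_(x <- r | P x) dF x).
Proof.
move=> dFx; elim: r => [|x r IH].
  under eq_fun do rewrite big_nil.
  by rewrite big_nil; exact: is_derive_cst.
under eq_fun do rewrite big_cons.
rewrite big_cons; case: ifP => // Px.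
exact: is_derive_add (dFx _ Px) IH.
Qed.

Lemma is_derive_comp1 f g t a b : is_derive (g t) 1 f a -> is_derive t 1 g b ->
  is_derive t 1 (fun s => f (g s)) (a * b).
Proof. by move=> df dg; exact: is_derive1_comp. Qed.

Lemma continuous_for_mul (U : topologicalType) (f g : U -> R) (t : U) :
  continuous_at t f -> continuous_at t g -> continuous_at t (fun s => f s * g s).
Proof. exact: continuousM. Qed.

Lemma continuous_bigsum (U : topologicalType) (T : Type) (r : seq T) (P : pred T)
    (F : T -> U -> R) (t : U) :
  (forall x, P x -> continuous_at t (F x)) ->
  continuous_at t (fun s => \sum_(x <- r | P x) F x s).
Proof.
move=> cF; elim: r => [|x r IH].
  rewrite (_ : (fun s => _) = cst 0); first exact: cst_continuous.
  by apply/funext => s; rewrite big_nil.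
rewrite (_ : (fun s => _) = fun s => (if P x then F x s else 0) +
    \sum_(y <- r | P y) F y s); last first.
  by apply/funext => s; rewrite big_cons; case: ifP; rewrite ?add0r.
apply: continuousD IH.
by case: (P x) (cF x) => [/(_ isT)|_]; [exact|exact: cst_continuous].
Qed.

Lemma continuous_segment_within f a b : {in `[a, b], continuous f} ->
  {within `[a, b], continuous f}.
Proof. by move=> cf; apply: continuous_in_subspaceT => x; rewrite inE => /cf. Qed.

Lemma le_increment f g f' g' a b : a <= b ->
  (forall x, a < x < b -> is_derive x 1 f (f' x)) ->
  (forall x, a < x < b -> is_derive x 1 g (g' x)) ->
  {within `[a, b], continuous f} -> {within `[a, b], continuous g} ->
  (forall x, a < x < b -> f' x <= g' x) ->
  f b - f a <= g b - g a.
Proof.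
move=> ab df dg cf cg fg.
have D x : x \in `]a, b[ -> is_derive x 1 (fun s => g s - f s) (g' x - f' x).
  by rewrite in_itv/= => xab; exact: is_derive_sub (dg _ xab) (df _ xab).
have C : {within `[a, b], continuous (fun s => g s - f s)}.
  exact: within_continuousB.
(* [MVT_segment] covers [a = b] too, but its point may be an end point, where the derivatives are
   not compared; for [a < b] the point given by [MVT] is interior. *)
have [c + E] := MVT_segment ab D C.
rewrite in_itv/= => cab.
have : 0 <= (g' c - f' c) * (b - a).
  move: ab; rewrite le_eqVlt => /predU1P[->|ab]; first by rewrite subrr mulr0.
  have [c' c'ab E'] := MVT ab D C.
  rewrite -E E' mulr_ge0// ?subr_ge0 ?(ltW ab)//.
  by apply: fg; move: c'ab; rewrite in_itv.
rewrite -E; lra.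
Qed.

Lemma le_increment_closed f g f' g' a b : a <= b ->
  (forall x, a <= x <= b -> is_derive x 1 f (f' x)) ->
  (forall x, a <= x <= b -> is_derive x 1 g (g' x)) ->
  (forall x, a < x < b -> f' x <= g' x) ->
  f b - f a <= g b - g a.
Proof.
move=> ab df dg fg; apply: (@le_increment _ _ f' g') => //.
- by move=> x /andP[ax xb]; apply: df; rewrite !ltW.
- by move=> x /andP[ax xb]; apply: dg; rewrite !ltW.
- apply: continuous_segment_within => x; rewrite in_itv/= => /df.
  exact: is_derive_continuous.
- apply: continuous_segment_within => x; rewrite in_itv/= => /dg.
  exact: is_derive_continuous.
Qed.

Lemma is_derive0_constant f a b : a <= b ->
  (forall x, a <= x <= b -> is_derive x 1 f 0) -> f b = f a.
Proof.
move=> ab df; apply/eqP; rewrite eq_le; apply/andP; split.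
- have := @le_increment_closed f (cst 0) (cst 0) (cst 0) a b ab df.
  rewrite /cst subrr subr_le0; apply => // x _; exact: is_derive_cst.
- have := @le_increment_closed (cst 0) f (cst 0) (cst 0) a b ab.
  rewrite /cst subrr subr_ge0; apply => // x _; exact: is_derive_cst.
Qed.

Lemma continuous_clamp a b : continuous (fun s : R => Num.max a (Num.min b s)).
Proof.
move=> s; apply: continuous_max; first exact: cst_continuous.
by apply: continuous_min; [exact: cst_continuous|exact: cvg_id].
Qed.

Lemma clamp_itv a b s : a <= b -> a <= Num.max a (Num.min b s) <= b.
Proof. by move=> ab; rewrite le_max lexx/= ge_max ab/= ge_min lexx. Qed.

Lemma clamp_id a b s : a <= s <= b -> Num.max a (Num.min b s) = s.
Proof. by move=> /andP[a_s sb]; rewrite (min_idPr sb) (max_idPr a_s). Qed.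

Lemma continuous_segment_bounded f a b : {in `[a, b], continuous f} ->
  exists2 C, 0 < C & forall s, a <= s <= b -> `|f s| <= C.
Proof.
have [ab|ba] := leP a b; last first.
  by move=> _; exists 1 => // s /andP[a_s /(le_trans a_s)]; rewrite leNgt ba.
move=> cf; have cwf := continuous_segment_within cf.
have [c _ cmax] := EVT_max ab cwf.
have [d _ dmin] := EVT_min ab cwf.
exists (`|f c| + `|f d| + 1).
  by rewrite ltr_wpDl// addr_ge0.
move=> s sab; have sab' : s \in `[a, b] by rewrite in_itv.
have := cmax _ sab'; have := dmin _ sab'.
have := ler_norm (f c); have := ler_norm (- f d); rewrite normrN => *.
have := normr_ge0 (f c); have := normr_ge0 (f d) => *.
by rewrite ler_norml; apply/andP; split; lra.
Qed.

Lemma continuous_segment_bounded_fin (T : finType) (F : T -> R -> R) a b :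
  (forall x, {in `[a, b], continuous (F x)}) ->
  exists2 C, 0 < C & forall x s, a <= s <= b -> `|F x s| <= C.
Proof.
move=> cF.
have /choice[C HC] : forall x, exists C, 0 < C /\ forall s, a <= s <= b -> `|F x s| <= C.
  by move=> x; have [C] := continuous_segment_bounded (cF x); exists C.
exists (1 + \sum_x C x).
  by rewrite ltr_pwDl// sumr_ge0// => x _; case: (HC x) => /ltW.
move=> x s sab; have [_ /(_ _ sab) Hx] := HC x.
apply: (le_trans Hx); rewrite (bigD1 x)//=.
have : 0 <= \sum_(i | i != x) C i by rewrite sumr_ge0// => y _; case: (HC y) => /ltW.
lra.
Qed.

End Calculus.

Section ContinuityCombinators.
Context {R : realType} {U : topologicalType}.
Implicit Types (f g : U -> R) (t : U).

Lemma continuous_for_add f g t : continuous_at t f -> continuous_at t g ->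
  continuous_at t (fun s => f s + g s).
Proof. exact: continuousD. Qed.

Lemma continuous_for_sub f g t : continuous_at t f -> continuous_at t g ->
  continuous_at t (fun s => f s - g s).
Proof. exact: continuousB. Qed.

Lemma continuous_for_max f g t : continuous_at t f -> continuous_at t g ->
  continuous_at t (fun s => Num.max (f s) (g s)).
Proof. exact: continuous_max. Qed.

End ContinuityCombinators.

Section Primitive.
Context {R : realType}.
Implicit Types (k : R -> R) (t a b : R).

(* Starting the integral at -1 makes [0] an interior point. *)
Definition primitive k t : R := \int[lebesgue_measure]_(s in `[-1, t]) k s.

Lemma continuous_segment_integrable k a b : {in `[a, b], continuous k} ->
  lebesgue_measure.-integrable `[a, b] (EFin \o k).
Proof.
move=> ck; apply: continuous_compact_integrable; first exact: segment_compact.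
exact: continuous_segment_within.
Qed.

Lemma is_derive_primitive k t : continuous k -> -1 < t ->
  is_derive t 1 (primitive k) (k t).
Proof.
move=> ck t1.
have ik : lebesgue_measure.-integrable `[-1, t + 1] (EFin \o k).
  by apply: continuous_segment_integrable => x _; exact: ck.
have tt1 : t < t + 1 by rewrite ltrDl.
have [D E] := continuous_FTC1_closed tt1 ik t1 (ck t).
by split; [exact: D|rewrite -derive1E; exact: E].
Qed.

Lemma Rintegral_primitive k a b : continuous k -> -1 <= a -> a <= b ->
  \int[lebesgue_measure]_(s in `[a, b]) k s = primitive k b - primitive k a.
Proof.
move=> ck a1 ab; rewrite /primitive Rintegral_itvB.
- rewrite Rintegral_itv_obnd_cbnd//.
  apply: integrableS (continuous_segment_integrable (a := a) (b := b) (fun x _ => ck x)) => //.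
  exact: subset_itv_oc_cc.
- by apply: continuous_segment_integrable => x _; exact: ck.
- by rewrite bnd_simp.
- by rewrite bnd_simp.
Qed.

End Primitive.

Section Increments.
Context {R : realType}.
Implicit Types (f g : R -> R) (a b C : R).

Lemma norm_increment_le f g f' g' a b : a <= b ->
  (forall x, a <= x <= b -> is_derive x 1 f (f' x)) ->
  (forall x, a <= x <= b -> is_derive x 1 g (g' x)) ->
  (forall x, a < x < b -> `|f' x| <= g' x) ->
  `|f b - f a| <= g b - g a.
Proof.
move=> ab df dg fg; rewrite ler_norml; apply/andP; split.
- have dNf x : a <= x <= b -> is_derive x 1 (fun s => - f s) (- f' x).
    by move=> /df ?; exact: is_derive_opp.
  have := le_increment_closed ab dNf dg.
  move=> /(_ _)/wrap[|]; last lra.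
  by move=> x /fg; rewrite ler_norml => /andP[+ _]; rewrite lerNl.
- apply: (le_increment_closed ab df dg) => x /fg; exact: le_trans (ler_norm _).
Qed.

Lemma norm_increment_le_cst f f' a b C : a <= b ->
  (forall x, a <= x <= b -> is_derive x 1 f (f' x)) ->
  (forall x, a < x < b -> `|f' x| <= C) ->
  `|f b - f a| <= C * (b - a).
Proof.
move=> ab df fC; rewrite mulrBr.
apply: (norm_increment_le (g := fun s => C * s) (g' := cst C) ab df) => //.
by move=> x _; rewrite -[X in is_derive _ _ _ X]mulr1; exact: is_derive_mull.
Qed.

Lemma norm_increment_le_open f f' a b C : a <= b ->
  (forall x, a < x < b -> is_derive x 1 f (f' x)) ->
  {within `[a, b], continuous f} ->
  (forall x, a < x < b -> `|f' x| <= C) ->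
  `|f b - f a| <= C * (b - a).
Proof.
move=> ab df cf fc.
have dc (k s : R) : is_derive s 1 (fun s : R => k * s) k.
  by rewrite -[X in is_derive _ _ _ X]mulr1; exact: is_derive_mull.
have cc (k : R) : {within `[a, b], continuous (fun s : R => k * s)}.
  apply: continuous_segment_within => s _; exact: is_derive_continuous (dc k s).
rewrite mulrBr; apply/ler_normlP; split.
- have := le_increment (f' := cst (- C)) ab (fun s _ => dc (- C) s) df (cc (- C)) cf.
  rewrite !mulNr => /(_ _)/wrap[|]; last lra.
  by move=> s /fc/ler_normlP[? ?]; rewrite /cst; lra.
- apply: (le_increment ab df (fun s _ => dc C s) cf (cc C)) => s /fc.
  by move=> /ler_normlP[].
Qed.

(** The increments of the partial sums are dominated by the telescoping differences
    [2 M (2^-n - 2^-(n + m))], a bound that survives the limit in [m]. The explicit tail is what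
    makes the Picard series converge uniformly. *)
Lemma series_half_cvg (u : R^nat) M : (forall n, `|u n| <= M * 2^-1 ^+ n) ->
  exists l : R, series u @ \oo --> l /\
    forall n, `|l - series u n| <= 2 * M * 2^-1 ^+ n.
Proof.
move=> uM.
have half1 : `|2^-1 : R| < 1 by rewrite ger0_norm ?invr_ge0// invf_lt1// ltr1n.
have cu : cvgn (series u).
  apply: normed_cvg; apply: (@series_le_cvg _ _ (geometric M 2^-1)) => //.
  - by move=> n; apply: normr_ge0.
  - by move=> n; apply: le_trans (uM n).
  - exact: is_cvg_geometric_series.
exists (limn (series u)); split => // n.
have incr m : `|series u (n + m)%N - series u n| <= 2 * M * (2^-1 ^+ n - 2^-1 ^+ (n + m)).
  elim: m => [|m IH]; first by rewrite addn0 !subrr normr0 mulr0.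
  rewrite addnS seriesSr -addrAC.
  apply: (le_trans (ler_normD _ _)); apply: (le_trans (lerD IH (uM _))).
  by rewrite exprS; lra.
have M0 : 0 <= M by have := uM 0%N; rewrite expr0 mulr1; apply: le_trans.
have bnd m : (n <= m)%N -> `|series u m - series u n| <= 2 * M * 2^-1 ^+ n.
  move=> nm; rewrite -(subnKC nm); apply: (le_trans (incr _)).
  apply: ler_wpM2l; first by rewrite mulr_ge0.
  by rewrite lerBlDr lerDl exprn_ge0// invr_ge0.
rewrite ler_norml; apply/andP; split.
- rewrite lerBrDr; apply: limr_ge => //; near=> m.
  have := bnd m; rewrite ler_norml => /(_ _)/andP[]; last by rewrite lerBrDr.
  by near: m; exact: nbhs_infty_ge.
- rewrite lerBlDr; apply: limr_le => //; near=> m.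
  have := bnd m; rewrite ler_norml => /(_ _)/andP[]; last by rewrite lerBlDr.
  by near: m; exact: nbhs_infty_ge.
Unshelve. all: by end_near. Qed.

End Increments.

(** * Linear differential systems *)

(* Picard iteration; the terms of the series are controlled in the norm
   weighted by [exp (2 k |t - t1|)], in which each step halves the norm. *)
Section LinearODE.
Context {R : realType} {T : finType}.
Variables (A : R -> T -> T -> R) (b t1 : R) (v : T -> R).
Implicit Types (s t c : R) (x y : T).
Hypothesis A_cont : forall x y, continuous (fun s => A s x y).
Hypothesis t1b : 0 <= t1 <= b.

Let b0 : 0 <= b. Proof. by case/andP: t1b; exact: le_trans. Qed.

Let cl s := Num.max 0 (Num.min b s).

Let cl_itv s : 0 <= cl s <= b. Proof. exact: clamp_itv. Qed.

Let cl_gtN1 s : -1 < cl s.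
Proof. by case/andP: (cl_itv s) => + _; apply: lt_le_trans; lra. Qed.

(** Clamping times into [[0, b]] makes each integrand continuous on the whole line, so that the
    primitives are differentiable from both sides at 0 and at [b]. *)
Fixpoint picard_term n t x : R :=
  if n is m.+1 then
    let k s := \sum_y A (cl s) x y * picard_term m (cl s) y in
    primitive k t - primitive k t1
  else v x.

Let k (w : R -> T -> R) x s := \sum_y A (cl s) x y * w (cl s) y.

Let continuous_k (w : R -> T -> R) x :
  (forall (s : R) y, -1 < s -> continuous_at s (w ^~ y)) ->
  continuous (k w x).
Proof.
move=> cw s; apply: continuous_bigsum => y _; apply: continuous_for_mul.
- apply: (@continuous_comp _ _ _ cl (fun s => A s x y)); last exact: A_cont.
  exact: continuous_clamp.
- apply: (@continuous_comp _ _ _ cl (w ^~ y)); last exact: cw.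
  exact: continuous_clamp.
Qed.

Let is_derive_integral (w : R -> T -> R) x t c :
  (forall (s : R) y, -1 < s -> continuous_at s (w ^~ y)) -> -1 < t ->
  is_derive t 1 (fun t => primitive (k w x) t - c) (k w x t).
Proof.
move=> cw tN1; rewrite -[X in is_derive _ _ _ X]subr0; apply: is_derive_sub.
by apply: is_derive_primitive => //; exact: continuous_k.
Qed.

Let continuous_term n (t : R) x : -1 < t -> continuous_at t (picard_term n ^~ x).
Proof.
elim: n t x => [|n IH] t x tN1; first exact: cst_continuous.
by apply: is_derive_continuous; exact: is_derive_integral.
Qed.

(** The prescribed time [t1] may lie anywhere in [[0, b]]: backward equations take [t1 = b], the
    forward law of the particle system takes [t1 = 0]. *)
Lemma linear_ode_exists : exists u : R -> T -> R,
  (forall x, u t1 x = v x) /\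
  (forall t x, 0 <= t <= b ->
    is_derive t 1 (u ^~ x) (\sum_y A t x y * u t y)).
Proof.
have [C C0 AC] : exists2 C, 0 < C & forall (xy : T * T) s, 0 <= s <= b ->
    `|A s xy.1 xy.2| <= C.
  by apply: continuous_segment_bounded_fin => -[x y] s _; exact: A_cont.
pose K := C * #|T|%:R + 1.
have K0 : 0 < K by rewrite ltr_wpDl// mulr_ge0// ltW.
pose V := \sum_x `|v x|.
have V0 : 0 <= V by exact: sumr_ge0.
have kK w x s M : (forall y, `|w (cl s) y| <= M) -> `|k w x s| <= K * M.
  move=> wM; apply: (le_trans (ler_norm_sum _ _ _)).
  apply: (@le_trans _ _ (\sum_(y : T) C * M)).
    apply: ler_sum => y _; rewrite normrM; apply: ler_pM => //.
    by apply: (AC (x, y)); exact: cl_itv.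
  rewrite sumr_const -mulr_natl mulrA [_ * C]mulrC ler_wpM2r//.
    by have [y _|T0] := pickP T; [exact: le_trans (wM x)|exact: le_trans (wM x)].
  by rewrite lerDl.
have term_bound n t x : 0 <= t <= b ->
    `|picard_term n t x| <= V * 2^-1 ^+ n * expR (2 * K * `|t - t1|).
  elim: n t x => [|n IH] t x tb.
    rewrite /= expr0 mulr1; apply: (@le_trans _ _ V).
      by rewrite /V (bigD1 x)//= lerDl sumr_ge0.
    by rewrite ler_peMr// -expR0 ler_expR !mulr_ge0// ltW.
  pose W := V * 2^-1 ^+ n.+1.
  have W0 : 0 <= W by rewrite mulr_ge0// exprn_ge0// invr_ge0.
  have tt1 : picard_term n.+1 t1 x = 0 by rewrite /= subrr.
  have d s : 0 <= s <= b ->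
      is_derive s 1 (picard_term n.+1 ^~ x) (k (picard_term n) x s).
    move=> /andP[s0 _]; apply: is_derive_integral; first exact: continuous_term.
    by apply: lt_le_trans s0; lra.
  have kb s : 0 <= s <= b -> `|k (picard_term n) x s| <=
      W * (2 * K * expR (2 * K * `|s - t1|)).
    move=> sb; apply: (le_trans (kK _ _ _ (V * 2^-1 ^+ n * expR (2 * K * `|s - t1|)) _)).
      by move=> y; rewrite /cl clamp_id//; exact: IH.
    by rewrite /W exprS; lra.
  have dexp c s : is_derive s 1 (fun s => W * expR (c * (s - t1)))
      (W * (c * expR (c * (s - t1)))).
    apply: is_derive_mull; rewrite [X in is_derive _ _ _ X]mulrC.
    apply: is_derive_comp1; rewrite -[X in is_derive _ _ _ X]mulr1.
    apply: is_derive_mull; rewrite -[X in is_derive _ _ _ X]subr0.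
    exact: is_derive_sub.
  case/andP: tb => t0 tb; case/andP: (t1b) => t10 t1b'.
  have [lt|lt] := leP t1 t.
  - have : `|picard_term n.+1 t x - picard_term n.+1 t1 x| <=
        W * expR (2 * K * (t - t1)) - W * expR (2 * K * (t1 - t1)).
      apply: (@norm_increment_le _ (picard_term n.+1 ^~ x)
        (fun s => W * expR (2 * K * (s - t1))) (k (picard_term n) x)
        (fun s => W * (2 * K * expR (2 * K * (s - t1)))) _ _ lt) => //.
      + by move=> s /andP[s1 s2]; apply: d; apply/andP; split; lra.
      + move=> s /andP[s1 s2]; apply: (le_trans (kb s _)); first by apply/andP; split; lra.
        by rewrite ger0_norm// subr_ge0 ltW.
    rewrite tt1 subr0 => /le_trans; apply; rewrite subrr mulr0 expR0 mulr1.
    rewrite ger0_norm ?subr_ge0// -/W; lra.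
  - have : `|picard_term n.+1 t1 x - picard_term n.+1 t x| <=
        - (W * expR (- (2 * K) * (t1 - t1))) - - (W * expR (- (2 * K) * (t - t1))).
      apply: (@norm_increment_le _ (picard_term n.+1 ^~ x)
        (fun s => - (W * expR (- (2 * K) * (s - t1)))) (k (picard_term n) x)
        (fun s => - (W * (- (2 * K) * expR (- (2 * K) * (s - t1))))) _ _ (ltW lt)).
      + by move=> s /andP[s1 s2]; apply: d; apply/andP; split; lra.
      + move=> s /andP[s1 s2]; apply: (le_trans (kb s _)); first by apply/andP; split; lra.
        rewrite ltr0_norm ?subr_lt0// mulrN -mulNr.
        by rewrite [- (2 * K) * expR _]mulNr mulrN opprK.
    rewrite tt1 sub0r normrN => /le_trans; apply; rewrite subrr mulr0 expR0 mulr1 opprK.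
    rewrite ltr0_norm ?subr_lt0// mulrN -mulNr -/W; lra.
pose M := V * expR (2 * K * b).
have M0 : 0 <= M by rewrite mulr_ge0// expR_ge0.
have unif n t x : 0 <= t <= b -> `|picard_term n t x| <= M * 2^-1 ^+ n.
  move=> tb; apply: (le_trans (term_bound n t x tb)).
  rewrite mulrAC ler_wpM2r// ?exprn_ge0// ?invr_ge0//.
  rewrite /M ler_wpM2l// ler_expR ler_wpM2l ?mulr_ge0 ?(ltW K0)//.
  by case/andP: tb t1b => ? ? /andP[? ?]; rewrite ler_norml; apply/andP; split; lra.
pose S n t x := series (fun m => picard_term m (cl t) x) n.
have cl_cl s : cl (cl s) = cl s by rewrite /cl clamp_id// cl_itv.
have /choice[u0 Hu0] : forall tx : R * T, exists l : R,
    forall n, `|l - S n tx.1 tx.2| <= 2 * M * 2^-1 ^+ n.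
  move=> [t x]; have [l [_ lS]] := series_half_cvg (fun n => unif n (cl t) x (cl_itv t)).
  by exists l.
pose u t x := u0 (cl t, x).
have S_cl n t x : S n (cl t) x = S n t x by rewrite /S cl_cl.
have Hu t x n : `|u t x - S n t x| <= 2 * M * 2^-1 ^+ n.
  by rewrite -S_cl; exact: (Hu0 (cl t, x)).
have halves : (fun n => 2 * M * 2^-1 ^+ n) @ \oo --> (0 : R).
  by apply: cvg_geometric; rewrite ger0_norm ?invr_ge0// invf_lt1// ltr1n.
have cS n (t : R) x : continuous_at t (S n ^~ x).
  apply: continuous_bigsum => m _.
  apply: (@continuous_comp _ _ _ cl (picard_term m ^~ x)).
    exact: continuous_clamp.
  exact: continuous_term.
have cu (t : R) x : continuous_at t (u ^~ x).
  apply/cvgrPdist_lt => e e0.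
  have e4 : 0 < e / 4 by lra.
  have /cvgrPdist_lt/(_ _ e4) := halves; move=> [n _ /(_ n (leqnn n))/=].
  rewrite sub0r normrN => /(le_lt_trans (ler_norm _)) nbnd.
  have /cvgrPdist_lt/(_ _ e4) := cS n t x.
  apply: filterS => s Ss.
  have := Hu t x n; have := Hu s x n; move: Ss nbnd.
  move=> /ltr_normlP[? ?] ? /ler_normlP[? ?] /ler_normlP[? ?].
  by apply/ltr_normlP; split; lra.
have cu1 (s : R) x : -1 < s -> continuous_at s (u ^~ x) by move=> _; exact: cu.
(* The uniform limit [u] is so far only continuous. The right-hand side [y] of the integral equation
   is differentiable by construction, and it will turn out to equal [u] on [[0, b]]. *)
pose y t x := v x + (primitive (k u x) t - primitive (k u x) t1).
have dy t x : 0 <= t <= b -> is_derive t 1 (y ^~ x) (k u x t).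
  move=> /andP[tb _]; rewrite -[X in is_derive _ _ _ X]add0r; apply: is_derive_add.
  by apply: is_derive_integral => //; apply: lt_le_trans tb; lra.
have yu t x : 0 <= t <= b -> y t x = u t x.
  move=> tb; apply/eqP; rewrite -subr_eq0 -normr_le0; apply/ler_addgt0Pr => e e0; rewrite add0r.
  (* The tail error [e / c] enters twice, once directly and once multiplied by [K] and integrated
     over a time at most [b]. *)
  pose c := 1 + K * b; have c0 : 0 < c by rewrite ltr_pwDl// mulr_ge0// ltW.
  have ec : 0 < e / c by rewrite divr_gt0.
  have /cvgrPdist_lt/(_ _ ec)[n _ nbnd] := halves.
  have nb m : (n <= m)%N -> 2 * M * 2^-1 ^+ m <= e / c.
    by move=> /nbnd/=; rewrite sub0r normrN => /(le_lt_trans (ler_norm _))/ltW.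
  pose Sr t := series (fun m => picard_term m t x) n.+1.
  have SrE s : Sr s = v x + \sum_(0 <= m < n) picard_term m.+1 s x.
    by rewrite /Sr /series/= big_nat_recl.
  have dSr s : 0 <= s <= b -> is_derive s 1 Sr (k (S n) x s).
    move=> /andP[s0 _]; rewrite (funext SrE) -[X in is_derive _ _ _ X]add0r.
    apply: is_derive_add.
    rewrite (_ : k (S n) x s = \sum_(0 <= m < n) k (picard_term m) x s).
      apply: is_derive_bigsum => m _; apply: is_derive_integral.
        exact: continuous_term.
      by apply: lt_le_trans s0; lra.
    rewrite exchange_big/=; apply: eq_bigr => z _.
    by rewrite /S /series/= mulr_sumr; apply: eq_bigr => m _; rewrite cl_cl.
  have dyS s : 0 <= s <= b ->
      is_derive s 1 (fun s => y s x - Sr s) (k u x s - k (S n) x s).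
    by move=> sb; apply: is_derive_sub; [exact: dy|exact: dSr].
  have y1 : y t1 x - Sr t1 = 0.
    by rewrite SrE /y subrr addr0 big1 ?addr0 ?subrr// => m _; rewrite /= subrr.
  have kuS s : `|k u x s - k (S n) x s| <= K * (e / c).
    rewrite /k -sumrB; under eq_bigr do rewrite -mulrBr.
    apply: (kK (fun s z => u s z - S n s z)) => z.
    by apply: (le_trans (Hu _ _ n)); exact: nb.
  have Ke0 : 0 <= K * (e / c) by rewrite mulr_ge0// ltW.
  have yS : `|y t x - Sr t| <= K * (e / c) * b.
    case/andP: (t1b) => t10 t1b'; case/andP: (tb) => t0 tb'.
    have [lt|lt] := leP t1 t.
    - have : `|(y t x - Sr t) - (y t1 x - Sr t1)| <= K * (e / c) * (t - t1).
        apply: (@norm_increment_le_cst _ (fun s => y s x - Sr s) (fun s => k u x s - k (S n) x s) _ _ _ lt) => //.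
        by move=> s /andP[s1 s2]; apply: dyS; apply/andP; split; lra.
      rewrite y1 subr0 => /le_trans; apply; apply: ler_wpM2l => //; lra.
    - have : `|(y t1 x - Sr t1) - (y t x - Sr t)| <= K * (e / c) * (t1 - t).
        apply: (@norm_increment_le_cst _ (fun s => y s x - Sr s) (fun s => k u x s - k (S n) x s) _ _ _ (ltW lt)) => //.
        by move=> s /andP[s1 s2]; apply: dyS; apply/andP; split; lra.
      rewrite y1 sub0r normrN => /le_trans; apply; apply: ler_wpM2l => //; lra.
  have SrS : S n.+1 t x = Sr t by rewrite /S /Sr /cl clamp_id.
  have := le_trans (Hu t x n.+1) (nb _ (leqnSn n)); rewrite SrS => uS.
  rewrite (_ : y t x - u t x = (y t x - Sr t) - (u t x - Sr t)); last by ring.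
  apply: (le_trans (ler_normB _ _)).
  have -> : e = K * (e / c) * b + e / c by rewrite /c; field; rewrite gt_eqF.
  exact: lerD.
exists y; split=> [x|t x tb]; first by rewrite /y subrr addr0.
rewrite (_ : \sum_ _ _ = k u x t); first exact: dy.
by rewrite /k /cl clamp_id//; apply: eq_bigr => z _; rewrite yu.
Qed.

End LinearODE.

(** * A maximum principle for finite linear systems *)

Section MaximumPrinciple.
Context {R : realType}.

(** Squaring makes the negative part differentiable across 0, which permits an energy argument for
    the maximum principle. *)
Lemma is_derive_sqr_min0 (r : R) :
  is_derive r 1 (fun s : R => Num.min s 0 ^+ 2) (2 * Num.min r 0).
Proof.
have [r0|r0|->] := ltgtP r 0.
- apply: (@near_eq_is_derive _ _ _ (fun s : R => s * s)).
    near=> s; rewrite (min_idPl _) ?expr2//; near: s.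
    by apply: (cvgr_le r) => //; exact: cvg_id.
  apply: (is_derive_eq (is_derive_mul (is_derive_id r 1) (is_derive_id r 1))).
  by rewrite mul1r mulr1; ring.
- apply: (@near_eq_is_derive _ _ _ (cst 0)).
    near=> s; rewrite (min_idPr _) ?expr0n//; near: s.
    by apply: (cvgr_ge r) => //; exact: cvg_id.
  by rewrite mulr0; exact: is_derive_cst.
- rewrite mulr0.
  pose f (s : R) := Num.min s 0 ^+ 2.
  have D : (fun h : R => h^-1 *: (f (h *: (1 : R) + 0) - f 0)) @ (0 : R)^' --> (0 : R).
    apply/cvgrPdist_le => e e0; near=> h.
    rewrite /f minxx expr0n/= subr0 sub0r normrN addr0 /GRing.scale/= mulr1.
    have h0 : h != 0 by near: h; exact: nbhs_dnbhs_neq.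
    apply: (@le_trans _ _ `|h|).
      rewrite normrM normfV ler_pdivrMl ?normr_gt0// -normrM ler_normr.
      rewrite ger0_norm ?sqr_ge0//; apply/orP; left.
      by case: (leP h 0) => ?; rewrite expr2// mul0r mulr_ge0// ltW.
    near: h; apply: dnbhs0_le => //.
  split; first by apply/cvg_ex; exists 0; exact: D.
  exact: cvg_lim.
Unshelve. all: by end_near. Qed.

Context {T : finType}.
Variables (A : R -> T -> T -> R) (b : R) (w dw : R -> T -> R).
Implicit Types (s : R) (x y z : T).
Hypothesis A_cont : forall x y, continuous (fun s => A s x y).
Hypothesis A_ge0 : forall s x y, 0 <= s <= b -> x != y -> 0 <= A s x y.
Hypothesis w_derive : forall s x, 0 <= s <= b ->
  is_derive s 1 (w ^~ x) (dw s x).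
Hypothesis w_supersol : forall s x, 0 <= s <= b ->
  \sum_y A s x y * w s y <= - dw s x.
Hypothesis w_end : forall x, 0 <= w b x.

(** Energy estimate: the sum [n] of the squared negative parts of [w] is such that
    [expR (K * r) * n r] increases in [r], and it vanishes at time [b], hence at all earlier
    times. *)
Lemma maximum_principle s x : 0 <= s <= b -> 0 <= w s x.
Proof.
move=> sb.
have [C C0 AC] : exists2 C, 0 < C & forall (xy : T * T) s, 0 <= s <= b ->
    `|A s xy.1 xy.2| <= C.
  by apply: continuous_segment_bounded_fin => -[y z] r _; exact: A_cont.
pose m r y := Num.min (w r y) 0.
pose n r := \sum_y m r y ^+ 2.
pose K := 2 * C * #|T|%:R.
have m_le0 r y : m r y <= 0 by rewrite /m ge_min lexx orbT.
have dn r : 0 <= r <= b -> is_derive r 1 n (\sum_y 2 * m r y * dw r y).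
  move=> rb; apply: is_derive_bigsum => y _.
  exact: (is_derive_comp1 (is_derive_sqr_min0 (w r y)) (w_derive y rb)).
have dn_ge r : 0 <= r <= b -> 0 <= K * n r + \sum_y 2 * m r y * dw r y.
  move=> rb.
  have H y : - \sum_z C * (m r y ^+ 2 + m r z ^+ 2) <= 2 * m r y * dw r y.
    have : 2 * m r y * - (\sum_z A r y z * w r z) <= 2 * m r y * dw r y.
      have := w_supersol y rb; have := m_le0 r y; nra.
    apply: le_trans; rewrite mulrN lerN2 mulr_sumr; apply: ler_sum => z _.
    have Ayz := AC (y, z) r rb; have {Ayz} := Ayz; rewrite /= => /ler_normlP[Al Au].
    (* Replace [w] by its negative part: off the diagonal because [m r y <= 0 <= A] and [m <= w], on
       the diagonal with equality because [m] vanishes where [w] is positive. *)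
    apply: (@le_trans _ _ (2 * m r y * (A r y z * m r z))).
      have [->|yz] := eqVneq y z.
        by rewrite /m; case: (leP (w r z) 0) => //; rewrite !mulr0 mul0r.
      rewrite -subr_le0 -mulrBr mulr_le0_ge0//; first by have := m_le0 r y; lra.
      by rewrite -mulrBr mulr_ge0 ?A_ge0// subr_ge0 /m ge_min lexx.
    have Al' : 0 <= C + A r y z by lra.
    have Au' : 0 <= C - A r y z by lra.
    have := mulr_ge0 Al' (sqr_ge0 (m r y - m r z)).
    have := mulr_ge0 Au' (sqr_ge0 (m r y + m r z)).
    nra.
  have -> : K * n r = \sum_y \sum_z C * (m r y ^+ 2 + m r z ^+ 2).
    under eq_bigr do rewrite -mulr_sumr big_split/= sumr_const.
    rewrite -mulr_sumr big_split/= sumr_const sumrMnl.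
    rewrite -/(n r) /K -[n r *+ _]mulr_natl; ring.
  rewrite -big_split/=; apply: sumr_ge0 => y _; have := H y; lra.
have ds r : 0 <= r <= b -> is_derive r 1 (fun r => expR (K * r) * n r)
    (expR (K * r) * (K * n r + \sum_y 2 * m r y * dw r y)).
  move=> rb.
  have dK : is_derive r 1 (fun r => expR (K * r)) (expR (K * r) * (K * 1)).
    by apply: is_derive_comp1; apply: is_derive_mull.
  by apply: (is_derive_eq (is_derive_mul dK (dn r rb))); ring.
have nb : n b = 0.
  by rewrite /n big1// => y _; rewrite /m (min_idPr (w_end y)) expr0n.
have ns : n s = 0.
  apply/eqP; rewrite eq_le sumr_ge0 ?andbT; last by move=> y _; exact: sqr_ge0.
  case/andP: sb => s0 sb.
  have : cst (0 : R) b - cst 0 s <= expR (K * b) * n b - expR (K * s) * n s.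
    apply: (@le_increment_closed _ (cst 0) (fun r => expR (K * r) * n r) (cst 0)
      (fun r => expR (K * r) * (K * n r + \sum_y 2 * m r y * dw r y)) s b sb).
    - by move=> r /andP[sr rb]; apply: ds; rewrite rb (le_trans s0).
    - move=> r /andP[sr rb]; rewrite mulr_ge0 ?expR_ge0// dn_ge//.
      by rewrite (ltW rb) (le_trans s0)// ltW.
  by rewrite /cst subrr nb mulr0 sub0r oppr_ge0 pmulr_rle0 ?expR_gt0.
rewrite leNgt; apply/negP => wx.
have : 0 < n s.
  rewrite /n (bigD1 x)//= ltr_pwDl//; last by apply: sumr_ge0 => y _; exact: sqr_ge0.
  by rewrite /m (min_idPl (ltW wx)) lt0r sqr_ge0 sqrf_eq0 lt_eqF.
by rewrite ns ltxx.
Qed.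

End MaximumPrinciple.

(** * Integrals of bounded measurable functions over sets of finite measure *)

Section BoundedIntegrals.
Context d (T : measurableType d) {R : realType} (mu : {measure set T -> \bar R}).
Context (D : set T) (mD : measurable D) (finD : (mu D < +oo)%E).
Implicit Types (f g : T -> R) (C : R).

(** Unlike integrability, this property is stable under products, which the multiplicative weights
    along a path require. *)
Definition bounded_measurable f : Prop :=
  measurable_fun D f /\ exists C, forall x, D x -> `|f x| <= C.

Lemma bounded_measurable_integrable f : bounded_measurable f ->
  mu.-integrable D (EFin \o f).
Proof.
move=> [mf [C fC]]; apply: measurable_bounded_integrable => //.
exists C; split; first exact: num_real.
by move=> M CM x Dx; exact: le_trans (fC _ Dx) (ltW CM).
Qed.

Lemma bounded_measurable_cst c : bounded_measurable (cst c).
Proof. by split=> //; exists `|c|. Qed.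

Lemma bounded_measurableD f g : bounded_measurable f -> bounded_measurable g ->
  bounded_measurable (fun x => f x + g x).
Proof.
move=> [mf [C fC]] [mg [C' gC]]; split; first exact: measurable_funD.
exists (C + C') => x Dx; apply: (le_trans (ler_normD _ _)).
by apply: lerD; [exact: fC|exact: gC].
Qed.

Lemma bounded_measurableM f g : bounded_measurable f -> bounded_measurable g ->
  bounded_measurable (fun x => f x * g x).
Proof.
move=> [mf [C fC]] [mg [C' gC]]; split; first exact: measurable_funM.
exists (C * C') => x Dx; rewrite normrM.
by apply: ler_pM => //; [exact: fC|exact: gC].
Qed.

Lemma bounded_measurable_sum (I : Type) (r : seq I) (P : pred I) (F : I -> T -> R) :
  (forall i, P i -> bounded_measurable (F i)) ->
  bounded_measurable (fun x => \sum_(i <- r | P i) F i x).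
Proof.
move=> FI; elim: r => [|i r IH].
  under eq_fun do rewrite big_nil.
  exact: bounded_measurable_cst.
under eq_fun do rewrite big_cons.
case: (boolP (P i)) => Pi //.
by apply: bounded_measurableD => //; exact: FI.
Qed.

Lemma bounded_measurable_prod (I : Type) (r : seq I) (P : pred I) (F : I -> T -> R) :
  (forall i, P i -> bounded_measurable (F i)) ->
  bounded_measurable (fun x => \prod_(i <- r | P i) F i x).
Proof.
move=> FI; elim: r => [|i r IH].
  under eq_fun do rewrite big_nil.
  exact: bounded_measurable_cst.
under eq_fun do rewrite big_cons.
case: (boolP (P i)) => Pi //.
by apply: bounded_measurableM => //; exact: FI.
Qed.

Lemma bounded_measurable_indic (A : set T) : measurable A ->
  bounded_measurable (\1_A : T -> R).
Proof.
move=> mA; split; first exact: measurable_indic.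
by exists 1 => x _; rewrite indicE; case: (_ \in _); rewrite ?normr1 ?normr0.
Qed.

Lemma Rintegral_sum (I : Type) (r : seq I) (P : pred I) (F : I -> T -> R) :
  (forall i, P i -> bounded_measurable (F i)) ->
  \int[mu]_(x in D) (\sum_(i <- r | P i) F i x) =
  \sum_(i <- r | P i) \int[mu]_(x in D) F i x.
Proof.
move=> FI; elim: r => [|i r IH].
  rewrite big_nil; under eq_Rintegral do rewrite big_nil.
  by rewrite Rintegral_cst// mul0r.
rewrite big_cons -IH; under eq_Rintegral do rewrite big_cons.
case: (boolP (P i)) => Pi //.
rewrite RintegralD//; apply: bounded_measurable_integrable; first exact: FI.
exact: bounded_measurable_sum.
Qed.

(** The first conclusion is how the path functionals are shown to be measurable: neither
    [s |-> V s (w s)] nor the exponential weight comes with a measurability assumption. *)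
Lemma bounded_convergence (F : nat -> T -> R) f C :
  (forall n, measurable_fun D (F n)) ->
  (forall n x, D x -> `|F n x| <= C) ->
  (forall x, D x -> F ^~ x @ \oo --> f x) ->
  bounded_measurable f /\
  (fun n => \int[mu]_(x in D) F n x) @ \oo --> \int[mu]_(x in D) f x.
Proof.
move=> mF FC Ff.
have mf : measurable_fun D f.
  exact: (@measurable_fun_cvg _ _ _ _ F).
have bf : bounded_measurable f.
  split=> //; exists C => x Dx.
  have cn : (fun n => `|F n x|) @ \oo --> `|f x| by apply: cvg_norm; exact: Ff.
  rewrite -(cvg_lim _ cn)//; apply: limr_le; first by apply/cvg_ex; exists `|f x|.
  by near=> n; exact: FC.
split=> //.
have FI n : bounded_measurable (F n) by split=> //; exists C; exact: FC.
have cC : mu.-integrable D (EFin \o cst C).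
  by apply: bounded_measurable_integrable; exact: bounded_measurable_cst.
have [_ _ H] : [/\ mu.-integrable D (EFin \o f),
    (\int[mu]_(x in D) `|(F n x)%:E - (f x)%:E|)%E @[n --> \oo] --> 0%E &
    (\int[mu]_(x in D) (F n x)%:E)%E @[n --> \oo] --> (\int[mu]_(x in D) (f x)%:E)%E].
  apply: (@dominated_convergence _ _ _ mu D mD (fun n => EFin \o F n) (EFin \o f)
    (EFin \o cst C)) => //.
  - by move=> n; exact/measurable_EFinP.
  - exact/measurable_EFinP.
  - by apply: aeW => x Dx; apply: cvg_EFin; [exact: nearW|exact: Ff].
  - by apply: aeW => x n Dx; rewrite lee_fin; exact: FC.
have fi g : bounded_measurable g ->
    (\int[mu]_(x in D) (g x)%:E)%E = (\int[mu]_(x in D) g x)%:E.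
  move=> bg; rewrite fineK//; apply: integrable_fin_num => //.
  exact: bounded_measurable_integrable.
by apply: fine_cvg; rewrite fi// in H.
Unshelve. all: by end_near. Qed.

End BoundedIntegrals.

(** * The Feynman-Kac formula *)

(* Riemann sums of [s |-> V s (w s)] in which the state is frozen at the right
   end point of each subinterval: right-continuity of the path makes the
   integrands converge pointwise, without any assumption on left limits. *)
Section FrozenPath.
Context {R : realType} {T : finType}.
Variables (V : R -> T -> R) (w : R -> T) (t : R).
Implicit Types (s : R) (x : T) (n k : nat).
Hypothesis V_cont : forall x, continuous (V ^~ x).
Hypothesis w_right : right_continuous_path w.
Hypothesis t_ge0 : 0 <= t.

Definition grid n k : R := k%:R * (t / n.+1%:R).

Local Notation mu := (@lebesgue_measure R).
Let D : set R := `[0, t[%classic.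

Definition frozen n s : R :=
  \sum_(k < n.+1) ((V ^~ (w (grid n k.+1))) \_ (`[grid n k, grid n k.+1[%classic)) s.

Lemma grid_ge0 n k : 0 <= grid n k.
Proof. by rewrite /grid mulr_ge0// divr_ge0. Qed.

Lemma grid_le n k : (k <= n.+1)%N -> grid n k <= t.
Proof.
move=> kn; rewrite /grid mulrCA ler_piMr// ler_pdivrMr ?ltr0n// mul1r ler_nat//.
Qed.

Lemma gridS n k : grid n k <= grid n k.+1.
Proof. by rewrite /grid ler_wpM2r ?ler_nat// divr_ge0. Qed.

Let frozenE n s : D s -> exists2 k, (k < n.+1)%N &
  (grid n k <= s < grid n k.+1) /\ frozen n s = V s (w (grid n k.+1)).
Proof.
rewrite /D/= in_itv/= => /andP[s0 st].
have t0 : 0 < t by exact: le_lt_trans st.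
pose d := t / n.+1%:R; have d0 : 0 < d by rewrite divr_gt0.
have /truncn_itv/andP[] : 0 <= s / d by rewrite divr_ge0// ltW.
set k := Num.truncn _; rewrite ler_pdivlMr// ltr_pdivrMr// => k1 k2.
have kn : (k < n.+1)%N.
  rewrite -(ltr_nat R) -(ltr_pM2r d0); apply: (le_lt_trans k1).
  by rewrite /d mulrC divfK.
exists k => //; rewrite /grid -/d k1 k2; split=> //.
rewrite /frozen (bigD1 (Ordinal kn))//= patchE mem_set; last first.
  by rewrite /= in_itv/= k1 k2.
rewrite big1 ?addr0// => j; rewrite -val_eqE/= => jk.
rewrite patchE memNset//= in_itv/= => /andP[j1 j2]; move/negP: jk; apply.
have lt_nat m m' : m%:R * d < m'.+1%:R * d -> (m <= m')%N.
  by rewrite ltr_pM2r// ltr_nat ltnS.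
by rewrite eqn_leq !lt_nat ?(le_lt_trans j1) ?(le_lt_trans k1).
Qed.

Lemma frozen_path_cvg :
  bounded_measurable D (fun s => V s (w s)) /\
  (fun n => \sum_(k < n.+1) (primitive (V ^~ (w (grid n k.+1))) (grid n k.+1)
                           - primitive (V ^~ (w (grid n k.+1))) (grid n k))) @ \oo
    --> \int[mu]_(s in `[0, t]) V s (w s).
Proof.
have [C C0 VC] : exists2 C, 0 < C & forall x s, 0 <= s <= t -> `|V s x| <= C.
  by apply: continuous_segment_bounded_fin => x s _; exact: V_cont.
have mV x A : measurable_fun A (V ^~ x).
  by apply: measurable_funTS; apply: continuous_measurable_fun; exact: V_cont.
have mD : measurable D by exact: measurable_itv.
have finD : (mu D < +oo)%E.
  by rewrite /D lebesgue_measure_itv/= lte_fin; case: ifP => _; rewrite ?ltry.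
have bmF n (k : 'I_n.+1) : bounded_measurable D
    ((V ^~ (w (grid n k.+1))) \_ (`[grid n k, grid n k.+1[%classic)).
  split.
    by apply/measurable_restrict => //; exact: mV.
  exists C => s; rewrite /D/= in_itv/= => /andP[s0 /ltW st].
  by rewrite patchE; case: ifP => _; rewrite ?normr0 ?(ltW C0)// VC ?s0.
have FE n : \int[mu]_(s in D) frozen n s =
    \sum_(k < n.+1) (primitive (V ^~ (w (grid n k.+1))) (grid n k.+1)
                   - primitive (V ^~ (w (grid n k.+1))) (grid n k)).
  transitivity (\sum_(k < n.+1) \int[mu]_(s in D)
      ((V ^~ (w (grid n k.+1))) \_ (`[grid n k, grid n k.+1[%classic)) s).
    by apply: Rintegral_sum => // k _; exact: bmF.
  apply: eq_bigr => k _.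
  have ck : mu.-integrable `[grid n k, grid n k.+1] (EFin \o V ^~ (w (grid n k.+1))).
    by apply: continuous_segment_integrable => s _; exact: V_cont.
  rewrite -Rintegral_mkcondr (_ : D `&` _ = `[grid n k, grid n k.+1[%classic).
    rewrite Rintegral_itv_bndo_bndc; last first.
      by apply: integrableS ck => //; exact: subset_itv_co_cc.
    rewrite Rintegral_primitive//; last exact: gridS.
    by apply: le_trans (grid_ge0 _ _); lra.
  apply/seteqP; split=> [s []//|s /= kk]; split=> //; move: kk.
  rewrite /D/= !in_itv/= => /andP[k1 k2]; rewrite (le_trans (grid_ge0 _ _) k1)/=.
  exact: lt_le_trans k2 (grid_le (ltn_ord k)).
have [bV H] : bounded_measurable D (fun s => V s (w s)) /\
    (fun n => \int[mu]_(s in D) frozen n s) @ \oo --> \int[mu]_(s in D) V s (w s).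
  apply: (@bounded_convergence _ _ _ mu D mD finD _ _ C) => //.
  - move=> n; suff [] : bounded_measurable D (frozen n) by [].
    by apply: bounded_measurable_sum => // k _; exact: bmF.
  - move=> n s Ds; have [k kn [_ ->]] := frozenE n Ds.
    by apply: VC; move: Ds; rewrite /D/= in_itv/= => /andP[-> /ltW].
  - move=> s Ds; have s0 : 0 <= s by move: Ds; rewrite /D/= in_itv/= => /andP[].
    have [e /= e0 we] := w_right s0.
    apply: cvg_near_cst; near=> n.
    have [k kn [/andP[k1 k2] ->]] := frozenE n Ds; congr V.
    apply: we => //=; rewrite ltr0_norm ?subr_lt0// opprB.
    have : grid n k.+1 - s <= t / n.+1%:R.
      by rewrite /grid -[k.+1%:R]natr1 mulrDl mul1r lerBlDr [leRHS]addrC lerD2r.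
    move=> /le_lt_trans; apply; rewrite ltr_pdivrMr ?ltr0n// mulrC -ltr_pdivrMr//.
    apply: (@lt_trans _ _ n%:R); last by rewrite ltr_nat.
    by near: n; exact: nbhs_infty_gtr.
split=> //; rewrite -Rintegral_itv_bndo_bndc.
  by under eq_fun do rewrite -FE.
exact: bounded_measurable_integrable.
Unshelve. all: by end_near. Qed.

End FrozenPath.

(** * From one-sided derivatives on a half-line to ordinary derivatives and continuity *)

Section HalfLineDerivative.
Context {R : realType}.
Implicit Types (g : R -> R) (a t d : R).

Lemma has_derivative_from_is_derive a g t d : a < t ->
  has_derivative_from a g t d -> is_derive t 1 g d.
Proof.
move=> at_ gd.
have D : (fun h : R => h^-1 *: (g (h *: (1 : R) + t) - g t)) @ (0 : R)^' --> d.
  apply/cvgrPdist_le => e e0.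
  have /cvgrPdist_le/(_ _ e0)[r /= r0 gr] := gd.
  near=> h; have h0 : h != 0 by near: h; exact: nbhs_dnbhs_neq.
  have := gr (h + t); rewrite /= addrK /GRing.scale/= mulr1 [h^-1 * _]mulrC; apply.
  - rewrite opprD addrCA subrr addr0 normrN; near: h.
    exact: dnbhs0_lt.
  - by rewrite -subr_eq0 addrK.
  - rewrite in_itv/= andbT; suff : `|h| <= t - a by move=> /ler_normlP[? ?]; lra.
    by near: h; apply: dnbhs0_le; rewrite subr_gt0.
split; first by apply/cvg_ex; exists d; exact: D.
exact: cvg_lim.
Unshelve. all: by end_near. Qed.

Lemma has_derivative_from_cvg_right a g d :
  has_derivative_from a g a d -> g x @[x --> a^'+] --> g a.
Proof.
move=> gd.
have H : (fun x => (g x - g a) / (x - a) * (x - a) + g a) @ a^'+ --> d * (a - a) + g a.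
  apply: cvgD; last exact: cvg_cst.
  apply: cvgM; last first.
    by apply: cvgB; [exact: cvg_within|exact: cvg_cst].
  apply: cvg_trans gd => A [e /= e0 Ae]; exists e => //= x xe ax; apply: Ae => //.
    by rewrite gt_eqF.
  by rewrite in_itv/= andbT ltW.
rewrite subrr mulr0 add0r in H.
apply: cvg_trans H; apply: near_eq_cvg; near=> x.
rewrite divfK ?subrK// subr_eq0 gt_eqF//; near: x; exact: nbhs_right_gt.
Unshelve. all: by end_near. Qed.

Lemma has_derivative_from_within a b g dg : a < b ->
  (forall t, a <= t -> has_derivative_from a g t (dg t)) ->
  {within `[a, b], continuous g}.
Proof.
move=> ab gd; apply/(continuous_within_itvP _ ab); split.
- move=> x; rewrite in_itv/= => /andP[ax xb].
  apply: (@is_derive_continuous _ _ _ (dg x)); exact: has_derivative_from_is_derive ax (gd _ (ltW ax)).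
- exact: has_derivative_from_cvg_right (gd _ (lexx a)).
- apply: cvg_at_left_filter; apply: (@is_derive_continuous _ _ _ (dg b)).
  exact: has_derivative_from_is_derive ab (gd _ (ltW ab)).
Qed.

End HalfLineDerivative.

(** * Finite-dimensional laws of the process, reweighted along a time grid *)

Section FiniteDimensionalLaws.
Context {R : realType} {T : finType} d (Omega : measurableType d).
Variables (P : probability Omega R) (X : R -> Omega -> T) (init : T -> R).
Variables (p : R -> R -> T -> T -> R) (tt : nat -> R) (f : nat -> T -> R).
Implicit Types (x : nat -> T) (y z : T) (k m n : nat).
Hypothesis X_meas : forall t y, 0 <= t -> measurable [set w | X t w = y].
Hypothesis tt0 : tt 0%N = 0.
Hypothesis ttS : forall k, tt k <= tt k.+1.
Hypothesis X_law : forall n x,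
  P [set w | forall k, (k <= n)%N -> X (tt k) w = x k] =
  (init (x 0%N) * \prod_(k < n) p (tt k) (tt k.+1) (x k) (x k.+1))%:E.

(** The unnormalised law of [X (tt m)] when paths are weighted by the factors [f k (X (tt k))] with
    [k < m]; the factor of index [m] is not yet included. *)
Fixpoint weighted_law m y : R :=
  if m is k.+1 then \sum_z weighted_law k z * f k z * p (tt k) (tt k.+1) z y
  else init y.

Lemma tt_ge0 k : 0 <= tt k.
Proof. by elim: k => [|k IH]; rewrite ?tt0//; exact: le_trans (ttS k). Qed.

Lemma state_fun_indicE (phi : T -> R) t w :
  phi (X t w) = \sum_y phi y * \1_[set w | X t w = y] w.
Proof.
rewrite (bigD1 (X t w))//= indicE mem_set// mulr1 big1 ?addr0// => y yX.
by rewrite indicE memNset ?mulr0//= => /esym/eqP; rewrite (negbTE yX).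
Qed.

Lemma bounded_measurable_state (phi : T -> R) t : 0 <= t ->
  bounded_measurable setT (fun w => phi (X t w)).
Proof.
move=> t0; under eq_fun do rewrite state_fun_indicE.
apply: bounded_measurable_sum => // y _; apply: bounded_measurableM => //.
  exact: bounded_measurable_cst.
by apply: bounded_measurable_indic; exact: X_meas.
Qed.

Let ev m n x := [set w | forall k, (m <= k <= n)%N -> X (tt k) w = x k].

Let measurable_ev m n x : measurable (ev m n x).
Proof.
rewrite (_ : ev m n x =
    \bigcap_k (if (m <= k <= n)%N then [set w | X (tt k) w = x k] else setT)).
  apply: bigcapT_measurable => k; case: ifP => _ //; exact: X_meas (tt_ge0 k).
apply/seteqP; split=> [w H k _|w H k mkn].
  by case: ifPn => // mkn; exact: H.
by have := H k I; rewrite mkn.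
Qed.

Let Pfin : (P setT < +oo)%E.
Proof. by rewrite probability_setT ltry. Qed.

Let bm_term m n x : bounded_measurable setT
  (fun w => (\prod_(j < m) f j (X (tt j) w)) * \1_(ev m n x) w).
Proof.
apply: bounded_measurableM => //; last exact: bounded_measurable_indic.
by apply: bounded_measurable_prod => // j _; exact: bounded_measurable_state (tt_ge0 j).
Qed.

(** The laws are prescribed for complete paths from index 0 only. The induction on [m] therefore
    keeps the later positions fixed in the event and sums out one more early position at each
    step. *)
Let weighted_event m n x : (m <= n)%N ->
  \int[P]_w ((\prod_(j < m) f j (X (tt j) w)) * \1_(ev m n x) w) =
  weighted_law m (x m) * \prod_(m <= k < n) p (tt k) (tt k.+1) (x k) (x k.+1).
Proof.
elim: m x => [|m IH] x mn.
  under eq_Rintegral do rewrite big_ord0 mul1r.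
  have -> : ev 0 n x = [set w | forall k, (k <= n)%N -> X (tt k) w = x k].
    by apply/seteqP; split.
  rewrite /Rintegral integral_indic ?setIT ?big_mkord//.
    exact: (congr1 fine (X_law n x)).
  exact: (measurable_ev 0 n x).
pose upd z k := if k == m then z else x k.
transitivity (\sum_z \int[P]_w
    (f m z * ((\prod_(j < m) f j (X (tt j) w)) * \1_(ev m n (upd z)) w))).
  rewrite -Rintegral_sum//; last first.
    by move=> z _; apply: bounded_measurableM => //; exact: bounded_measurable_cst.
  apply: eq_Rintegral => w _; rewrite (bigD1 (X (tt m) w))//= [X in _ + X]big1 ?addr0.
    rewrite big_ord_recr/= mulrAC [RHS]mulrC; congr (_ * _ * _).
    rewrite !indicE; congr ((_ : bool)%:R); apply/idP/idP; rewrite !inE /ev/= => H k /andP[mk kn].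
      by rewrite /upd; case: eqVneq => [->//|km]; apply: H; rewrite kn andbT ltn_neqAle eq_sym km.
    by rewrite H ?(ltnW mk)// /upd gtn_eqF.
  move=> z zX; rewrite indicE memNset ?mulr0// => /(_ m).
  by rewrite leqnn (ltnW mn) /upd eqxx => /(_ isT)/esym/eqP; rewrite (negbTE zX).
rewrite /= mulr_suml; apply: eq_bigr => z _.
rewrite RintegralZl//; last exact: bounded_measurable_integrable (bm_term _ _ _).
have um : upd z m = z by rewrite /upd eqxx.
have us k : (m < k)%N -> upd z k = x k by move=> mk; rewrite /upd gtn_eqF.
rewrite IH ?(ltnW mn)// big_ltn// um us//.
have -> : \prod_(m.+1 <= k < n) p (tt k) (tt k.+1) (upd z k) (upd z k.+1) =
    \prod_(m.+1 <= k < n) p (tt k) (tt k.+1) (x k) (x k.+1).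
  by apply: eq_big_nat => k /andP[mk _]; rewrite us// us// ltnW.
by ring.
Qed.

Lemma weighted_lawE m (phi : T -> R) :
  \int[P]_w ((\prod_(j < m) f j (X (tt j) w)) * phi (X (tt m) w)) =
  \sum_y weighted_law m y * phi y.
Proof.
transitivity (\sum_y \int[P]_w
    (phi y * ((\prod_(j < m) f j (X (tt j) w)) * \1_(ev m m (fun=> y)) w))).
  rewrite -Rintegral_sum//; last first.
    by move=> z _; apply: bounded_measurableM => //; exact: bounded_measurable_cst.
  apply: eq_Rintegral => w _; rewrite state_fun_indicE mulr_sumr.
  apply: eq_bigr => y _; rewrite mulrCA; congr (_ * (_ * _)).
  rewrite !indicE; congr ((_ : bool)%:R); apply/idP/idP; rewrite !inE /ev/=.
    by move=> <- k; rewrite -eqn_leq => /eqP->.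
  by move=> /(_ m); rewrite leqnn; apply.
apply: eq_bigr => y _.
rewrite RintegralZl//; last exact: bounded_measurable_integrable (bm_term _ _ _).
by rewrite weighted_event// big_geq// mulr1 mulrC.
Qed.

End FiniteDimensionalLaws.

Section FeynmanKac.
Context {R : realType} {T : finType} d (Omega : measurableType d).
Variables (P : probability Omega R) (X : R -> Omega -> T) (init : T -> R).
Variables (G : R -> (T -> R) -> T -> R) (Gm : R -> T -> T -> R).
Variables (V : R -> T -> R) (t : R) (h : R -> T -> R).
Implicit Types (a b s u : R) (x y z : T).
Hypothesis X_markov : markov_process P X init G.
Hypothesis G_mx : forall s phi x, 0 <= s -> G s phi x = \sum_y Gm s x y * phi y.
Hypothesis Gm_cont : forall x y, continuous (fun s => Gm s x y).
Hypothesis V_cont : forall x, continuous (V ^~ x).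
Hypothesis t_ge0 : 0 <= t.
Hypothesis h_derive : forall s x, 0 <= s <= t ->
  is_derive s 1 (h ^~ x) (- (\sum_y Gm s x y * h s y - V s x * h s x)).

Let discount a b x : R := expR (- (primitive (V ^~ x) b - primitive (V ^~ x) a)).

Let is_derive_discount a b x : -1 < b ->
  is_derive b 1 (discount a ^~ x) (- V b x * discount a b x).
Proof.
move=> b1; rewrite mulrC; apply: is_derive_comp1; apply: is_derive_opp.
rewrite -[X in is_derive _ _ _ X]subr0; apply: is_derive_sub.
by apply: is_derive_primitive => //; exact: V_cont.
Qed.

Let bounds : exists c : R, [/\ 0 < c,
  forall s x y, 0 <= s <= t -> `|Gm s x y| <= c,
  forall s x, 0 <= s <= t -> `|V s x| <= c &
  forall s x, 0 <= s <= t -> `|h s x| <= c].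
Proof.
have [c1 c10 Gc] : exists2 c, 0 < c & forall (xy : T * T) s, 0 <= s <= t ->
    `|Gm s xy.1 xy.2| <= c.
  by apply: continuous_segment_bounded_fin => xy s _; exact: Gm_cont.
have [c2 c20 Vc] : exists2 c, 0 < c & forall x s, 0 <= s <= t -> `|V s x| <= c.
  by apply: continuous_segment_bounded_fin => x s _; exact: V_cont.
have [c3 c30 hc] : exists2 c, 0 < c & forall x s, 0 <= s <= t -> `|h s x| <= c.
  apply: continuous_segment_bounded_fin => x s; rewrite in_itv/= => st.
  exact: is_derive_continuous (h_derive x st).
exists (c1 + c2 + c3); split; first by rewrite !addr_gt0.
- by move=> s x y st; apply: (le_trans (Gc (x, y) s st)); lra.
- by move=> s x st; apply: (le_trans (Vc x s st)); lra.
- by move=> s x st; apply: (le_trans (hc x s st)); lra.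
Qed.

Let discount_le (c : R) a b x : (forall s x, 0 <= s <= t -> `|V s x| <= c) ->
  0 <= a -> a <= b -> b <= t -> discount a b x <= expR (c * (b - a)).
Proof.
move=> Vc a0 ab bt; rewrite ler_expR.
have : `|primitive (V ^~ x) b - primitive (V ^~ x) a| <= c * (b - a).
  apply: (norm_increment_le_cst (f' := V ^~ x) ab) => s /andP[s1 s2].
    by apply: is_derive_primitive; [exact: V_cont|lra].
  by apply: Vc; apply/andP; split; lra.
by move=> /ler_normlP[].
Qed.

Let discount_near1 (c : R) a b x : 0 < c -> (forall s x, 0 <= s <= t -> `|V s x| <= c) ->
  0 <= a -> a <= b -> b <= t -> `|discount a b x - 1| <= c * expR (c * t) * (b - a).
Proof.
move=> c0 Vc a0 ab bt.
have -> : 1 = discount a a x by rewrite /discount subrr oppr0 expR0.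
apply: (@norm_increment_le_cst _ (discount a ^~ x) (fun b => - V b x * discount a b x)) => //.
  by move=> s /andP[s1 s2]; apply: is_derive_discount; lra.
move=> s /andP[s1 s2]; rewrite normrM normrN ler_pM//.
  by apply: Vc; apply/andP; split; lra.
rewrite ger0_norm ?expR_ge0//; apply: (le_trans (@discount_le c a s x Vc _ _ _)); try lra.
by rewrite ler_expR ler_pM2l//; lra.
Qed.

Section Step.
Variable p : R -> R -> T -> T -> R.
Hypothesis p_trans : transition_function G p.

Let is_derive_trans a u z y : 0 <= a -> a < u ->
  is_derive u 1 (fun u => p a u z y) (\sum_x p a u z x * Gm u x y).
Proof.
move=> a0 au; case: p_trans => _ _ _ _ /(_ a u z (fun x => (x == y)%:R) a0 (ltW au)).
move=> /(has_derivative_from_is_derive au).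
have pick (q : T -> R) : \sum_x q x * (x == y)%:R = q y.
  rewrite (bigD1 y)//= eqxx mulr1 big1 ?addr0// => x xy.
  by rewrite (negbTE xy) mulr0.
rewrite /gen_apply; under eq_fun do rewrite pick.
under eq_bigr => x _ do rewrite G_mx ?(le_trans a0 (ltW au))// pick.
by [].
Qed.

Let trans_within a b z y : 0 <= a -> a < b ->
  {within `[a, b], continuous (fun u => p a u z y)}.
Proof.
move=> a0 ab; case: p_trans => _ _ _ _ pd.
rewrite (_ : (fun u => _) = fun u => gen_apply (p a u) (fun x => (x == y)%:R) z).
  exact: (has_derivative_from_within ab (fun u au => pd a u z _ a0 au)).
apply/funext => u; rewrite /gen_apply (bigD1 y)//= eqxx mulr1 big1 ?addr0// => x xy.
by rewrite (negbTE xy) mulr0.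
Qed.

(** Freezing the state at the end of a step costs second order only. After the backward equation for
    [h] is used, the derivative retains just the differences [discount a u y - discount a u x],
    which are of order [u - a] since all discounts equal 1 at [u = a]. *)
Lemma transition_step : exists2 K, 0 <= K & forall a b z,
  0 <= a -> a <= b -> b <= t ->
  `|\sum_y p a b z y * (discount a b y * h b y) - h a z| <= K * (b - a) ^+ 2.
Proof.
have [c [c0 Gc Vc hc]] := bounds.
pose D := c * expR (c * t); have D0 : 0 <= D by rewrite mulr_ge0 ?expR_ge0// ltW.
pose K := #|T|%:R * (c * (2 * D) * c).
have K0 : 0 <= K by rewrite !mulr_ge0// ltW.
exists K => // a b z a0; rewrite le_eqVlt => /predU1P[<- _|ab bt].
  rewrite subrr expr0n mulr0 (bigD1 z)//= big1 ?addr0; last first.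
    by move=> y yz; case: p_trans => _ _ -> // _ _; rewrite eq_sym (negbTE yz) mul0r.
  case: p_trans => _ _ -> // _ _; rewrite eqxx mul1r /discount !subrr oppr0 expR0 mul1r.
  by rewrite subrr normr0.
pose B u := \sum_y p a u z y * (discount a u y * h u y).
pose dB u := \sum_x p a u z x * \sum_y Gm u x y * (discount a u y - discount a u x) * h u y.
have Ba : B a = h a z.
  rewrite /B (bigD1 z)//= big1 ?addr0; last first.
    by move=> y yz; case: p_trans => _ _ -> // _ _; rewrite eq_sym (negbTE yz) mul0r.
  by case: p_trans => _ _ -> // _ _; rewrite eqxx mul1r /discount !subrr oppr0 expR0 mul1r.
rewrite -Ba expr2 mulrA; apply: (norm_increment_le_open (f' := dB) (ltW ab)).
- move=> u /andP[au ub]; have ut : 0 <= u <= t by apply/andP; split; lra.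
  have u1 : -1 < u by lra.
  apply: (is_derive_eq (is_derive_bigsum _ (fun y _ => is_derive_mul
    (is_derive_trans z y a0 au)
    (is_derive_mul (is_derive_discount a y u1) (h_derive y ut))))).
  rewrite big_split/=; under eq_bigr do rewrite mulr_suml.
  rewrite exchange_big/= -big_split/=; apply: eq_bigr => x _.
  under [in RHS]eq_bigr do rewrite mulrBr mulrBl.
  rewrite sumrB; under eq_bigr do rewrite -!mulrA.
  rewrite -mulr_sumr; under [X in _ = _ * (_ - X)]eq_bigr do rewrite mulrAC.
  rewrite -mulr_suml; under [X in _ = _ * (X - _)]eq_bigr do rewrite -mulrA.
  by ring.
- move=> u; apply: continuous_bigsum => y _; apply: continuous_for_mul.
    exact: trans_within.
  apply: continuous_segment_within => s; rewrite in_itv/= => /andP[as_ sb].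
  apply: is_derive_continuous; apply: is_derive_mul.
    by apply: is_derive_discount; lra.
  by apply: h_derive; apply/andP; split; lra.
- move=> u /andP[au ub]; have ut : 0 <= u <= t by apply/andP; split; lra.
  apply: (le_trans (ler_norm_sum _ _ _)).
  apply: (@le_trans _ _ (\sum_x p a u z x * (K * (b - a)))).
    apply: ler_sum => x _; have p0 : 0 <= p a u z x.
      by case: p_trans => p0 *; apply: p0 => //; lra.
    rewrite normrM ger0_norm// ler_wpM2l//.
    apply: (le_trans (ler_norm_sum _ _ _)).
    apply: (@le_trans _ _ (\sum_(y : T) c * (2 * D * (b - a)) * c)).
      apply: ler_sum => y _; rewrite !normrM; apply: ler_pM => //; last exact: hc.
      apply: ler_pM => //; first exact: Gc.
      have ny := @discount_near1 c a u y c0 Vc a0 (ltW au) (ltW (lt_le_trans ub bt)).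
      have nx := @discount_near1 c a u x c0 Vc a0 (ltW au) (ltW (lt_le_trans ub bt)).
      have : D * (u - a) <= D * (b - a) by rewrite ler_wpM2l//; lra.
      move: nx ny; rewrite -/D => /ler_normlP[? ?] /ler_normlP[? ?] ?.
      by apply/ler_normlP; split; lra.
    by rewrite sumr_const -mulr_natl /K; set n := _%:R; lra.
  rewrite -mulr_suml; case: p_trans => _ -> //; last lra.
  by rewrite mul1r.
Qed.

End Step.

(** The exponential of the time integral is a limit of products of one-step discounts. Their
    expectation follows from the finite-dimensional laws, and by [transition_step] each of the
    [n + 1] steps adds an error of order [(t / (n + 1))^2], so the total error tends to 0. *)
Lemma feynman_kac :
  bounded_measurable setT (fun w =>
    expR (- \int[lebesgue_measure]_(s in `[0, t]) V s (X s w)) * h t (X t w)) /\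
  \int[P]_w (expR (- \int[lebesgue_measure]_(s in `[0, t]) V s (X s w)) * h t (X t w))
  = \sum_x init x * h 0 x.
Proof.
case: (X_markov) => X_meas X_right [p p_trans X_law].
have [K K0 stepK] := transition_step p_trans.
have [c [c0 Gc Vc hc]] := bounds.
(* The discount of a cell is attached to its right end point, so index 0 carries the factor 1. *)
pose f n k := if k is j.+1 then discount (grid t n j) (grid t n k) else fun=> 1.
have law n m (x : nat -> T) : P [set w | forall k, (k <= m)%N -> X (grid t n k) w = x k] =
    (init (x 0%N) * \prod_(k < m) p (grid t n k) (grid t n k.+1) (x k) (x k.+1))%:E.
  by apply: X_law; [rewrite /grid mul0r|move=> k _; exact: gridS].
have grid0 n : grid t n 0 = 0 by rewrite /grid mul0r.
have gridn n : grid t n n.+1 = t by rewrite /grid mulrCA divff ?mulr1.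
have gridD n k : grid t n k.+1 - grid t n k = t / n.+1%:R.
  by rewrite /grid -[k.+1%:R]natr1 mulrDl mul1r addrAC subrr add0r.
pose Y n w := (\prod_(j < n.+1) f n j (X (grid t n j) w)) *
  (f n n.+1 (X (grid t n n.+1) w) * h t (X (grid t n n.+1) w)).
pose J n w := \sum_(k < n.+1)
  (primitive (V ^~ (X (grid t n k.+1) w)) (grid t n k.+1)
   - primitive (V ^~ (X (grid t n k.+1) w)) (grid t n k)).
have YE n w : Y n w = expR (- J n w) * h t (X t w).
  rewrite /Y mulrA; congr (_ * _); last by rewrite gridn.
  transitivity (\prod_(j < n.+2) f n j (X (grid t n j) w)).
    by rewrite [RHS]big_ord_recr.
  by rewrite big_ord_recl/= mul1r -sumrN expR_sum.
have JN n w : - J n w <= c * t.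
  rewrite /J -sumrN; apply: (@le_trans _ _ (\sum_(k < n.+1) c * (t / n.+1%:R))).
    apply: ler_sum => k _; have kt := grid_le t_ge0 (ltn_ord k).
    rewrite -(gridD n k) -ler_expR; apply: discount_le => //.
      exact: grid_ge0.
    exact: gridS.
  have E : n.+1%:R * (c * (t / n.+1%:R)) = c * t.
    by rewrite mulrCA; congr (_ * _); rewrite mulrCA divff ?mulr1// pnatr_eq0.
  by rewrite sumr_const card_ord -[X in X <= _]mulr_natl E.
have mY n : bounded_measurable setT (Y n).
  apply: bounded_measurableM => //.
    apply: bounded_measurable_prod => // j _.
    by apply: bounded_measurable_state => //; exact: grid_ge0.
  apply: (bounded_measurable_state X_meas (fun x => f n n.+1 x * h t x)).
  exact: grid_ge0.
have tt : 0 <= t <= t by rewrite t_ge0 lexx.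
have [bY intY] : bounded_measurable setT (fun w =>
    expR (- \int[lebesgue_measure]_(s in `[0, t]) V s (X s w)) * h t (X t w)) /\
    (fun n => \int[P]_w Y n w) @ \oo -->
    \int[P]_w (expR (- \int[lebesgue_measure]_(s in `[0, t]) V s (X s w)) * h t (X t w)).
  have finP : (P setT < +oo)%E by rewrite probability_setT ltry.
  apply: (@bounded_convergence _ _ _ P setT measurableT finP _ _ (expR (c * t) * c)).
  - by move=> n; case: (mY n).
  - move=> n w _; rewrite YE normrM; apply: ler_pM => //; last exact: hc.
    by rewrite ger0_norm ?expR_ge0// ler_expR.
  - move=> w _; under eq_fun do rewrite YE.
    apply: cvgM; last exact: cvg_cst.
    have [_ JJ] := frozen_path_cvg V_cont (X_right w) t_ge0.
    exact: (cvg_comp _ _ (cvgN JJ) (@continuous_expR R _)).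
split=> //.
(* [weighted_law] stops before the factor of index [m]; [e] includes it. *)
pose e n m y := weighted_law init p (grid t n) (f n) m y * f n m y.
have f_ge0 n k y : 0 <= f n k y by case: k => [|k]//=; exact: expR_ge0.
have f_le n k y : (k <= n)%N -> f n k.+1 y <= expR (c * (t / n.+1%:R)).
  move=> kn; rewrite -(gridD n k); apply: discount_le => //; first exact: grid_ge0.
    exact: gridS.
  exact: grid_le.
pose I0 := \sum_x `|init x|.
have I00 : 0 <= I0 by exact: sumr_ge0.
have eS n m y : e n m.+1 y = (\sum_z e n m z * p (grid t n m) (grid t n m.+1) z y) * f n m.+1 y.
  by [].
have e_le n m : (m <= n.+1)%N -> \sum_y `|e n m y| <= I0 * expR (c * (grid t n m)).
  elim: m => [_|m IH mn].
    by rewrite grid0 mulr0 expR0 mulr1 /e/=; apply: ler_sum => y _; rewrite mulr1.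
  apply: (@le_trans _ _ (\sum_y (\sum_z `|e n m z| *
      p (grid t n m) (grid t n m.+1) z y) * expR (c * (t / n.+1%:R)))).
    apply: ler_sum => y _; rewrite eS normrM (ger0_norm (f_ge0 _ _ _)).
    apply: ler_pM => //; last exact: f_le.
    apply: (le_trans (ler_norm_sum _ _ _)); apply: ler_sum => z _.
    rewrite normrM [X in _ * X]ger0_norm//; case: p_trans => p0 *; apply: p0.
      exact: grid_ge0.
    exact: gridS.
  rewrite -mulr_suml exchange_big/=; under eq_bigr do rewrite -mulr_sumr.
  under eq_bigr => z _.
    rewrite (_ : \sum_y p _ _ z y = 1); last first.
      by case: p_trans => _ p1 *; apply: p1; [exact: grid_ge0|exact: gridS].
    rewrite mulr1; over.
  have -> : grid t n m.+1 = grid t n m + t / n.+1%:R by rewrite -(gridD n m); lra.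
  rewrite [c * (_ + _)]mulrDr expRD [I0 * _]mulrA.
  by rewrite ler_wpM2r ?expR_ge0// IH// ltnW.
pose C := I0 * expR (c * t) * K.
have C0 : 0 <= C by rewrite !mulr_ge0// expR_ge0.
have approx n m : (m <= n.+1)%N ->
    `|\sum_y e n m y * h (grid t n m) y - \sum_x init x * h 0 x| <=
    m%:R * (C * (t / n.+1%:R) ^+ 2).
  elim: m => [_|m IH mn].
    by rewrite mul0r grid0 /e/=; under eq_bigr do rewrite mulr1; rewrite subrr normr0.
  rewrite -natr1 mulrDl mul1r [leRHS]addrC.
  rewrite -[X in `|X - _|](subrK (\sum_y e n m y * h (grid t n m) y)) -[X in `|X|]addrA.
  apply: (le_trans (ler_normD _ _)); apply: lerD; last by apply: IH; exact: ltnW.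
  have -> : \sum_y e n m.+1 y * h (grid t n m.+1) y =
      \sum_z e n m z * \sum_y p (grid t n m) (grid t n m.+1) z y *
        (discount (grid t n m) (grid t n m.+1) y * h (grid t n m.+1) y).
    under eq_bigr do rewrite eS -mulrA mulr_suml.
    rewrite exchange_big/=; apply: eq_bigr => z _; rewrite mulr_sumr.
    by apply: eq_bigr => y _; rewrite -mulrA.
  rewrite -sumrB; under eq_bigr do rewrite -mulrBr.
  apply: (le_trans (ler_norm_sum _ _ _)).
  apply: (@le_trans _ _ (\sum_z `|e n m z| * (K * (t / n.+1%:R) ^+ 2))).
    apply: ler_sum => z _; rewrite normrM ler_wpM2l// -(gridD n m).
    by apply: stepK; [exact: grid_ge0|exact: gridS|exact: grid_le].
  rewrite -mulr_suml /C -!mulrA mulrA ler_wpM2r ?mulr_ge0 ?sqr_ge0//.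
  apply: (le_trans (e_le _ _ (ltnW mn))).
  by rewrite ler_wpM2l// ler_expR ler_pM2l// grid_le// ltnW.
have lim2 : (fun n => \int[P]_w Y n w) @ \oo --> \sum_x init x * h 0 x.
  have YE' n : \int[P]_w Y n w = \sum_y e n n.+1 y * h (grid t n n.+1) y.
    rewrite /Y (weighted_lawE (f n) X_meas (grid0 n) (gridS t_ge0 n) (law n) n.+1
      (fun x => f n n.+1 x * h t x)).
    by apply: eq_bigr => y _; rewrite /e gridn mulrA.
  under eq_fun do rewrite YE'.
  apply/cvgrPdist_le => r r0; near=> n.
  rewrite distrC; apply: (le_trans (approx n n.+1 (leqnn _))).
  have E m : m != 0 -> m * (C * (t / m) ^+ 2) = C * t ^+ 2 / m by move=> m0; field.
  rewrite E ?pnatr_eq0//.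
  rewrite ler_pdivrMr ?ltr0n// [r * _]mulrC -ler_pdivrMr//.
  apply: (@le_trans _ _ n%:R); last by rewrite ler_nat.
  by near: n; exact: nbhs_infty_ger.
exact: (cvg_unique _ intY lim2).
Unshelve. all: by end_near. Qed.

End FeynmanKac.

(** * Second moments of the particle system *)

Section ParticleAlgebra.
Context {R : realType} {S : finType} {N : nat}.
Implicit Types (x : state S N) (f g h H : S -> R) (L : S -> S -> R).
Hypothesis N_gt0 : (0 < N)%N.

Let N_neq0 : N%:R != 0 :> R. Proof. by rewrite pnatr_eq0 -lt0n. Qed.

Lemma pairing_empirical f x : pairing f (empirical x) = N%:R^-1 * \sum_i f (x i).
Proof.
rewrite /pairing /empirical; under eq_bigr do rewrite mulrCA mulr_sumr.
rewrite -mulr_sumr exchange_big/=; congr (_ * _); apply: eq_bigr => i _.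
rewrite (bigD1 (x i))//= eqxx mulr1 big1 ?addr0// => y yx.
by rewrite eq_sym (negbTE yx) mulr0.
Qed.

Lemma pairing_empirical_replace f x (i : 'I_N) y :
  pairing f (empirical (replace_at x i y)) =
  pairing f (empirical x) + N%:R^-1 * (f y - f (x i)).
Proof.
rewrite !pairing_empirical -mulrDr; congr (_ * _).
rewrite (bigD1 i)//= ffunE eqxx [in RHS](bigD1 i)//=.
rewrite (eq_bigr (fun j => f (x j))); first by ring.
by move=> j ji; rewrite ffunE (negbTE ji).
Qed.

(** The diagonal pairs [i = j] are included, so that a product of two empirical integrals is a pair
    mean. *)
Definition pair_mean (F : S -> S -> R) x : R :=
  N%:R^-2 * \sum_i \sum_j F (x i) (x j).

Lemma pair_mean_prod g h x : pair_mean (fun y z => g y * h z) x =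
  pairing g (empirical x) * pairing h (empirical x).
Proof.
rewrite !pairing_empirical /pair_mean mulrACA -exprVn expr2; congr (_ * _).
by rewrite mulr_suml; apply: eq_bigr => i _; rewrite mulr_sumr.
Qed.

Lemma pair_meanD F1 F2 x : pair_mean (fun y z => F1 y z + F2 y z) x =
  pair_mean F1 x + pair_mean F2 x.
Proof.
rewrite /pair_mean -mulrDr -big_split/=; congr (_ * _); apply: eq_bigr => i _.
by rewrite -big_split.
Qed.

Lemma pair_meanZ c F x : pair_mean (fun y z => c * F y z) x = c * pair_mean F x.
Proof.
rewrite /pair_mean mulrCA; congr (_ * _); rewrite mulr_sumr.
by apply: eq_bigr => i _; rewrite mulr_sumr.
Qed.

Lemma pair_mean_left f x : pair_mean (fun y z => f y) x = pairing f (empirical x).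
Proof.
rewrite pairing_empirical /pair_mean; under eq_bigr do rewrite sumr_const card_ord.
rewrite sumrMnl -[X in _ * X]mulr_natl mulrA; congr (_ * _).
by rewrite expr2 invfM -mulrA mulVf ?mulr1.
Qed.

Variables (lam : R -> R) (L : R -> S -> S -> R) (H : R -> S -> R) (s : R).
Hypothesis L_row : forall y, \sum_z L s y z = 0.

Let Q (y z : S) := lam s * L s y z.

Definition drift f : S -> R := fun y => \sum_z Q y z * f z - H s y * f y.

(** Normalised without the customary factor 1/2: as the rows of [Q] sum to 0, this is
    [Q (g h) - g (Q h) - h (Q g)]. *)
Definition carre_du_champ g h : S -> R :=
  fun y => \sum_z Q y z * ((g z - g y) * (h z - h y)).

Definition selection_square g h : S -> S -> R :=
  fun y z => Num.max (H s y - H s z) 0 * ((g z - g y) * (h z - h y)).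

Lemma particle_genE (phi : state S N -> R) x :
  particle_gen lam L H s phi x =
  \sum_i \sum_y Q (x i) y * (phi (replace_at x i y) - phi x) +
  N%:R^-1 * \sum_i \sum_j
    Num.max (H s (x i) - H s (x j)) 0 * (phi (replace_at x i (x j)) - phi x).
Proof.
rewrite /particle_gen; congr (_ + _); rewrite mulr_sumr; apply: eq_bigr => i _.
rewrite /gen_component /gen_apply mulr_sumr.
have E : \sum_y Q (x i) y * phi x = 0 by rewrite -mulr_suml -mulr_sumr L_row mulr0 mul0r.
under [in RHS]eq_bigr do rewrite mulrBr.
by rewrite sumrB E subr0; apply: eq_bigr => y _; rewrite mulrA.
Qed.

(** Summing over ordered pairs antisymmetrises the selection rates, and
    [max (a - b) 0 - max (b - a) 0 = a - b] removes the positive parts. What is left over from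
    [drift] is the mean of [H], which the exponential weight will compensate. *)
Lemma particle_gen_pairing f x :
  particle_gen lam L H s (fun x => pairing f (empirical x)) x =
  pairing (drift f) (empirical x) +
  pairing (H s) (empirical x) * pairing f (empirical x).
Proof.
rewrite particle_genE.
under eq_bigr do under eq_bigr do rewrite pairing_empirical_replace addrAC subrr add0r.
under [X in _ + _ * X]eq_bigr do
  under eq_bigr do rewrite pairing_empirical_replace addrAC subrr add0r.
rewrite -pair_mean_prod.
have E1 : \sum_i \sum_y Q (x i) y * (N%:R^-1 * (f y - f (x i))) =
    N%:R^-1 * \sum_i \sum_y Q (x i) y * f y.
  rewrite mulr_sumr; apply: eq_bigr => i _.
  have E : \sum_y Q (x i) y * f (x i) = 0.
    by rewrite -mulr_suml -mulr_sumr L_row mulr0 mul0r.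
  under eq_bigr do rewrite mulrCA mulrBr.
  by rewrite -mulr_sumr sumrB E subr0.
have E2 : \sum_i \sum_j Num.max (H s (x i) - H s (x j)) 0 * (f (x j) - f (x i)) =
    \sum_i \sum_j (H s (x i) * f (x j) - H s (x i) * f (x i)).
  have sym (F : 'I_N -> 'I_N -> R) : \sum_i \sum_j F i j = 2^-1 * \sum_i \sum_j (F i j + F j i).
    under [in RHS]eq_bigr do rewrite big_split/=.
    rewrite big_split/= [X in _ * (_ + X)]exchange_big/=; lra.
  rewrite sym [RHS]sym; congr (_ * _); apply: eq_bigr => i _; apply: eq_bigr => j _.
  have [h|h|->] := ltgtP (H s (x i)) (H s (x j)).
  - by rewrite max_r ?subr_le0 ?(ltW h)// max_l ?subr_ge0 ?(ltW h)//; ring.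
  - by rewrite max_l ?subr_ge0 ?(ltW h)// max_r ?subr_le0 ?(ltW h)//; ring.
  - by rewrite subrr maxxx; ring.
have E3 : N%:R^-1 * (\sum_i \sum_j
      Num.max (H s (x i) - H s (x j)) 0 * (N%:R^-1 * (f (x j) - f (x i)))) =
    pair_mean (fun y z => H s y * f z) x - pairing (fun y => H s y * f y) (empirical x).
  rewrite -pair_mean_left /pair_mean -mulrBr -sumrB.
  under [in RHS]eq_bigr do rewrite -sumrB.
  rewrite -E2 expr2 invfM -[in RHS]mulrA; congr (_ * _); rewrite mulr_sumr.
  by apply: eq_bigr => i _; rewrite mulr_sumr; apply: eq_bigr => j _; rewrite mulrCA.
rewrite E1 E3 !pairing_empirical /drift sumrB mulrBr.
by rewrite addrA addrAC.
Qed.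

(** A jump moves one particle and changes each empirical integral by order [1 / N]. The linear parts
    of the product rule are given by [particle_gen_pairing]; the quadratic part is the source of
    correlations. *)
Lemma particle_gen_pairing_prod g h x :
  particle_gen lam L H s
    (fun x => pairing g (empirical x) * pairing h (empirical x)) x =
  2 * pairing (H s) (empirical x) *
    (pairing g (empirical x) * pairing h (empirical x)) +
  pairing (drift g) (empirical x) * pairing h (empirical x) +
  pairing g (empirical x) * pairing (drift h) (empirical x) +
  N%:R^-1 * (pairing (carre_du_champ g h) (empirical x) +
    pair_mean (selection_square g h) x).
Proof.
have split (c Dg Dh a b : R) : c * ((a + Dg) * (b + Dh) - a * b) =
    a * (c * Dh) + b * (c * Dg) + c * (Dg * Dh) by ring.
have Eg := particle_gen_pairing g x; have Eh := particle_gen_pairing h x.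
rewrite !particle_genE in Eg Eh *.
have [a Ea] : {a | pairing g (empirical x) = a} by exists (pairing g (empirical x)).
have [b Eb] : {b | pairing h (empirical x) = b} by exists (pairing h (empirical x)).
rewrite Ea Eb in Eg Eh *.
have P1 : \sum_i \sum_y Q (x i) y *
      (pairing g (empirical (replace_at x i y)) * pairing h (empirical (replace_at x i y)) - a * b) =
    a * (\sum_i \sum_y Q (x i) y * (pairing h (empirical (replace_at x i y)) - b)) +
    b * (\sum_i \sum_y Q (x i) y * (pairing g (empirical (replace_at x i y)) - a)) +
    N%:R^-1 * pairing (carre_du_champ g h) (empirical x).
  rewrite pairing_empirical /carre_du_champ !mulr_sumr -!big_split/=.
  apply: eq_bigr => i _; rewrite !mulr_sumr -!big_split/=; apply: eq_bigr => y _.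
  by rewrite !pairing_empirical_replace Ea Eb; ring.
have P2 : N%:R^-1 * (\sum_i \sum_j Num.max (H s (x i) - H s (x j)) 0 *
      (pairing g (empirical (replace_at x i (x j))) * pairing h (empirical (replace_at x i (x j))) - a * b)) =
    a * (N%:R^-1 * (\sum_i \sum_j Num.max (H s (x i) - H s (x j)) 0 * (pairing h (empirical (replace_at x i (x j))) - b))) +
    b * (N%:R^-1 * (\sum_i \sum_j Num.max (H s (x i) - H s (x j)) 0 * (pairing g (empirical (replace_at x i (x j))) - a))) +
    N%:R^-1 * pair_mean (selection_square g h) x.
  rewrite /pair_mean /selection_square expr2 invfM !mulr_sumr -!big_split/=.
  apply: eq_bigr => i _; rewrite !mulr_sumr -!big_split/=; apply: eq_bigr => j _.
  by rewrite !pairing_empirical_replace Ea Eb; ring.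
rewrite P1 P2 [N%:R^-1 * (_ + _)]mulrDr.
set A1 := \sum_i _ in Eg *; set A2 := N%:R^-1 * _ in Eg *.
set B1 := \sum_i _ in Eh *; set B2 := N%:R^-1 * _ in Eh *.
have -> : pairing (drift g) (empirical x) = A1 + A2 - pairing (H s) (empirical x) * a.
  by rewrite Eg addrK.
have -> : pairing (drift h) (empirical x) = B1 + B2 - pairing (H s) (empirical x) * b.
  by rewrite Eh addrK.
by ring.
Qed.

End ParticleAlgebra.

Section ParticleMoments.
Context {R : realType} {S : finType} {N : nat}.
Context d (Omega : measurableType d) (P : probability Omega R).
Variables (X : R -> Omega -> state S N) (mu : R -> S -> R).
Variables (G : R -> (state S N -> R) -> state S N -> R).
Variables (lam : R -> R) (L : R -> S -> S -> R) (H : R -> S -> R) (T : R).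
Implicit Types (s t : R) (x : state S N) (y : S) (f g h : S -> R) (phi : state S N -> R).
Hypothesis N_gt0 : (0 < N)%N.
Hypothesis lam_cont : continuous lam.
Hypothesis L_cont : forall y y', continuous (fun s => L s y y').
Hypothesis H_cont : forall y, continuous (H ^~ y).
Hypothesis L_row : forall s y, \sum_y' L s y y' = 0.
Hypothesis T_ge0 : 0 <= T.
Hypothesis mu_derive : forall s y, 0 <= s <= T ->
  is_derive s 1 (mu ^~ y) (- (H s y * mu s y)).
Hypothesis mu_inv : forall s y, 0 <= s <= T -> \sum_y' mu s y' * L s y' y = 0.
Hypothesis mu0_sum : \sum_y mu 0 y = 1.
Hypothesis X_markov : markov_process P X (product_weight (mu 0)) G.
Hypothesis GE : forall s phi x, 0 <= s -> G s phi x = particle_gen lam L H s phi x.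

Let N_neq0 : N%:R != 0 :> R. Proof. by rewrite pnatr_eq0 -lt0n. Qed.

Definition generator_matrix s x z : R :=
  particle_gen lam L H s (fun x' => (x' == z)%:R) x.

Lemma particle_gen_linear s phi x :
  particle_gen lam L H s phi x = \sum_z generator_matrix s x z * phi z.
Proof.
have D z : phi z - phi x = \sum_v ((z == v)%:R - (x == v)%:R) * phi v.
  under eq_bigr do rewrite mulrBl.
  have pick w : \sum_v (w == v)%:R * phi v = phi w.
    by rewrite (bigD1 w)//= eqxx mul1r big1 ?addr0// => v /negbTE; rewrite eq_sym => ->; rewrite mul0r.
  by rewrite sumrB !pick.
rewrite /generator_matrix particle_genE//.
under [in RHS]eq_bigr do rewrite particle_genE// mulrDl.
rewrite big_split/=; congr (_ + _).
  under eq_bigr do under eq_bigr do rewrite D mulr_sumr.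
  under [in RHS]eq_bigr do rewrite mulr_suml.
  rewrite [RHS]exchange_big/=; apply: eq_bigr => i _.
  under [in RHS]eq_bigr do rewrite mulr_suml.
  rewrite [RHS]exchange_big/=; apply: eq_bigr => y _.
  by apply: eq_bigr => z _; rewrite mulrA.
under [in RHS]eq_bigr do rewrite -mulrA.
rewrite -[RHS]mulr_sumr; congr (_ * _).
under eq_bigr do under eq_bigr do rewrite D mulr_sumr.
under [in RHS]eq_bigr do rewrite mulr_suml.
rewrite [RHS]exchange_big/=; apply: eq_bigr => i _.
under [in RHS]eq_bigr do rewrite mulr_suml.
rewrite [RHS]exchange_big/=; apply: eq_bigr => y _.
by apply: eq_bigr => z _; rewrite mulrA.
Qed.

Lemma generator_matrix_cont x z : continuous (fun s => generator_matrix s x z).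
Proof.
move=> s; rewrite /generator_matrix /particle_gen /gen_component /gen_apply.
apply: continuous_for_add.
  apply: continuous_for_mul; first exact: lam_cont.
  apply: continuous_bigsum => i _; apply: continuous_bigsum => y _.
  by apply: continuous_for_mul; [exact: L_cont|exact: cst_continuous].
apply: continuous_for_mul; first exact: cst_continuous.
apply: continuous_bigsum => i _; apply: continuous_bigsum => j _.
apply: continuous_for_mul; last exact: cst_continuous.
apply: continuous_for_max; last exact: cst_continuous.
by apply: continuous_for_sub; exact: H_cont.
Qed.

(** The factor [k] is 1 for first moments and 2 for second moments, because the square of the weight
    is the weight of the doubled potential. *)
Let potential (k : R) s x := k * pairing (H s) (empirical x).

Let potential_cont k x : continuous (potential k ^~ x).
Proof.
move=> s; apply: continuous_for_mul; first exact: cst_continuous.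
apply: continuous_bigsum => y _.
by apply: continuous_for_mul; [exact: H_cont|exact: cst_continuous].
Qed.

Lemma backward_exists t f : 0 <= t -> exists g : R -> S -> R,
  (forall y, g t y = f y) /\
  (forall s y, 0 <= s <= t -> is_derive s 1 (g ^~ y) (- drift lam L H s (g s) y)).
Proof.
move=> t0; pose A s y z := (y == z)%:R * H s y - lam s * L s y z.
have cA y z : continuous (fun s => A s y z).
  move=> s; apply: continuous_for_sub; apply: continuous_for_mul.
  - exact: cst_continuous.
  - exact: H_cont.
  - exact: lam_cont.
  - exact: L_cont.
have tt : 0 <= t <= t by rewrite t0 lexx.
have [g [gt dg]] := linear_ode_exists f cA tt.
exists g; split=> // s y st; apply: (is_derive_eq (dg s y st)).
rewrite /A /drift; under eq_bigr do rewrite mulrBl.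
rewrite sumrB opprB; congr (_ - _).
rewrite (bigD1 y)//= eqxx mul1r big1 ?addr0// => z /negbTE; rewrite eq_sym => ->.
by rewrite !mul0r.
Qed.

Lemma pairing_drift s g : 0 <= s <= T ->
  pairing (drift lam L H s g) (mu s) = - pairing (fun y => H s y * g y) (mu s).
Proof.
move=> sT; rewrite /pairing /drift; under eq_bigr do rewrite mulrBl.
suff E : \sum_y (\sum_y' lam s * L s y y' * g y') * mu s y = 0 by rewrite sumrB E sub0r.
under eq_bigr do rewrite mulr_suml.
rewrite exchange_big/= big1// => z _.
rewrite (eq_bigr (fun y => (lam s * g z) * (mu s y * L s y z))).
  by rewrite -mulr_sumr mu_inv// mulr0.
by move=> y _; ring.
Qed.

Lemma is_derive_pairing s (g dg : R -> S -> R) : 0 <= s <= T ->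
  (forall y, is_derive s 1 (g ^~ y) (dg s y)) ->
  is_derive s 1 (fun s => pairing (g s) (mu s))
    (pairing (fun y => dg s y + drift lam L H s (g s) y) (mu s)).
Proof.
move=> sT dgs.
apply: (is_derive_eq (is_derive_bigsum _ (fun y _ => is_derive_mul (dgs y) (mu_derive y sT)))).
have -> : pairing (fun y => dg s y + drift lam L H s (g s) y) (mu s) =
    pairing (dg s) (mu s) + pairing (drift lam L H s (g s)) (mu s).
  by rewrite /pairing -big_split/=; apply: eq_bigr => y _; rewrite mulrDl.
rewrite pairing_drift// /pairing -sumrN -big_split/=; apply: eq_bigr => y _; ring.
Qed.

(** [mu] is invariant under [L] and its density changes at rate [- H], so it solves the equation
    adjoint to the backward one. *)
Lemma pairing_backward_const t s (g : R -> S -> R) : 0 <= s -> s <= t -> t <= T ->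
  (forall s y, 0 <= s <= t -> is_derive s 1 (g ^~ y) (- drift lam L H s (g s) y)) ->
  pairing (g s) (mu s) = pairing (g t) (mu t).
Proof.
move=> s0 st tT dg; symmetry.
apply: (@is_derive0_constant _ (fun s => pairing (g s) (mu s))) => // r /andP[sr rt].
have rT : 0 <= r <= T by apply/andP; split; lra.
have rt' : 0 <= r <= t by apply/andP; split; lra.
apply: (is_derive_eq (is_derive_pairing (dg := fun s y => - drift lam L H s (g s) y) rT (fun y => dg r y rt'))).
by rewrite /pairing big1// => y _; rewrite addNr mul0r.
Qed.

Lemma product_weight_prod (F : 'I_N -> S -> R) (m : S -> R) :
  \sum_(x : state S N) product_weight m x * \prod_i F i (x i) = \prod_(i < N) \sum_y m y * F i y.
Proof.
rewrite bigA_distr_bigA/=; apply: eq_bigr => x _.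
by rewrite /product_weight -big_split.
Qed.

Lemma product_weight_mean f (i : 'I_N) :
  \sum_(x : state S N) product_weight (mu 0) x * f (x i) = pairing f (mu 0).
Proof.
pose F j y := if j == i then f y else 1.
transitivity (\sum_(x : state S N) product_weight (mu 0) x * \prod_j F j (x j)).
  apply: eq_bigr => x _; rewrite (bigD1 i)//= /F eqxx big1 ?mulr1// => j /negbTE->//.
rewrite product_weight_prod (bigD1 i)//= [X in _ * X]big1 ?mulr1.
  by rewrite /pairing; apply: eq_bigr => y _; rewrite /F eqxx mulrC.
by move=> j /negbTE ji; rewrite /F ji; under eq_bigr do rewrite mulr1.
Qed.

Lemma product_weight_mean2 g h (i j : 'I_N) : i != j ->
  \sum_(x : state S N) product_weight (mu 0) x * (g (x i) * h (x j)) =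
  pairing g (mu 0) * pairing h (mu 0).
Proof.
move=> ij; have ji : j != i by rewrite eq_sym.
pose F k y := if k == i then g y else if k == j then h y else 1.
transitivity (\sum_(x : state S N) product_weight (mu 0) x * \prod_k F k (x k)).
  apply: eq_bigr => x _; rewrite (bigD1 i)//= (bigD1 j)//= /F eqxx (negbTE ji) eqxx.
  by rewrite big1 ?mulr1// => k /andP[/negbTE-> /negbTE->].
rewrite product_weight_prod (bigD1 i)//= (bigD1 j)//= [X in _ * (_ * X)]big1 ?mulr1.
  rewrite /F eqxx (negbTE ji) eqxx /pairing.
  by congr (_ * _); apply: eq_bigr => y _; rewrite mulrC.
move=> k /andP[/negbTE ki /negbTE kj].
by rewrite /F ki kj; under eq_bigr do rewrite mulr1.
Qed.

Lemma product_weight_pairing f :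
  \sum_(x : state S N) product_weight (mu 0) x * pairing f (empirical x) = pairing f (mu 0).
Proof.
under eq_bigr do rewrite pairing_empirical mulrCA mulr_sumr.
rewrite -mulr_sumr exchange_big/=; under eq_bigr do rewrite product_weight_mean.
by rewrite sumr_const card_ord -[X in _ * X]mulr_natl mulrA mulVf ?mul1r.
Qed.

(** Distinct particles are independent; the [N] diagonal pairs among [N^2] give the second term. *)
Lemma product_weight_pairing2 g h :
  \sum_(x : state S N) product_weight (mu 0) x * (pairing g (empirical x) * pairing h (empirical x)) =
  (1 - N%:R^-1) * (pairing g (mu 0) * pairing h (mu 0)) +
  N%:R^-1 * pairing (fun y => g y * h y) (mu 0).
Proof.
under eq_bigr do rewrite -pair_mean_prod// /pair_mean mulrCA mulr_sumr.
rewrite -mulr_sumr exchange_big/=.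
have E i : \sum_(x : state S N) product_weight (mu 0) x * \sum_(j < N) g (x i) * h (x j) =
    pairing (fun y => g y * h y) (mu 0) + (N%:R - 1) * (pairing g (mu 0) * pairing h (mu 0)).
  under eq_bigr do rewrite mulr_sumr.
  rewrite exchange_big/= (bigD1 i)//= (product_weight_mean (fun y => g y * h y)); congr (_ + _).
  rewrite (eq_bigr (fun=> pairing g (mu 0) * pairing h (mu 0))); last first.
    by move=> j ji; apply: product_weight_mean2; rewrite eq_sym.
  rewrite sumr_const -[LHS]mulr_natl; congr (_ * _).
  rewrite (eq_card (B := predC1 i)); last by move=> j; rewrite !inE.
  by rewrite cardC1 card_ord -subn1 natrB.
under eq_bigr do rewrite E.
rewrite sumr_const card_ord -[X in _ * X]mulr_natl expr2 invfM.
by field.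
Qed.

Lemma second_moment_backward t phi (k : R) : 0 <= t ->
  exists h : R -> state S N -> R, (forall x, h t x = phi x) /\
  forall s x, 0 <= s <= t -> is_derive s 1 (h ^~ x)
    (- (\sum_z generator_matrix s x z * h s z - potential k s x * h s x)).
Proof.
move=> t0; pose A s x z := (x == z)%:R * potential k s x - generator_matrix s x z.
have cA x z : continuous (fun s => A s x z).
  move=> s; apply: continuous_for_sub; last exact: generator_matrix_cont.
  by apply: continuous_for_mul; [exact: cst_continuous|exact: potential_cont].
have tt : 0 <= t <= t by rewrite t0 lexx.
have [h [ht dh]] := linear_ode_exists phi cA tt.
exists h; split=> // s x st; apply: (is_derive_eq (dh s x st)).
rewrite /A; under eq_bigr do rewrite mulrBl.
rewrite sumrB opprB; congr (_ - _).
rewrite (bigD1 x)//= eqxx mul1r big1 ?addr0// => z /negbTE; rewrite eq_sym => ->.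
by rewrite !mul0r.
Qed.

Let X_meas : forall t x, 0 <= t -> measurable [set w | X t w = x].
Proof. by case: X_markov. Qed.

Let G_mx s phi x : 0 <= s -> G s phi x = \sum_x' generator_matrix s x x' * phi x'.
Proof. by move=> s0; rewrite GE// particle_gen_linear. Qed.

Let weight k t w := expR (- \int[lebesgue_measure]_(s in `[0, t]) potential k s (X s w)).

(** Unbiasedness. By [particle_gen_pairing], integrating a backward solution on [S] against the
    empirical measure yields an exact backward solution for the particle system. *)
Lemma first_moment t f : 0 <= t <= T ->
  bounded_measurable setT (fun w => weight 1 t w * pairing f (empirical (X t w))) /\
  \int[P]_w (weight 1 t w * pairing f (empirical (X t w))) = pairing f (mu t).
Proof.
move=> /andP[t0 tT]; have [g [gt dg]] := backward_exists f t0.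
have dh s x : 0 <= s <= t -> is_derive s 1 (fun s => pairing (g s) (empirical x))
    (- (\sum_x' generator_matrix s x x' * pairing (g s) (empirical x') -
        potential 1 s x * pairing (g s) (empirical x))).
  move=> st; rewrite -(particle_gen_linear s (fun x => pairing (g s) (empirical x))).
  rewrite particle_gen_pairing// /potential mul1r addrK.
  apply: (is_derive_eq (is_derive_bigsum _ (fun y _ => is_derive_mulr (empirical x y) (dg s y st)))).
  by rewrite /pairing -sumrN; apply: eq_bigr => y _; rewrite mulNr.
have [] := feynman_kac X_markov G_mx (@generator_matrix_cont) (@potential_cont 1) t0 dh.
have gf : g t = f by apply/funext.
rewrite gf => bm ->; split=> //.
by rewrite product_weight_pairing (pairing_backward_const (t := t) _ t0 tT dg)// gf.
Qed.

(** The weighted law of the system is constructed as a solution of its forward equation, so that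
    second moments can be differentiated in time; [second_momentE] identifies it with
    expectations. *)
Lemma forward_exists : exists rho : R -> state S N -> R,
  (forall x, rho 0 x = product_weight (mu 0) x) /\
  (forall s x, 0 <= s <= T -> is_derive s 1 (rho ^~ x)
    (\sum_x' rho s x' * generator_matrix s x' x - potential 2 s x * rho s x)).
Proof.
pose A s (x x' : state S N) := generator_matrix s x' x - (x == x')%:R * potential 2 s x.
have cA x x' : continuous (fun s => A s x x').
  move=> s; apply: continuous_for_sub; first exact: generator_matrix_cont.
  by apply: continuous_for_mul; [exact: cst_continuous|exact: potential_cont].
have tt : 0 <= (0 : R) <= T by rewrite T_ge0 andbT.
have [rho [rho0 drho]] := linear_ode_exists (product_weight (mu 0)) cA tt.
exists rho; split=> // s x st; apply: (is_derive_eq (drho s x st)).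
rewrite /A; under eq_bigr do rewrite mulrBl.
rewrite sumrB; congr (_ - _); first by apply: eq_bigr => x' _; rewrite mulrC.
rewrite (bigD1 x)//= eqxx mul1r big1 ?addr0// => x' /negbTE; rewrite eq_sym => ->.
by rewrite !mul0r.
Qed.

Section ForwardLaw.
Variable rho : R -> state S N -> R.
Hypothesis rho0 : forall x, rho 0 x = product_weight (mu 0) x.
Hypothesis rho_derive : forall s x, 0 <= s <= T -> is_derive s 1 (rho ^~ x)
    (\sum_x' rho s x' * generator_matrix s x' x - potential 2 s x * rho s x).

Lemma is_derive_forward s (phi dphi : R -> state S N -> R) : 0 <= s <= T ->
  (forall x, is_derive s 1 (phi ^~ x) (dphi s x)) ->
  is_derive s 1 (fun s => \sum_x rho s x * phi s x)
    (\sum_x rho s x * (dphi s x + particle_gen lam L H s (phi s) x -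
      potential 2 s x * phi s x)).
Proof.
move=> sT dp.
apply: (is_derive_eq (is_derive_bigsum _ (fun x _ => is_derive_mul (rho_derive x sT) (dp x)))).
rewrite big_split/=; under eq_bigr do rewrite mulrBl mulr_suml.
rewrite sumrB exchange_big/= -sumrB -big_split/=; apply: eq_bigr => x _.
rewrite (particle_gen_linear s (phi s)); under eq_bigr do rewrite -mulrA.
by rewrite -mulr_sumr; ring.
Qed.

(** Both sides equal the initial mean of the backward solution [h] with end value [phi]: the left
    one by Feynman-Kac, the right one because [rho] and [h] solve adjoint equations. *)
Lemma second_momentE t phi : 0 <= t <= T ->
  bounded_measurable setT (fun w => weight 2 t w * phi (X t w)) /\
  \int[P]_w (weight 2 t w * phi (X t w)) = \sum_x rho t x * phi x.
Proof.
move=> /andP[t0 tT]; have [h [ht dh]] := second_moment_backward phi 2 t0.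
have [] := feynman_kac X_markov G_mx (@generator_matrix_cont) (@potential_cont 2) t0 dh.
have hf : h t = phi by apply/funext.
rewrite hf => bm ->; split=> //.
under eq_bigr do rewrite -rho0.
rewrite -[in RHS]hf; symmetry.
apply: (@is_derive0_constant _ (fun s => \sum_x rho s x * h s x)) => // r /andP[r0 rt].
have rT : 0 <= r <= T by apply/andP; split; lra.
have rt' : 0 <= r <= t by apply/andP; split; lra.
apply: (is_derive_eq (is_derive_forward (dphi := fun s x =>
  - (\sum_x' generator_matrix s x x' * h s x' - potential 2 s x * h s x)) rT (fun x => dh r x rt'))).
rewrite big1// => x _; rewrite particle_gen_linear; ring.
Qed.

Definition second_moment_measure s y y' : R :=
  \sum_x rho s x * (empirical x y * empirical x y').

Lemma second_moment_measureC s y y' :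
  second_moment_measure s y y' = second_moment_measure s y' y.
Proof. by apply: eq_bigr => x _; rewrite [empirical x y * _]mulrC. Qed.

(** The sign is read off the probabilistic representation. *)
Lemma second_moment_measure_ge0 s y y' : 0 <= s <= T ->
  0 <= second_moment_measure s y y'.
Proof.
move=> sT; rewrite /second_moment_measure.
have [_ /= <-] := second_momentE (fun x => empirical x y * empirical x y') sT.
apply: Rintegral_ge0 => w _; rewrite mulr_ge0 ?expR_ge0//.
by rewrite mulr_ge0// /empirical mulr_ge0 ?invr_ge0// sumr_ge0.
Qed.

Lemma second_moment_pair_mean s (F : S -> S -> R) :
  \sum_y \sum_y' second_moment_measure s y y' * F y y' =
  \sum_x rho s x * pair_mean F x.
Proof.
have E x : pair_mean F x = \sum_y \sum_y' empirical x y * empirical x y' * F y y'.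
  transitivity (pairing (fun y => pairing (F y) (empirical x)) (empirical x)).
    rewrite pairing_empirical /pair_mean expr2 invfM -mulrA; congr (_ * _).
    by rewrite mulr_sumr; apply: eq_bigr => i _; rewrite pairing_empirical.
  rewrite /pairing; apply: eq_bigr => y _; rewrite mulr_suml; apply: eq_bigr => y' _; ring.
under [in RHS]eq_bigr do rewrite E mulr_sumr.
rewrite [RHS]exchange_big/=; apply: eq_bigr => y _.
under [in RHS]eq_bigr do rewrite mulr_sumr.
rewrite [RHS]exchange_big/=; apply: eq_bigr => y' _.
by rewrite mulr_suml; apply: eq_bigr => x _; ring.
Qed.

End ForwardLaw.

Let weight2E t w : 0 <= t -> weight 2 t w = weight 1 t w ^+ 2.
Proof.
move=> t0; rewrite /weight -expRM_natl mulrN; congr (expR (- _)).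
have X_right : right_continuous_path (X ^~ w) by case: X_markov => _ + _; exact.
have int1 k : lebesgue_measure.-integrable `[0, t[
    (EFin \o (fun s => potential k s (X s w))).
  apply: bounded_measurable_integrable => //.
    by rewrite /= lebesgue_measure_itv/=; case: ifP => _; rewrite ?ltry.
  by have [] := frozen_path_cvg (@potential_cont k) X_right t0.
rewrite -!Rintegral_itv_bndo_bndc// -RintegralZl//.
by apply: eq_Rintegral => s _; rewrite /potential mul1r.
Qed.

Let weighted_pairing f t w :
  pairing f (weighted_empirical H (X ^~ w) t) = weight 1 t w * pairing f (empirical (X t w)).
Proof.
rewrite /pairing mulr_sumr; apply: eq_bigr => y _.
rewrite /weighted_empirical /weight mulrCA; congr (expR (- _) * _).
by apply: eq_Rintegral => s _; rewrite /potential mul1r.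
Qed.

(** Everything that the analysis needs from the process. From here on the probability space is
    hidden behind the symmetric nonnegative kernel [b], its evolution equation and its initial
    value. *)
Theorem particle_second_moment : exists b : R -> S -> S -> R,
  [/\ forall s y y', 0 <= s <= T -> 0 <= b s y y',
      forall s y y', b s y y' = b s y' y,
      forall t f, 0 <= t <= T ->
        ('E_P[fun w =>
          (`|pairing f (weighted_empirical H (X ^~ w) t) - pairing f (mu t)| ^+ 2)%R])%E =
        (\sum_y \sum_y' b t y y' * (f y * f y') - pairing f (mu t) ^+ 2)%:E,
      forall s (g h dg dh : R -> S -> R), 0 <= s <= T ->
        (forall y, is_derive s 1 (g ^~ y) (dg s y)) ->
        (forall y, is_derive s 1 (h ^~ y) (dh s y)) ->
        is_derive s 1 (fun s => \sum_y \sum_y' b s y y' * (g s y * h s y'))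
          (\sum_y \sum_y' b s y y' *
            ((dg s y + drift lam L H s (g s) y) * h s y' +
             g s y * (dh s y' + drift lam L H s (h s) y') +
             N%:R^-1 * (carre_du_champ lam L s (g s) (h s) y +
                        selection_square H s (g s) (h s) y y'))) &
      forall g h, \sum_y \sum_y' b 0 y y' * (g y * h y') =
        (1 - N%:R^-1) * (pairing g (mu 0) * pairing h (mu 0)) +
        N%:R^-1 * pairing (fun y => g y * h y) (mu 0)].
Proof.
have [rho [rho0 drho]] := forward_exists.
exists (second_moment_measure rho); split.
- by move=> s y y' sT; exact: second_moment_measure_ge0.
- exact: second_moment_measureC.
- move=> t f tT; have t0 : 0 <= t by case/andP: tT.
  rewrite second_moment_pair_mean; under eq_bigr do rewrite pair_mean_prod//.
  have [b1 E1] := first_moment f tT.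
  have [b2 E2] := second_momentE rho0 drho (fun x => pairing f (empirical x) * pairing f (empirical x)) tT.
  set m := pairing f (mu t) in E1 *.
  pose Y w := weight 2 t w * (pairing f (empirical (X t w)) * pairing f (empirical (X t w))).
  pose Z w := weight 1 t w * pairing f (empirical (X t w)).
  have finP : (P setT < +oo)%E by rewrite probability_setT ltry.
  have b3 : bounded_measurable setT (fun w => -2 * m * Z w).
    by apply: bounded_measurableM => //; exact: bounded_measurable_cst.
  have b4 : bounded_measurable (T := Omega) (R := R) setT (cst (m ^+ 2)).
    exact: bounded_measurable_cst.
  have b34 := bounded_measurableD b3 b4.
  have b234 := bounded_measurableD b2 b34.
  have i (Z : Omega -> R) := bounded_measurable_integrable (mu := P) measurableT finP (f := Z).
  rewrite unlock (eq_integral (fun w => (Y w + (-2 * m * Z w + cst (m ^+ 2) w))%:E)); last first.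
    move=> w _; congr (_%:E); rewrite weighted_pairing /Y weight2E// -/(Z w) real_normK ?num_real//.
    by rewrite /Z/=; ring.
  rewrite -[LHS]fineK; last first.
    by apply: integrable_fin_num => //; exact: i.
  congr (_%:E).
  transitivity (\int[P]_w (Y w + (-2 * m * Z w + cst (m ^+ 2) w))); first by [].
  rewrite RintegralD//; [|exact: (i _ b2)|exact: (i _ b34)].
  rewrite RintegralD//; [|exact: (i _ b3)|exact: (i _ b4)].
  rewrite RintegralZl//; last exact: (i _ b1).
  rewrite Rintegral_cst// [fine _](congr1 fine (probability_setT P)) mulr1 E1 E2.
  by ring.
- move=> s g h dg dh sT Dg Dh.
  rewrite (_ : (fun s => _) = (fun s => \sum_x rho s x *
      (pairing (g s) (empirical x) * pairing (h s) (empirical x)))); last first.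
    apply/funext => r; rewrite second_moment_pair_mean.
    by apply: eq_bigr => x _; rewrite pair_mean_prod.
  have Dp (f df : R -> S -> R) x : (forall y, is_derive s 1 (f ^~ y) (df s y)) ->
      is_derive s 1 (fun s => pairing (f s) (empirical x)) (pairing (df s) (empirical x)).
    move=> Df; exact: is_derive_bigsum (fun y _ => is_derive_mulr (empirical x y) (Df y)).
  apply: (is_derive_eq (is_derive_forward (rho := rho)
    (phi := fun s x => pairing (g s) (empirical x) * pairing (h s) (empirical x))
    (dphi := fun s x => pairing (dg s) (empirical x) * pairing (h s) (empirical x) +
      pairing (g s) (empirical x) * pairing (dh s) (empirical x)) drho sT
    (fun x => is_derive_mul (Dp g dg x Dg) (Dp h dh x Dh)))).
  rewrite second_moment_pair_mean; apply: eq_bigr => x _; congr (_ * _).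
  rewrite !pair_meanD pair_meanZ pair_meanD !pair_mean_prod// pair_mean_left//.
  have pD f1 f2 : pairing (fun y => f1 y + f2 y) (empirical x) =
      pairing f1 (empirical x) + pairing f2 (empirical x).
    by rewrite /pairing -big_split; apply: eq_bigr => y _; rewrite mulrDl.
  by rewrite (pD (dg s)) (pD (dh s)) particle_gen_pairing_prod// /potential; ring.
- move=> g h; rewrite second_moment_pair_mean.
  under eq_bigr do rewrite rho0 pair_mean_prod//.
  exact: product_weight_pairing2.
Qed.

End ParticleMoments.

(** * Propagation of L^p norms on a block *)

Section LpNorms.
Context {R : realType} {S : finType}.
Implicit Types (m f g : S -> R) (p q r c : R).

Lemma Lp_norm_ge0 m p f : 0 <= Lp_norm m p f.
Proof. exact: powR_ge0. Qed.

Let sum_ge0 m p f : (forall x, 0 <= m x) -> 0 <= \sum_x `|f x| `^ p * m x.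
Proof. by move=> m0; apply: sumr_ge0 => x _; rewrite mulr_ge0 ?powR_ge0. Qed.

Lemma Lp_norm_powR m p f : (forall x, 0 <= m x) -> 0 < p ->
  Lp_norm m p f `^ p = \sum_x `|f x| `^ p * m x.
Proof.
by move=> m0 p0; rewrite /Lp_norm -powRrM mulVf ?gt_eqF// powRr1 ?sum_ge0.
Qed.

Lemma Lp_norm_le m p f c : (forall x, 0 <= m x) -> 0 < p -> 0 <= c ->
  \sum_x `|f x| `^ p * m x <= c `^ p -> Lp_norm m p f <= c.
Proof.
move=> m0 p0 c0 H.
have -> : c = (c `^ p) `^ p^-1 by rewrite -powRrM divff ?gt_eqF// powRr1.
by apply: ge0_ler_powR; rewrite ?nnegrE ?invr_ge0 ?powR_ge0 ?sum_ge0// ltW.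
Qed.

Lemma Lp_norm_homo m p f g : (forall x, 0 <= m x) -> 0 < p ->
  (forall x, m x != 0 -> `|f x| <= `|g x|) -> Lp_norm m p f <= Lp_norm m p g.
Proof.
move=> m0 p0 fg; apply: Lp_norm_le => //; first exact: Lp_norm_ge0.
rewrite Lp_norm_powR//; apply: ler_sum => x _.
have [->|mx] := eqVneq (m x) 0; first by rewrite !mulr0.
by rewrite ler_wpM2r// ge0_ler_powR ?nnegrE ?(ltW p0)// fg.
Qed.

Lemma Lp_norm0P m p f : (forall x, 0 <= m x) -> 0 < p -> Lp_norm m p f = 0 ->
  forall x, m x != 0 -> f x = 0.
Proof.
move=> m0 p0 E x mx.
have := Lp_norm_powR f m0 p0; rewrite E powR0 ?gt_eqF// => /esym/eqP.
rewrite psumr_eq0; last by move=> y _; rewrite mulr_ge0 ?powR_ge0.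
move=> /allP/(_ x (mem_index_enum _)); rewrite mulf_eq0 (negbTE mx) orbF powR_eq0.
by rewrite normr_eq0 => /andP[/eqP].
Qed.

(* Young's inequality applied to [f] and [g] normalised in [L^q] and [L^r]. *)
Lemma Lp_norm_holder m p q r f g : (forall x, 0 <= m x) ->
  0 < p -> 0 < q -> 0 < r -> p^-1 = q^-1 + r^-1 ->
  Lp_norm m p (fun x => f x * g x) <= Lp_norm m q f * Lp_norm m r g.
Proof.
move=> m0 p0 q0 r0 pqr.
have := Lp_norm_powR f m0 q0; have := Lp_norm_ge0 m q f; have := @Lp_norm0P m q f m0 q0.
have := Lp_norm_powR g m0 r0; have := Lp_norm_ge0 m r g; have := @Lp_norm0P m r g m0 r0.
generalize (Lp_norm m q f) (Lp_norm m r g) => a b b_0 b0 bE a_0 a0 aE.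
have zero : a * b = 0 -> forall x, m x != 0 -> f x * g x = 0.
  move=> /eqP; rewrite mulf_eq0 => /orP[] /eqP ab x mx.
    by rewrite (a_0 ab) ?mul0r.
  by rewrite (b_0 ab) ?mulr0.
apply: (Lp_norm_le m0 p0 (mulr_ge0 a0 b0)).
have [ab|ab] := eqVneq (a * b) 0.
  rewrite big1 ?powR_ge0// => x _.
  have [->|mx] := eqVneq (m x) 0; first by rewrite mulr0.
  by rewrite zero// normr0 powR0 ?gt_eqF// mul0r.
have {}a0 : 0 < a by rewrite lt_neqAle a0 andbT eq_sym; apply: contraNneq ab => ->; rewrite mul0r.
have {}b0 : 0 < b by rewrite lt_neqAle b0 andbT eq_sym; apply: contraNneq ab => ->; rewrite mulr0.
rewrite (powRM p (ltW a0) (ltW b0)).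
have young x : (`|f x| / a) `^ p * (`|g x| / b) `^ p <=
    p / q * (`|f x| `^ q / a `^ q) + p / r * (`|g x| `^ r / b `^ r).
  have pq0 : 0 < q / p by rewrite divr_gt0.
  have pr0 : 0 < r / p by rewrite divr_gt0.
  have pq1 : (q / p)^-1 + (r / p)^-1 = 1.
    by rewrite !invf_div -mulrDr -pqr divff ?gt_eqF.
  have := conjugate_powR (powR_ge0 (`|f x| / a) p) (powR_ge0 (`|g x| / b) p) pq0 pr0 pq1.
  rewrite -!powRrM ![p * (_ / p)]mulrC !divfK ?gt_eqF// !invf_div.
  have pn y c s : 0 < c -> (`|y| / c) `^ s = `|y| `^ s / c `^ s.
    move=> c0; rewrite powRM ?invr_ge0 ?(ltW c0)//; congr (_ * _).
    by rewrite -powR_inv1 ?(ltW c0)// -powRrM mulN1r powRN.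
  by rewrite !pn// ![_ * (p / _)]mulrC.
have sum_young : \sum_x (`|f x| / a) `^ p * (`|g x| / b) `^ p * m x <= 1.
  apply: (@le_trans _ _ (p / q * (a `^ q / a `^ q) + p / r * (b `^ r / b `^ r))).
    rewrite {1}aE {1}bE !mulr_suml !mulr_sumr -big_split/=.
    apply: ler_sum => x _; apply: (le_trans (ler_wpM2r (m0 x) (young x))).
    by rewrite mulrDl lerD//; lra.
  by rewrite !divff ?gt_eqF ?powR_gt0// !mulr1 -mulrDr -pqr divff ?gt_eqF.
rewrite -[leRHS]mulr1.
have -> : \sum_x `|f x * g x| `^ p * m x =
    a `^ p * b `^ p * \sum_x (`|f x| / a) `^ p * (`|g x| / b) `^ p * m x.
  rewrite mulr_sumr; apply: eq_bigr => x _; rewrite [RHS]mulrA; congr (_ * _).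
  have fa : 0 <= `|f x| / a by rewrite divr_ge0// ltW.
  have gb : 0 <= `|g x| / b by rewrite divr_ge0// ltW.
  have -> : `|f x * g x| = (a * b) * (`|f x| / a * (`|g x| / b)).
    by rewrite normrM; field; rewrite !gt_eqF.
  rewrite (powRM p (mulr_ge0 (ltW a0) (ltW b0)) (mulr_ge0 fa gb)).
  by rewrite (powRM p (ltW a0) (ltW b0)) (powRM p fa gb).
by rewrite ler_wpM2l// mulr_ge0 ?powR_ge0.
Qed.

Lemma Lp_norm1 m f : (forall x, 0 <= m x) -> Lp_norm m 1 f = \sum_x `|f x| * m x.
Proof.
move=> m0; rewrite /Lp_norm invr1; under eq_bigr do rewrite powRr1//.
rewrite powRr1//; apply: sumr_ge0 => x _; exact: mulr_ge0.
Qed.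

Lemma Lp_norm_one m p : (forall x, 0 <= m x) -> 0 < p -> \sum_x m x = 1 ->
  Lp_norm m p (fun=> 1) = 1.
Proof.
move=> m0 p0 m1; rewrite /Lp_norm; under eq_bigr do rewrite normr1 powR1 mul1r.
by rewrite m1 powR1.
Qed.

Lemma Lp_norm_mono m p q f : (forall x, 0 <= m x) -> \sum_x m x = 1 ->
  0 < p -> p <= q -> Lp_norm m p f <= Lp_norm m q f.
Proof.
move=> m0 m1 p0; rewrite le_eqVlt => /predU1P[->//|pq].
have q0 : 0 < q by exact: lt_trans pq.
have d0 : 0 < p^-1 - q^-1 by rewrite subr_gt0 ltf_pV2.
have [r r0 pqr] : exists2 r, 0 < r & p^-1 = q^-1 + r^-1.
  by exists (p^-1 - q^-1)^-1; rewrite ?invr_gt0// invrK subrKC.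
have := Lp_norm_holder f (fun=> 1) m0 p0 q0 r0 pqr.
rewrite [X in _ * X](Lp_norm_one m0 r0 m1) mulr1.
by rewrite (_ : (fun x => f x * 1) = f)//; apply/funext => x; rewrite mulr1.
Qed.

Lemma Lp_norm_sqr m p f : (forall x, 0 <= m x) -> 0 < p ->
  Lp_norm m p (fun x => f x ^+ 2) = Lp_norm m (2 * p) f ^+ 2.
Proof.
move=> m0 p0; rewrite /Lp_norm -[RHS]powR_mulrn ?powR_ge0// -powRrM.
have -> : (2 * p)^-1 * 2%:R = p^-1 by field; rewrite gt_eqF.
have E : \sum_x `|f x ^+ 2| `^ p * m x = \sum_x `|f x| `^ (2 * p) * m x.
  by apply: eq_bigr => x _; rewrite powRrM powR_mulrn// normrX.
by rewrite E.
Qed.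

Lemma Lp_norm_norm m p f : Lp_norm m p (fun x => `|f x|) = Lp_norm m p f.
Proof. by rewrite /Lp_norm; under eq_bigr do rewrite normr_id. Qed.

(** At a zero of [u] the power need not be differentiable; there continuity follows from the
    monotonicity of the power. *)
Lemma continuous_powR_comp (u : R -> R) p s : 0 < p -> (forall r, 0 <= u r) ->
  continuous_at s u -> continuous_at s (fun r => u r `^ p).
Proof.
move=> p0 u0 cu; have := u0 s; rewrite le_eqVlt => /predU1P[us|us].
  apply/cvgrPdist_lt => e e0; rewrite -us powR0 ?gt_eqF//.
  have e1 : 0 < e `^ p^-1 by rewrite powR_gt0.
  have /cvgrPdist_lt/(_ _ e1) := cu; apply: filterS => r.
  rewrite -us !sub0r !normrN ger0_norm// ger0_norm ?powR_ge0// => H.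
  have -> : e = (e `^ p^-1) `^ p by rewrite -powRrM mulVf ?gt_eqF// powRr1// ltW.
  by apply: gt0_ltr_powR; rewrite ?nnegrE ?powR_ge0.
apply: (@continuous_comp _ _ _ u (fun x => x `^ p)) => //.
exact: is_derive_continuous (is_derive1_powR p us).
Qed.

Lemma continuous_Lp_norm (m f : R -> S -> R) p s : 0 < p ->
  (forall r x, 0 <= m r x) -> (forall x, continuous_at s (m ^~ x)) ->
  (forall x, continuous_at s (f ^~ x)) ->
  continuous_at s (fun r => Lp_norm (m r) p (f r)).
Proof.
move=> p0 m0 cm cf; apply: continuous_powR_comp.
- by rewrite invr_gt0.
- by move=> r; exact: sum_ge0.
apply: continuous_bigsum => x _; apply: continuous_for_mul => //.
apply: continuous_powR_comp => //.
by apply: cvg_norm; exact: cf.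
Qed.

(** Carries estimates proved for strictly positive end values over to nonnegative ones, by
    continuity of the norm at [e = 0]. *)
Lemma Lp_norm_addeps m p f c c' : (forall x, 0 <= m x) -> 0 < p -> 0 <= c' ->
  (forall e, 0 < e -> c <= c' * Lp_norm m p (fun x => `|f x| + e)) ->
  c <= c' * Lp_norm m p f.
Proof.
move=> m0 p0 c'0 H; rewrite -Lp_norm_norm.
have cN : continuous_at (0 : R) (fun e => c' * Lp_norm m p (fun x => `|f x| + e)).
  apply: continuous_for_mul; first exact: cst_continuous.
  apply: (continuous_Lp_norm (m := fun=> m) (f := fun e x => `|f x| + e)) => // x.
    exact: cst_continuous.
  by apply: continuous_for_add; [exact: cst_continuous|exact: cvg_id].
have -> : c' * Lp_norm m p (fun x => `|f x|) = c' * Lp_norm m p (fun x => `|f x| + 0).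
  by congr (_ * Lp_norm _ _ _); apply/funext => x; rewrite addr0.
have cR := cvg_at_right_filter cN.
rewrite -(cvg_lim _ cR)//; apply: limr_ge; first by apply/cvg_ex; eexists; exact: cR.
by near=> e; apply: H; near: e; exact: nbhs_right_gt.
Unshelve. all: by end_near. Qed.

End LpNorms.

(* [c |-> U - 2 c V + c^2 W] is nonnegative, being the integral of
   [(x^(p/2-1) - c)^2] over [b, a]; the inequality is its discriminant. *)
Lemma stroock_varopoulos {R : realType} (a b p : R) : 0 < a -> 0 < b -> 1 < p ->
  4 * (p - 1) * (a `^ (p / 2) - b `^ (p / 2)) ^+ 2 <=
  p ^+ 2 * ((a - b) * (a `^ (p - 1) - b `^ (p - 1))).
Proof.
move=> a0 b0 p1; wlog ba : a b a0 b0 / b < a.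
  move=> H; have [ab|ab|->] := ltgtP a b; last by rewrite !subrr expr0n !(mulr0, mul0r).
    have := H b a b0 a0 ab.
    rewrite -[a `^ _ - b `^ (p / 2)]opprB sqrrN -[a - b]opprB -[a `^ _ - b `^ (p - 1)]opprB.
    by rewrite mulrNN.
  exact: H.
have p0 : 0 < p by lra.
pose U := (a `^ (p - 1) - b `^ (p - 1)) / (p - 1).
pose V := 2 / p * (a `^ (p / 2) - b `^ (p / 2)).
have quad c : 0 <= U - 2 * c * V + c ^+ 2 * (a - b).
  pose F (x : R) := (p - 1)^-1 * x `^ (p - 1) - 2 * c * (2 / p) * x `^ (p / 2) + c ^+ 2 * x.
  have dF (x : R) : 0 < x -> is_derive x 1 F ((x `^ (p / 2 - 1) - c) ^+ 2).
    move=> x0.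
    apply: (is_derive_eq (is_derive_add (is_derive_sub
      (is_derive_mull (p - 1)^-1 (is_derive1_powR (p - 1) x0))
      (is_derive_mull (2 * c * (2 / p)) (is_derive1_powR (p / 2) x0)))
      (is_derive_mull (c ^+ 2) (is_derive_id x 1)))).
    have -> : x `^ (p - 1 - 1) = x `^ (p / 2 - 1) ^+ 2.
      rewrite -powR_mulrn ?powR_ge0// -powRrM; congr (_ `^ _); lra.
    have p1' : p - 1 != 0 by rewrite subr_eq0 gt_eqF.
    by field; rewrite p1' gt_eqF.
  have := @le_increment_closed _ (cst 0) F (cst 0) (fun x => (x `^ (p / 2 - 1) - c) ^+ 2) b a (ltW ba).
  rewrite /cst subrr => /(_ _ _)/wrap[|].
    by move=> x /andP[bx _]; apply: dF; exact: lt_le_trans bx.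
  move=> /(_ (fun x _ => sqr_ge0 _)).
  suff -> : F a - F b = U - 2 * c * V + c ^+ 2 * (a - b) by [].
  by rewrite /F /U /V; ring.
have W0 : 0 < a - b by rewrite subr_gt0.
have VUW : V ^+ 2 <= U * (a - b).
  have := quad (V / (a - b)).
  have -> : U - 2 * (V / (a - b)) * V + (V / (a - b)) ^+ 2 * (a - b) =
      U - V ^+ 2 / (a - b) by field; rewrite gt_eqF.
  by rewrite subr_ge0 ler_pdivrMr.
have -> : 4 * (p - 1) * (a `^ (p / 2) - b `^ (p / 2)) ^+ 2 = p ^+ 2 * (p - 1) * V ^+ 2.
  by rewrite /V; field; rewrite gt_eqF.
have -> : p ^+ 2 * ((a - b) * (a `^ (p - 1) - b `^ (p - 1))) =
    p ^+ 2 * (p - 1) * (U * (a - b)).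
  by rewrite /U; field; rewrite subr_eq0 gt_eqF.
by rewrite ler_wpM2l// mulr_ge0 ?sqr_ge0// subr_ge0 ltW.
Qed.

(* The normalised norm [Y = (Z / m)^(1/p) m] with a time-dependent exponent;
   the factor [m] absorbs the mean of [H] over the block [A]. *)
Section LogNorm.
Context {R : realType} {S : finType}.
Variables (A : {set S}) (Q : R -> S -> S -> R) (H mu g : R -> S -> R).
Variables (p dp : R -> R) (s : R).
Implicit Types (x y : S) (phi : S -> R).
Hypothesis A_ne : exists x, x \in A.
Hypothesis mu_gt0 : forall x, 0 < mu s x.
Hypothesis g_gt0 : forall x, x \in A -> 0 < g s x.
Hypothesis Q_ge0 : forall x y, x != y -> 0 <= Q s x y.
Hypothesis Q_row : forall x, \sum_y Q s x y = 0.
Hypothesis Q_balance : forall x y, mu s x * Q s x y = mu s y * Q s y x.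
Hypothesis Q_block : forall x y, x \in A -> y \notin A -> Q s x y = 0.
Hypothesis mu_derive : forall x, is_derive s 1 (mu ^~ x) (- (H s x * mu s x)).
Hypothesis g_derive : forall x, x \in A ->
  is_derive s 1 (g ^~ x) (- (\sum_y Q s x y * g s y - H s x * g s x)).
Hypothesis p_derive : is_derive s 1 p (dp s).
Hypothesis p_gt1 : 1 < p s.

Definition dirichlet_sum r phi : R :=
  2^-1 * \sum_(x in A) \sum_(y in A) (phi y - phi x) ^+ 2 * Q r x y * mu r x.

(** The power is spelled out with [expR] and [ln] so that a time-dependent exponent is handled by
    the chain rule. *)
Definition moment_sum r : R := \sum_(x in A) expR (p r * ln (g r x)) * mu r x.

Definition log_norm r : R :=
  (ln (moment_sum r) - ln (mass (mu r) A)) / p r + ln (mass (mu r) A).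

Definition block_mean_H r : R := (\sum_(x in A) H r x * mu r x) / mass (mu r) A.

(** The mass of [A] times the entropy of [g^p] under the conditional law on [A]. *)
Definition entropy_sum r : R :=
  \sum_(x in A) expR (p r * ln (g r x)) * (p r * ln (g r x)) * mu r x -
  moment_sum r * (ln (moment_sum r) - ln (mass (mu r) A)).

Let Z := moment_sum s.
Let m := mass (mu s) A.
Let c := block_mean_H s.
Let E x := expR (p s * ln (g s x)).

Lemma dirichlet_sum_ge0 phi : 0 <= dirichlet_sum s phi.
Proof.
rewrite /dirichlet_sum mulr_ge0 ?invr_ge0//.
apply: sumr_ge0 => x _; apply: sumr_ge0 => y _.
have [->|xy] := eqVneq x y; first by rewrite subrr expr0n !mul0r.
by rewrite mulr_ge0 ?(ltW (mu_gt0 x))// mulr_ge0 ?sqr_ge0 ?Q_ge0.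
Qed.

Lemma mass_gt0 : 0 < mass (mu s) A.
Proof.
have [x xA] := A_ne; rewrite /mass (bigD1 x)//=.
by apply: ltr_pwDl => //; apply: sumr_ge0 => y _; exact: ltW.
Qed.

Lemma moment_sum_gt0 : 0 < moment_sum s.
Proof.
have [x xA] := A_ne; rewrite /moment_sum (bigD1 x)//=.
apply: ltr_pwDl; first by rewrite mulr_gt0 ?expR_gt0.
by apply: sumr_ge0 => y _; rewrite mulr_ge0 ?expR_ge0// ltW.
Qed.

Let row_in x : x \in A -> \sum_(y in A) Q s x y = 0.
Proof.
move=> xA; rewrite -[RHS](Q_row x) [RHS](bigID (mem A))/=.
by rewrite [X in _ = _ + X]big1 ?addr0// => y /(Q_block xA).
Qed.

Let drift_in x : x \in A -> \sum_y Q s x y * g s y = \sum_(y in A) Q s x y * (g s y - g s x).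
Proof.
move=> xA; under [in RHS]eq_bigr do rewrite mulrBr.
rewrite sumrB -mulr_suml row_in// mul0r subr0 (bigID (mem A))/=.
by rewrite [X in _ + X]big1 ?addr0// => y /(Q_block xA)->; rewrite mul0r.
Qed.

(** Symmetrisation by detailed balance; no rate leaves the block, so the row sums vanish inside
    it. *)
Lemma generator_by_parts phi : \sum_(x in A) phi x * (\sum_y Q s x y * g s y) * mu s x =
  - (2^-1 * \sum_(x in A) \sum_(y in A)
      (phi x - phi y) * (g s x - g s y) * Q s x y * mu s x).
Proof.
pose F x y := phi x * (g s y - g s x) * Q s x y * mu s x.
have -> : \sum_(x in A) phi x * (\sum_y Q s x y * g s y) * mu s x =
    \sum_(x in A) \sum_(y in A) F x y.
  apply: eq_bigr => x xA; rewrite drift_in// mulr_sumr mulr_suml.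
  by apply: eq_bigr => y _; rewrite /F; ring.
have sym : \sum_(x in A) \sum_(y in A) F x y = \sum_(x in A) \sum_(y in A) F y x.
  by rewrite exchange_big.
have -> : \sum_(x in A) \sum_(y in A) F x y =
    2^-1 * (\sum_(x in A) \sum_(y in A) F x y + \sum_(x in A) \sum_(y in A) F y x).
  by rewrite -sym; set u := \sum_(x in A) _; lra.
rewrite -mulrN; congr (_ * _); rewrite -big_split -sumrN/=; apply: eq_bigr => x _.
rewrite -big_split -sumrN/=; apply: eq_bigr => y _; rewrite /F.
have B : Q s y x * mu s y = Q s x y * mu s x by rewrite mulrC -Q_balance mulrC.
by rewrite -2!mulrA -[_ * Q s y x * mu s y]mulrA B; ring.
Qed.

(** The moving exponent contributes the entropy, and the generator contributes the Dirichlet form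
    through [stroock_varopoulos]. The derivatives of the two logarithms of the mass combine to
    [- p (p - 1) c Z], which is what centres [H] at its block mean. *)
Lemma is_derive_log_norm : exists2 l, is_derive s 1 log_norm l &
  dp s * entropy_sum s + (p s - 1) * (4 * dirichlet_sum s (fun x => g s x `^ (p s / 2)) +
    p s * \sum_(x in A) (H s x - c) * g s x `^ p s * mu s x) <= p s ^+ 2 * Z * l.
Proof.
have p0 : 0 < p s by exact: lt_trans ltr01 p_gt1.
have m0 : 0 < m by exact: mass_gt0. have Z0 : 0 < Z by exact: moment_sum_gt0.
have EpowR x : x \in A -> E x = g s x `^ p s.
  by move=> xA; rewrite /E /powR gt_eqF ?g_gt0.
pose dZ := \sum_(x in A) (E x * (dp s * ln (g s x) + p s * ((g s x)^-1 *
    - (\sum_y Q s x y * g s y - H s x * g s x))) * mu s x + E x * - (H s x * mu s x)).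
have DZ : is_derive s 1 moment_sum dZ.
  apply: is_derive_bigsum => x xA; apply: is_derive_mul => //.
  apply: is_derive_comp1; apply: is_derive_mul => //.
  by apply: is_derive_comp1 (g_derive xA); exact: is_derive1_ln (g_gt0 xA).
have Dm : is_derive s 1 (fun r => mass (mu r) A) (- (c * m)).
  rewrite /c /block_mean_H divfK ?gt_eqF// -sumrN.
  by apply: is_derive_bigsum => x _; exact: mu_derive.
have DlnZ : is_derive s 1 (fun r => ln (moment_sum r)) (Z^-1 * dZ).
  exact: is_derive_comp1 (is_derive1_ln Z0) DZ.
have Dlnm : is_derive s 1 (fun r => ln (mass (mu r) A)) (- c).
  apply: (is_derive_eq (is_derive_comp1 (is_derive1_ln m0) Dm)).
  by rewrite mulrN mulrCA mulVf ?mulr1// gt_eqF.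
have Dp1 : is_derive s 1 (fun r => (p r)^-1) (- p s ^- 2 * dp s).
  by apply: (is_derive_eq (is_deriveV _ _)) => //; rewrite gt_eqF.
exists ((Z^-1 * dZ - - c) * (p s)^-1 + (ln Z - ln m) * (- p s ^- 2 * dp s) + - c).
  exact: is_derive_add (is_derive_mul (is_derive_sub DlnZ Dlnm) Dp1) Dlnm.
have -> : p s ^+ 2 * Z * ((Z^-1 * dZ - - c) * (p s)^-1 + (ln Z - ln m) * (- p s ^- 2 * dp s) + - c)
   = p s * dZ + p s * c * Z - dp s * (Z * (ln Z - ln m)) - p s ^+ 2 * c * Z.
  by field; rewrite !gt_eqF.
have dZE : p s * dZ = dp s * (\sum_(x in A) E x * (p s * ln (g s x)) * mu s x)
    - p s ^+ 2 * (\sum_(x in A) g s x `^ (p s - 1) * (\sum_y Q s x y * g s y) * mu s x)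
    + p s * (p s - 1) * (\sum_(x in A) H s x * g s x `^ p s * mu s x).
  rewrite /dZ !mulr_sumr -sumrN -!big_split/=; apply: eq_bigr => x xA.
  have gx := g_gt0 xA.
  have E1 : E x * (g s x)^-1 = g s x `^ (p s - 1).
    rewrite EpowR// -[g s x `^ p s](@mulr_powRB1 _ (g s x)) ?(ltW gx)//.
    by rewrite mulrAC divff ?mul1r// gt_eqF.
  rewrite -E1 -EpowR//; set e := E x; set G := \sum_y _.
  by field; rewrite gt_eqF.
rewrite dZE generator_by_parts /entropy_sum -/Z -/m.
have HC : \sum_(x in A) (H s x - c) * g s x `^ p s * mu s x =
    \sum_(x in A) H s x * g s x `^ p s * mu s x - c * Z.
  rewrite /Z /moment_sum mulr_sumr -sumrB; apply: eq_bigr => x xA.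
  by rewrite -/(E x) EpowR//; ring.
rewrite HC.
set W := \sum_(x in A) \sum_(y in A) _.
have : 4 * (p s - 1) * dirichlet_sum s (fun x => g s x `^ (p s / 2)) <= p s ^+ 2 * (2^-1 * W).
  rewrite /dirichlet_sum /W mulrCA [leRHS]mulrCA ler_wpM2l ?invr_ge0//.
  rewrite !mulr_sumr; apply: ler_sum => x xA; rewrite !mulr_sumr; apply: ler_sum => y yA.
  have [->|xy] := eqVneq x y; first by rewrite !subrr expr0n !(mul0r, mulr0).
  have Qm : 0 <= Q s x y * mu s x by rewrite mulr_ge0 ?Q_ge0// ltW.
  have := ler_wpM2r Qm (stroock_varopoulos (g_gt0 yA) (g_gt0 xA) p_gt1).
  congr (_ <= _); by ring.
set D := dirichlet_sum _ _; set S1 := \sum_(x in A) E x * _ * _.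
set S2 := \sum_(x in A) H s x * _ * _; set lz := ln Z - ln m => HD.
rewrite -subr_ge0.
rewrite (_ : _ - _ = p s ^+ 2 * (2^-1 * W) - 4 * (p s - 1) * D); last by ring.
by rewrite subr_ge0.
Qed.

End LogNorm.

Lemma increment_ge {R : realType} (f : R -> R) (c a b : R) : a <= b ->
  (forall x, a <= x <= b -> exists2 l, is_derive x 1 f l & c <= l) ->
  c * (b - a) <= f b - f a.
Proof.
move=> ab df.
have D x : a <= x <= b -> is_derive x 1 f ('D_1 f x).
  by move=> /df[l [fl _] _]; exact: derivableP.
have Dc x : a <= x <= b -> c <= 'D_1 f x.
  by move=> /df[l [_ <-]].
rewrite mulrBr.
apply: (@le_increment_closed _ (fun x => c * x) f (cst c) (fun x => 'D_1 f x)) => //.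
- move=> x _; rewrite -[X in is_derive _ _ _ X]mulr1; exact: is_derive_mull.
- by move=> x /andP[ax xb]; apply: Dc; rewrite !ltW.
Qed.

Section BlockEstimates.
Context {R : realType} {S : finType}.
Variables (A : {set S}) (Q : R -> S -> S -> R) (H mu : R -> S -> R).
Variables (T omega a pmax : R).
Implicit Types (s t p : R) (x y : S) (f phi : S -> R).
Hypothesis A_ne : exists x, x \in A.
Hypothesis T_gt0 : 0 < T.
Hypothesis omega_ge0 : 0 <= omega.
Hypothesis pmax_ge4 : 4 <= pmax.
Hypothesis mu_gt0 : forall s x, 0 <= s <= T -> 0 < mu s x.
Hypothesis Q_ge0 : forall s x y, 0 <= s <= T -> x != y -> 0 <= Q s x y.
Hypothesis Q_row : forall s x, 0 <= s <= T -> \sum_y Q s x y = 0.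
Hypothesis Q_balance : forall s x y, 0 <= s <= T -> mu s x * Q s x y = mu s y * Q s y x.
Hypothesis Q_block : forall s x y, 0 <= s <= T -> x \in A -> y \notin A -> Q s x y = 0.
Hypothesis mu_derive : forall s x, 0 <= s <= T ->
  is_derive s 1 (mu ^~ x) (- (H s x * mu s x)).
Hypothesis H_osc : forall s x, 0 <= s <= T -> x \in A ->
  - omega <= H s x - block_mean_H A H mu s.
Hypothesis poincare_H : forall s phi, 0 <= s <= T ->
  - (\sum_(x in A) (H s x - block_mean_H A H mu s) * phi x ^+ 2 * mu s x) <=
  4 / pmax * dirichlet_sum A Q mu s phi +
  (\sum_(x in A) phi x ^+ 2 * mu s x) / ((pmax + 3) * T).
Hypothesis log_sobolev : forall s phi, 0 <= s <= T -> (forall x, x \in A -> 0 < phi x) ->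
  17 / 8 * a * omega *
    (\sum_(x in A) phi x ^+ 2 * ln (phi x ^+ 2) * mu s x -
     (\sum_(x in A) phi x ^+ 2 * mu s x) *
     (ln (\sum_(x in A) phi x ^+ 2 * mu s x) - ln (mass (mu s) A))) <=
  dirichlet_sum A Q mu s phi.

Definition block_norm s p f : R := mass (mu s) A * Lp_norm (cond (mu s) A) p f.

Lemma cond_ge0 s x : 0 <= s <= T -> 0 <= cond (mu s) A x.
Proof.
move=> sT; rewrite /cond; case: ifP => // _.
by rewrite divr_ge0 ?(ltW (mu_gt0 _ sT))// ltW// (mass_gt0 A_ne (fun x => mu_gt0 x sT)).
Qed.

Lemma cond_sum (h : S -> R) s : \sum_x h x * cond (mu s) A x =
  (\sum_(x in A) h x * mu s x) / mass (mu s) A.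
Proof.
rewrite (bigID (mem A))/= [X in _ + X]big1 ?addr0; last first.
  by move=> x /negbTE xA; rewrite /cond xA mulr0.
by rewrite mulr_suml; apply: eq_bigr => x xA; rewrite /cond xA mulrA.
Qed.

Section Positive.
Variables (t : R) (g : R -> S -> R).
Hypothesis tT : t <= T.
Hypothesis g_gt0 : forall s x, 0 <= s <= t -> x \in A -> 0 < g s x.
Hypothesis g_derive : forall s x, 0 <= s <= t -> x \in A ->
  is_derive s 1 (g ^~ x) (- (\sum_y Q s x y * g s y - H s x * g s x)).

Let inT s : 0 <= s <= t -> 0 <= s <= T.
Proof. by move=> /andP[-> st]; exact: le_trans tT. Qed.

Lemma expR_log_norm (p : R -> R) s : 0 <= s <= t -> 0 < p s ->
  expR (log_norm A mu g p s) = block_norm s (p s) (g s).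
Proof.
move=> st p0; have sT := inT st.
have m0 := mass_gt0 A_ne (fun x => mu_gt0 x sT).
have Z0 : 0 < moment_sum A mu g p s by exact: (moment_sum_gt0 g p A_ne (fun x => mu_gt0 x sT)).
rewrite /log_norm expRD lnK ?posrE// mulrC; congr (_ * _).
rewrite /Lp_norm (cond_sum (fun x => `|g s x| `^ p s)).
have -> : \sum_(x in A) `|g s x| `^ p s * mu s x = moment_sum A mu g p s.
  apply: eq_bigr => x xA; have gx := g_gt0 st xA.
  by rewrite gtr0_norm// /powR gt_eqF.
by rewrite -ln_div ?posrE// /powR gt_eqF ?divr_gt0// mulrC.
Qed.

(** With a constant exponent there is no entropy term. [poincare_H] lets the Dirichlet form absorb
    the potential up to the rate [1 / ((pmax + 3) T)], which is at most [1 / (7 T)] and costs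
    [exp (1 / 7)] over the time [T]. *)
Lemma Lp_bound_pos s p : 0 <= s <= t -> 1 < p -> p <= pmax ->
  block_norm s p (g s) <= expR (7^-1) * block_norm t p (g t).
Proof.
move=> /andP[s0 st] p1 ppmax; have p0 : 0 < p by exact: lt_trans p1.
have P0 : 0 < pmax by exact: lt_le_trans pmax_ge4.
have t0 : 0 <= t <= t by rewrite lexx (le_trans s0).
rewrite -(expR_log_norm (p := cst p)) ?s0// -(expR_log_norm (p := cst p)) ?t0// -expRD.
rewrite ler_expR.
have : - (7 * T)^-1 * (t - s) <= log_norm A mu g (cst p) t - log_norm A mu g (cst p) s.
  apply: increment_ge => // r /andP[sr rt].
  have rt' : 0 <= r <= t by rewrite rt (le_trans s0).
  have rT := inT rt'.
  have [l dl lH] := is_derive_log_norm (p := cst p) (dp := cst 0) A_ne (fun x => mu_gt0 x rT) (fun x xA => g_gt0 rt' xA)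
    (fun x y => @Q_ge0 r x y rT) (fun x => Q_row x rT) (fun x y => Q_balance x y rT)
    (fun x y => @Q_block r x y rT) (fun x => mu_derive x rT) (fun x xA => g_derive rt' xA)
    (is_derive_cst p r 1) p1.
  exists l => //.
  have m0 := mass_gt0 A_ne (fun x => mu_gt0 x rT).
  have Z0 := moment_sum_gt0 g (cst p) A_ne (fun x => mu_gt0 x rT).
  move: lH; rewrite /= mul0r add0r.
  set D := dirichlet_sum _ _ _ _ _; set HZ := \sum_(x in A) _.
  set Z := moment_sum _ _ _ _ _ in Z0 * => lH.
  have D0 : 0 <= D by exact: dirichlet_sum_ge0 (fun x => mu_gt0 x rT) (fun x y => @Q_ge0 r x y rT) _.
  have sq x : (g r x `^ (p / 2)) ^+ 2 = g r x `^ p.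
    by rewrite -powR_mulrn ?powR_ge0// -powRrM; congr (_ `^ _); lra.
  have PH : - HZ <= 4 / pmax * D + Z / ((pmax + 3) * T).
    have := poincare_H (fun x => g r x `^ (p / 2)) rT.
    congr (- _ <= _ + _ / _).
      by apply: eq_bigr => x _; rewrite sq.
    apply: eq_bigr => x xA; rewrite sq /cst /powR gt_eqF//; exact: g_gt0.
  clearbody D HZ Z.
  have pm4 := pmax_ge4; pose k := ((pmax + 3) * T)^-1.
  have k0 : 0 < k by rewrite invr_gt0 mulr_gt0//; lra.
  have k7 : k <= (7 * T)^-1.
    rewrite lef_pV2 ?posrE ?mulr_gt0//; last lra.
    by rewrite ler_pM2r//; lra.
  have pP : p * (4 / pmax * D) <= 4 * D.
    have -> : p * (4 / pmax * D) = p / pmax * (4 * D) by ring.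
    by rewrite ler_piMl ?mulr_ge0// ler_pdivrMr// mul1r.
  have pHZ : - (p * Z * k) <= 4 * D + p * HZ.
    have := ler_wpM2l (ltW p0) PH; rewrite -/k mulrDr mulrN [p * (Z * k)]mulrA; lra.
  (* The zero-order term enters as [(p - 1) * p * Z * k], which is at most [p ^+ 2 * Z * k]. *)
  have : 0 <= p ^+ 2 * Z * (l + k).
    have pm1 : 0 <= p - 1 by lra.
    have := ler_wpM2l pm1 pHZ; move=> /le_trans/(_ lH) H1.
    have : 0 <= p * Z * k by rewrite !mulr_ge0 ?(ltW p0) ?(ltW Z0) ?(ltW k0).
    rewrite mulrDr; move: H1; nra.
  rewrite pmulr_rge0; last by rewrite mulr_gt0 ?exprn_gt0.
  lra.
have : (t - s) / (7 * T) <= 7^-1.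
  have tT' := tT; rewrite ler_pdivrMr ?mulr_gt0// mulrA mulVf ?mul1r; lra.
rewrite mulNr [_^-1 * _]mulrC; lra.
Qed.

(* The exponent [p u = 1 + (p1 - 1) exp (k (s + delta - u))] decreases from
   [p2] to [p1]; the factor 17/8 of [log_sobolev] is what makes [delta = 2/(17 omega)]
   long enough for this. *)
Lemma hypercontractive_pos s delta p1 p2 : 0 <= s -> 0 < delta -> s + delta <= t ->
  17 * omega * delta = 2 -> 1 < p1 -> p1 < p2 -> ln ((p2 - 1) / (p1 - 1)) <= a ->
  block_norm s p2 (g s) <= expR (2 / 17) * block_norm (s + delta) p1 (g (s + delta)).
Proof.
move=> s0 d0 sdt od p11 p12 lna.
pose k := ln ((p2 - 1) / (p1 - 1)) / delta.
pose p (u : R) := 1 + (p1 - 1) * expR (k * (s + delta - u)).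
pose dp (u : R) := - k * (p u - 1).
have q1 : 0 < p1 - 1 by lra. have q2 : 0 < p2 - 1 by lra.
have p_gt1 (u : R) : 1 < p u by rewrite /p ltrDl mulr_gt0 ?expR_gt0.
have ps : p s = p2.
  rewrite /p (_ : s + delta - s = delta); last by ring.
  rewrite /k divfK ?gt_eqF// lnK ?posrE ?divr_gt0//.
  by rewrite mulrC divfK ?gt_eqF//; ring.
have psd : p (s + delta) = p1 by rewrite /p subrr mulr0 expR0; ring.
have dpE (u : R) : is_derive u 1 p (dp u).
  have D1 : is_derive u 1 (fun u : R => s + delta - u) (0 - 1) by exact: is_derive_sub.
  have D2 := is_derive_comp1 (g := fun u => k * (s + delta - u))
    (is_derive_expR (k * (s + delta - u))) (is_derive_mull k D1).
  have D3 : is_derive u 1 p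
      (0 + (p1 - 1) * (expR (k * (s + delta - u)) * (k * (0 - 1)))).
    by apply: is_derive_add; exact: is_derive_mull.
  by apply: (is_derive_eq D3); rewrite /dp /p; ring.
have k0 : 0 <= k.
  rewrite divr_ge0 ?(ltW d0)// ln_ge0// ler_pdivlMr// mul1r; lra.
(* As [a / delta = 17 / 2 * a * omega] and [17 / 2 = 4 * (17 / 8)], the inequality [log_sobolev]
   will bound [k * ent] by [4 * D]. *)
have ka : k <= 17 / 2 * a * omega.
  rewrite ler_pdivrMr//; apply: (le_trans lna).
  rewrite (_ : _ * delta = a * (17 * omega * delta) / 2); last by ring.
  by rewrite od mulfK.
have st : 0 <= s <= t by rewrite s0 /=; lra.
have sdt' : 0 <= s + delta <= t by rewrite sdt andbT addr_ge0// ltW.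
have pos u : 0 < p u by exact: lt_trans ltr01 (p_gt1 u).
have := expR_log_norm (p := p) st (pos s); rewrite ps => <-.
have := expR_log_norm (p := p) sdt' (pos _); rewrite psd => <-.
rewrite -expRD ler_expR.
have : - omega * (s + delta - s) <= log_norm A mu g p (s + delta) - log_norm A mu g p s.
  apply: increment_ge => [|u /andP[su usd]]; first by rewrite lerDl ltW.
  have ut : 0 <= u <= t by rewrite (le_trans s0 su) (le_trans usd).
  have uT := inT ut.
  have [l dl lH] := is_derive_log_norm A_ne (fun x => mu_gt0 x uT)
    (fun x xA => g_gt0 ut xA) (fun x y => @Q_ge0 u x y uT) (fun x => Q_row x uT)
    (fun x y => Q_balance x y uT) (fun x y => @Q_block u x y uT)
    (fun x => mu_derive x uT) (fun x xA => g_derive ut xA) (dpE u) (p_gt1 u).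
  exists l => //.
  have Z0 := moment_sum_gt0 g p A_ne (fun x => mu_gt0 x uT).
  have sq x : (g u x `^ (p u / 2)) ^+ 2 = g u x `^ p u.
    by rewrite -powR_mulrn ?powR_ge0// -powRrM; congr (_ `^ _); lra.
  have ME x : x \in A -> expR (p u * ln (g u x)) = g u x `^ p u.
    by move=> xA; rewrite /powR gt_eqF// g_gt0.
  have D0 := dirichlet_sum_ge0 A (fun x => mu_gt0 x uT) (fun x y => @Q_ge0 u x y uT)
    (fun x => g u x `^ (p u / 2)).
  have ent : 17 / 8 * a * omega * entropy_sum A mu g p u <=
      dirichlet_sum A Q mu u (fun x => g u x `^ (p u / 2)).
    have := @log_sobolev u (fun x => g u x `^ (p u / 2)) uT.
    move=> /(_ (fun x xA => powR_gt0 _ (g_gt0 ut xA))).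
    have MZ : \sum_(x in A) (g u x `^ (p u / 2)) ^+ 2 * mu u x = moment_sum A mu g p u.
      by apply: eq_bigr => x xA; rewrite sq ME.
    rewrite MZ (eq_bigr (fun x => expR (p u * ln (g u x)) * (p u * ln (g u x)) * mu u x))//.
    by move=> x xA; rewrite sq ME// ln_powR.
  have HZ : - (omega * moment_sum A mu g p u) <=
      \sum_(x in A) (H u x - block_mean_H A H mu u) * g u x `^ p u * mu u x.
    rewrite /moment_sum mulr_sumr -sumrN; apply: ler_sum => x xA.
    rewrite ME// mulrA -mulNr -mulNr.
    by rewrite ler_wpM2r ?(ltW (mu_gt0 x uT))// ler_wpM2r ?powR_ge0// H_osc.
  move: lH HZ ent D0 Z0; rewrite /dp.
  set D := dirichlet_sum _ _ _ _ _; set HZ := \sum_(x in A) _; set ent := entropy_sum _ _ _ _ _.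
  set Z := moment_sum _ _ _ _ _; move=> lH HZo entD D0 Z0.
  have kE : k * ent <= 4 * D.
    have [e0|e0] := leP ent 0.
      by apply: (@le_trans _ _ 0); [exact: mulr_ge0_le0|exact: mulr_ge0].
    apply: (le_trans (ler_wpM2r (ltW e0) ka)).
    have -> : 17 / 2 * a * omega * ent = 4 * (17 / 8 * a * omega * ent) by field.
    by rewrite ler_pM2l.
  have := p_gt1 u; move: lH; set P := p u; clearbody P D HZ ent Z => lH P1.
  have P0 : 0 < P by lra.
  have : 0 <= P ^+ 2 * Z * (l + omega).
    have pm1 : 0 <= P - 1 by lra.
    have h1 : 0 <= (P - 1) * (4 * D - k * ent) by rewrite mulr_ge0// subr_ge0.
    have h2 : 0 <= (P - 1) * P * (HZ + omega * Z).
      by rewrite mulr_ge0// ?mulr_ge0 ?(ltW P0)//; lra.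
    have h3 : 0 <= P * (omega * Z) by rewrite !mulr_ge0 ?omega_ge0 ?(ltW P0) ?(ltW Z0).
    nra.
  rewrite pmulr_rge0; last by rewrite mulr_gt0 ?exprn_gt0.
  lra.
have -> : - omega * (s + delta - s) = - (2 / 17).
  by rewrite -od; field.
lra.
Qed.

End Positive.

Section Nonnegative.
Variables (t : R) (g u : R -> S -> R).
Hypothesis tT : 0 <= t <= T.
Hypothesis g_ge0 : forall s x, 0 <= s <= t -> x \in A -> 0 <= g s x.
Hypothesis g_derive : forall s x, 0 <= s <= t -> x \in A ->
  is_derive s 1 (g ^~ x) (- (\sum_y Q s x y * g s y - H s x * g s x)).
Hypothesis u_gt0 : forall s x, 0 <= s <= t -> x \in A -> 0 < u s x.
Hypothesis u_end : forall x, x \in A -> u t x = 1.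
Hypothesis u_derive : forall s x, 0 <= s <= t -> x \in A ->
  is_derive s 1 (u ^~ x) (- (\sum_y Q s x y * u s y - H s x * u s x)).

(** Logarithms need strict positivity. It is gained by adding [e] times the solution with end value
    1, which changes the end value by exactly [e]. *)
Let ge (e : R) s x := g s x + e * u s x.

Let ge_gt0 (e : R) s x : 0 < e -> 0 <= s <= t -> x \in A -> 0 < ge e s x.
Proof. by move=> e0 st xA; rewrite ltr_wpDl ?g_ge0// mulr_gt0// u_gt0. Qed.

Let ge_derive e s x : 0 <= s <= t -> x \in A ->
  is_derive s 1 (ge e ^~ x) (- (\sum_y Q s x y * ge e s y - H s x * ge e s x)).
Proof.
move=> st xA.
apply: (is_derive_eq (is_derive_add (g_derive st xA) (is_derive_mull e (u_derive st xA)))).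
rewrite /ge; under [in RHS]eq_bigr do rewrite mulrDr mulrCA.
by rewrite big_split/= -mulr_sumr; ring.
Qed.

Let extend (C : R) s p1 p2 : 0 <= C -> 0 <= s <= t -> 0 < p1 -> 0 < p2 ->
  (forall e : R, 0 < e -> block_norm s p2 (ge e s) <= C * block_norm t p1 (ge e t)) ->
  block_norm s p2 (g s) <= C * block_norm t p1 (g t).
Proof.
move=> C0 st p10 p20 HC.
have sT : 0 <= s <= T by case/andP: st tT => -> st /andP[_]; exact: le_trans.
have mt := mass_gt0 A_ne (fun x => mu_gt0 x tT).
have ms := mass_gt0 A_ne (fun x => mu_gt0 x sT).
rewrite [C * _]mulrA; apply: Lp_norm_addeps => //.
- by move=> x; exact: cond_ge0.
- by rewrite mulr_ge0// ltW.
move=> e e0; apply: (@le_trans _ _ (block_norm s p2 (ge e s))).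
  apply: (ler_wpM2l (ltW ms)).
  apply: (Lp_norm_homo (fun x => cond_ge0 x sT) p20) => x.
  rewrite /cond; case: ifP => [xA _|_]; last by rewrite eqxx.
  rewrite (ger0_norm (g_ge0 st xA)) (ger0_norm (ltW (ge_gt0 e0 st xA))).
  by rewrite lerDl (mulr_ge0 (ltW e0) (ltW (u_gt0 st xA))).
apply: (le_trans (HC e e0)); rewrite -mulrA; apply: (ler_wpM2l C0); apply: (ler_wpM2l (ltW mt)).
have tt : 0 <= t <= t by case/andP: tT => -> _; exact: lexx.
apply: (Lp_norm_homo (fun x => cond_ge0 x tT) p10) => x.
rewrite /cond; case: ifP => [xA _|_]; last by rewrite eqxx.
rewrite /ge (u_end xA) mulr1 (ger0_norm (g_ge0 tt xA)).
by rewrite (ger0_norm (addr_ge0 (g_ge0 tt xA) (ltW e0))).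
Qed.

Lemma Lp_bound s p : 0 <= s <= t -> 1 < p -> p <= pmax ->
  block_norm s p (g s) <= expR (7^-1) * block_norm t p (g t).
Proof.
move=> st p1 pP; have p0 : 0 < p by exact: lt_trans p1.
apply: (extend (expR_ge0 _) st p0 p0) => e e0.
have tT' : t <= T by case/andP: tT.
exact: (Lp_bound_pos tT' (fun r x => @ge_gt0 e r x e0) (fun r x => @ge_derive e r x)).
Qed.

(** The exponent is lowered from [p2] to [p1] on [[s, s + delta]], at cost [exp (2 / 17)], and then
    kept up to [t], at cost [exp (1 / 7)]. *)
Lemma hypercontractive_bound s delta p1 p2 : 0 <= s -> 0 < delta -> s + delta <= t ->
  17 * omega * delta = 2 -> 1 < p1 -> p1 <= pmax -> p1 < p2 ->
  ln ((p2 - 1) / (p1 - 1)) <= a ->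
  block_norm s p2 (g s) <= expR (2 / 17 + 7^-1) * block_norm t p1 (g t).
Proof.
move=> s0 d0 sdt od p11 p1P p12 lna.
have p10 : 0 < p1 by exact: lt_trans p11. have p20 : 0 < p2 by exact: lt_trans p12.
have sd0 : 0 <= s + delta by rewrite addr_ge0// ltW.
have st : 0 <= s <= t by rewrite s0; apply: le_trans sdt; rewrite lerDl ltW.
apply: (extend (expR_ge0 _) st p10 p20) => e e0; rewrite expRD -mulrA.
have tT' : t <= T by case/andP: tT.
apply: (le_trans (hypercontractive_pos tT' (fun r x => @ge_gt0 e r x e0)
  (fun r x => @ge_derive e r x) s0 d0 sdt od p11 p12 lna)).
apply: (ler_wpM2l (expR_ge0 _)).
by apply: (Lp_bound_pos tT' (fun r x => @ge_gt0 e r x e0) (fun r x => @ge_derive e r x));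
  rewrite ?sd0.
Qed.

End Nonnegative.

End BlockEstimates.

Lemma is_derive_expR_lin {R : realType} (t k s : R) :
  is_derive s 1 (fun s => expR (k * (t - s))) (- k * expR (k * (t - s))).
Proof.
have D1 := is_derive_comp1 (g := fun u => k * (t - u)) (is_derive_expR (k * (t - s)))
  (is_derive_mull k (is_derive_sub (is_derive_cst t s 1) (is_derive_id s 1))).
by apply: (is_derive_eq D1); ring.
Qed.

(** * Order properties of backward solutions *)

Section BackwardSolutions.
Context {R : realType} {S : finType}.
Variables (lam : R -> R) (L : R -> S -> S -> R) (H : R -> S -> R).
Implicit Types (s t : R) (x y : S) (f : S -> R) (g h w : R -> S -> R) (A : {set S}).

Definition backward t g : Prop := forall s y, 0 <= s <= t ->
  is_derive s 1 (g ^~ y) (- drift lam L H s (g s) y).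

Lemma drift_lin s c g h y : drift lam L H s (fun z => c * g s z + h s z) y =
  c * drift lam L H s (g s) y + drift lam L H s (h s) y.
Proof.
rewrite /drift; under eq_bigr do rewrite mulrDr mulrCA.
by rewrite big_split/= -mulr_sumr; ring.
Qed.

Lemma backward_lin t c g h : backward t g -> backward t h ->
  backward t (fun s y => c * g s y + h s y).
Proof.
move=> bg bh s y st.
apply: (is_derive_eq (is_derive_add (is_derive_mull c (bg s y st)) (bh s y st))).
by rewrite drift_lin; ring.
Qed.

Hypothesis lam_cont : continuous lam.
Hypothesis L_cont : forall y y', continuous (fun s => L s y y').
Hypothesis H_cont : forall y, continuous (H ^~ y).
Variable T : R.
Hypothesis Q_ge0 : forall s x y, 0 <= s <= T -> x != y -> 0 <= lam s * L s x y.
Hypothesis L_row : forall s y, \sum_y' L s y y' = 0.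

(** The matrix [lam L - H + k] has nonnegative off-diagonal entries; the shift [k] affects the
    diagonal alone, so its sign is free. *)
Lemma backward_supersol t (k : R) w (dw : R -> S -> R) : t <= T ->
  (forall s y, 0 <= s <= t -> is_derive s 1 (w ^~ y) (dw s y)) ->
  (forall s y, 0 <= s <= t -> drift lam L H s (w s) y + k * w s y <= - dw s y) ->
  (forall y, 0 <= w t y) -> forall s y, 0 <= s <= t -> 0 <= w s y.
Proof.
move=> tT dws ws wt s y st.
pose A s x y := lam s * L s x y + (y == x)%:R * (k - H s x).
have AE s' x' : \sum_z A s' x' z * w s' z = drift lam L H s' (w s') x' + k * w s' x'.
  rewrite /A /drift; under eq_bigr do rewrite mulrDl.
  rewrite big_split/= [X in _ + X = _](bigD1 x')//= eqxx mul1r [X in _ + (_ + X)]big1 ?addr0.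
    by ring.
  by move=> z /negbTE ->; rewrite !mul0r.
apply: (maximum_principle (A := A) (dw := dw) (b := t)) => //.
- move=> x' y' s'; apply: continuous_for_add; apply: continuous_for_mul.
  + exact: lam_cont.
  + exact: L_cont.
  + exact: cst_continuous.
  + by apply: continuous_for_sub; [exact: cst_continuous|exact: H_cont].
- move=> s' x' y' /andP[s0 st'] xy; rewrite /A eq_sym (negbTE xy) mul0r addr0.
  by apply: Q_ge0 => //; rewrite s0 (le_trans st').
- by move=> s' x' st'; rewrite AE; exact: ws.
Qed.

Lemma backward_ge0 t g : t <= T -> backward t g -> (forall y, 0 <= g t y) ->
  forall s y, 0 <= s <= t -> 0 <= g s y.
Proof.
move=> tT bg; apply: (backward_supersol (k := 0) tT bg) => s y st.
by rewrite mul0r addr0 opprK.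
Qed.

Lemma backward_abs t g h : t <= T -> backward t g -> backward t h ->
  (forall y, `|g t y| <= h t y) -> forall s y, 0 <= s <= t -> `|g s y| <= h s y.
Proof.
move=> tT bg bh gh s y st; rewrite ler_norml; apply/andP; split.
  have := backward_ge0 tT (backward_lin 1 bg bh) _ y st.
  rewrite mul1r => H0; rewrite lerNl -subr_ge0 opprK addrC.
  by apply: H0 => z; have := gh z; rewrite ler_norml => /andP[]; lra.
have := backward_ge0 tT (backward_lin (-1) bg bh) _ y st.
rewrite mulN1r => H0; rewrite -subr_ge0 addrC.
by apply: H0 => z; have := gh z; rewrite ler_norml => /andP[]; lra.
Qed.

Variable omega : R.
Hypothesis H_bound : forall s y, 0 <= s <= T -> `|H s y| <= omega.

(** [exp (- omega (t - s))], constant in space, is a subsolution with end value 1, since [L] kills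
    constants and [H <= omega]. *)
Lemma backward_gt0 t u : t <= T -> backward t u -> (forall y, u t y = 1) ->
  forall s y, 0 <= s <= t -> 0 < u s y.
Proof.
move=> tT bu u1 s y st.
suff: 0 <= u s y - expR (- omega * (t - s)).
  by rewrite subr_ge0; apply: lt_le_trans; exact: expR_gt0.
apply: (backward_supersol (k := 0) (w := fun s y => u s y - expR (- omega * (t - s)))
  (dw := fun s y => - drift lam L H s (u s) y - (- - omega * expR (- omega * (t - s)))) tT) => //.
- by move=> s' y' st'; apply: is_derive_sub; [exact: bu|exact: is_derive_expR_lin].
- move=> s' y' st'; rewrite mul0r addr0 /drift.
  under eq_bigr do rewrite mulrBr.
  rewrite sumrB -mulr_suml -mulr_sumr L_row mulr0 mul0r.
  have s'T : 0 <= s' <= T by case/andP: st' => -> /= /le_trans; apply.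
  have := expR_ge0 (- omega * (t - s')); set e := expR _ => e0.
  have := H_bound y' s'T; rewrite ler_norml => /andP[_ h1].
  have := ler_wpM2r e0 h1; nra.
- by move=> z; rewrite u1 subrr mulr0 expR0 subrr.
Qed.

(** [g^2] solves the equation of [w] up to a carre du champ of favourable sign and an extra term
    [- H g^2 <= omega g^2], which the exponential absorbs. *)
Lemma backward_sqr t g w : t <= T -> backward t g -> backward t w ->
  (forall y, w t y = g t y ^+ 2) ->
  forall s y, 0 <= s <= t -> g s y ^+ 2 <= expR (omega * (t - s)) * w s y.
Proof.
move=> tT bg bw wg s y st; rewrite -subr_ge0.
pose e s := expR (omega * (t - s)).
apply: (backward_supersol (k := omega) (w := fun s y => e s * w s y - g s y ^+ 2)
  (dw := fun s y => (- omega * e s * w s y + e s * - drift lam L H s (w s) y) -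
     (- drift lam L H s (g s) y * g s y + g s y * - drift lam L H s (g s) y)) tT) => //.
- move=> s' y' st'; apply: is_derive_sub.
    by apply: is_derive_mul; [exact: is_derive_expR_lin|exact: bw].
  by apply: is_derive_mul; exact: bg.
- move=> s' y' st'; have s'T : 0 <= s' <= T by case/andP: st' => -> /= /le_trans; apply.
  set E := e s'.
  have -> : drift lam L H s' (fun y => E * w s' y - g s' y ^+ 2) y' =
      E * drift lam L H s' (w s') y' - drift lam L H s' (fun y => g s' y ^+ 2) y'.
    rewrite /drift; under eq_bigr do rewrite mulrBr mulrCA.
    by rewrite sumrB -mulr_sumr; ring.
  have C0 : 0 <= carre_du_champ lam L s' (g s') (g s') y'.
    apply: sumr_ge0 => z _; have [->|zy] := eqVneq z y'; first by rewrite subrr !mulr0.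
    by rewrite mulr_ge0 ?Q_ge0 1?eq_sym// -expr2 sqr_ge0.
  have CE : drift lam L H s' (fun y => g s' y ^+ 2) y' =
      carre_du_champ lam L s' (g s') (g s') y' + 2 * g s' y' * drift lam L H s' (g s') y'
      + H s' y' * g s' y' ^+ 2.
    rewrite /drift /carre_du_champ.
    have -> : \sum_z lam s' * L s' y' z * ((g s' z - g s' y') * (g s' z - g s' y')) =
      \sum_z lam s' * L s' y' z * g s' z ^+ 2 -
      2 * g s' y' * (\sum_z lam s' * L s' y' z * g s' z) +
      g s' y' ^+ 2 * (lam s' * \sum_z L s' y' z).
      rewrite !mulr_sumr -sumrB -big_split/=; apply: eq_bigr => z _; ring.
    by rewrite L_row; ring.
  rewrite CE; have := H_bound y' s'T; rewrite ler_norml => /andP[h1 _].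
  have := ler_wpM2r (sqr_ge0 (g s' y')) h1.
  set D := drift _ _ _ _ _ _; set D' := drift _ _ _ _ _ _; nra.
- by move=> z; rewrite wg /e subrr mulr0 expR0 mul1r subrr.
Qed.

Lemma backward_restrict t g A : backward t g ->
  (forall s x y, 0 <= s <= t -> (x \in A) != (y \in A) -> L s x y = 0) ->
  backward t (fun s y => if y \in A then g s y else 0).
Proof.
move=> bg LA s y st.
case yA: (y \in A).
  apply: (is_derive_eq (bg s y st)); rewrite /drift yA; congr (- (_ - _)).
  apply: eq_bigr => z _; case: ifP => // zA.
  by rewrite LA ?mulr0 ?mul0r// yA zA.
apply: (is_derive_eq (is_derive_cst (0 : R) s (1 : R))).
rewrite /drift yA mulr0 subr0 big1 ?oppr0// => z _; case: ifP => zA; last by rewrite mulr0.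
by rewrite LA ?mulr0 ?mul0r// yA zA.
Qed.

End BackwardSolutions.

(** * Norms under the conditional laws on blocks, and elementary numerical estimates *)

Section BlockNorms.
Context {R : realType} {S : finType}.
Implicit Types (c m f g h : S -> R) (A : {set S}).

Lemma normr_pairing_le c p f : (forall x, 0 <= c x) -> \sum_x c x = 1 -> 1 <= p ->
  `|pairing f c| <= Lp_norm c p f.
Proof.
move=> c0 c1 p1; apply: (@le_trans _ _ (Lp_norm c 1 f)); last exact: Lp_norm_mono.
rewrite Lp_norm1//; apply: le_trans (ler_norm_sum _ _ _) _; apply: ler_sum => x _.
by rewrite normrM (ger0_norm (c0 x)).
Qed.

Lemma pairing_sqr c f : (forall x, 0 <= c x) ->
  pairing (fun x => f x ^+ 2) c = Lp_norm c 2 f ^+ 2.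
Proof.
move=> c0; rewrite -[X in Lp_norm c X]mulr1 -(Lp_norm_sqr f c0 ltr01) Lp_norm1//.
by apply: eq_bigr => x _; rewrite (ger0_norm (sqr_ge0 _)).
Qed.

Lemma pairing_norm_le c p f : (forall x, 0 <= c x) -> \sum_x c x = 1 -> 1 <= p ->
  pairing (fun x => `|f x|) c <= Lp_norm c p f.
Proof.
move=> c0 c1 p1; rewrite -Lp_norm_norm.
exact: le_trans (ler_norm _) (normr_pairing_le _ c0 c1 p1).
Qed.

Lemma pairing_norm_sqr_le c h g : (forall x, 0 <= c x) ->
  pairing (fun x => `|h x| * g x ^+ 2) c <= Lp_norm c 2 h * Lp_norm c 4 g ^+ 2.
Proof.
move=> c0.
have two0 : 0 < 2 :> R by [].
have hq : 1^-1 = 2^-1 + 2^-1 :> R by lra.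
have := @Lp_norm_holder _ _ c 1 2 2 h (fun x => g x ^+ 2) c0 ltr01 two0 two0 hq.
rewrite Lp_norm1// (Lp_norm_sqr g c0 two0) -natrM; apply: le_trans.
apply: ler_sum => x _; rewrite ler_wpM2r// normrM ler_wpM2l//.
by rewrite (ger0_norm (sqr_ge0 _)).
Qed.

Section OneBlock.
Variables (m : S -> R) (A : {set S}).
Hypothesis m_gt0 : forall x, 0 < m x.
Hypothesis A_ne : exists x, x \in A.

Lemma mass_pos : 0 < mass m A.
Proof. exact: (@mass_gt0 R S A (fun=> m) 0 A_ne m_gt0). Qed.

Lemma cond_nonneg x : 0 <= cond m A x.
Proof. by rewrite /cond; case: ifP => // _; rewrite divr_ge0 ?ltW ?mass_pos. Qed.

Lemma pairing_cond f : pairing f (cond m A) = (\sum_(x in A) f x * m x) / mass m A.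
Proof.
rewrite /pairing (bigID (mem A))/= [X in _ + X]big1 ?addr0; last first.
  by move=> x /negbTE xA; rewrite /cond xA mulr0.
by rewrite mulr_suml; apply: eq_bigr => x xA; rewrite /cond xA mulrA.
Qed.

Lemma cond_sum1 : \sum_x cond m A x = 1.
Proof.
have := pairing_cond (fun=> 1); rewrite /pairing.
under eq_bigr do rewrite mul1r; move=> ->.
under eq_bigr do rewrite mul1r.
by rewrite divff// gt_eqF// mass_pos.
Qed.

Lemma mass_pairing_cond f : mass m A * pairing f (cond m A) = \sum_(x in A) f x * m x.
Proof. by rewrite pairing_cond mulrC divfK// gt_eqF// mass_pos. Qed.

Lemma Lp_norm_cond_eq p f g : (forall x, x \in A -> f x = g x) ->
  Lp_norm (cond m A) p f = Lp_norm (cond m A) p g.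
Proof.
move=> fg; congr (_ `^ _); apply: eq_bigr => x _; rewrite /cond.
by case: ifP => [xA|_]; [rewrite fg|rewrite !mulr0].
Qed.

Lemma Lp_norm_cond_ge p f x : 1 <= p -> x \in A ->
  `|f x| * m x <= mass m A * Lp_norm (cond m A) p f.
Proof.
move=> p1 xA.
have := pairing_norm_le f cond_nonneg cond_sum1 p1.
rewrite -(ler_pM2l mass_pos); apply: le_trans; rewrite mass_pairing_cond.
rewrite (bigD1 x)//= lerDl; apply: sumr_ge0 => y _.
by rewrite mulr_ge0// ltW.
Qed.

End OneBlock.

Section Partition.
Context {I : finType}.
Variables (m : S -> R) (Si : I -> {set S}).
Hypothesis m_gt0 : forall x, 0 < m x.
Hypothesis Si_nonempty : forall i, exists x, x \in Si i.
Hypothesis Si_disjoint : forall i j x, x \in Si i -> x \in Si j -> i = j.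
Hypothesis Si_cover : forall x, exists i, x \in Si i.

Lemma sum_partition (F : S -> R) : \sum_x F x = \sum_i \sum_(x in Si i) F x.
Proof.
under [in RHS]eq_bigr do rewrite big_mkcond.
rewrite exchange_big/=; apply: eq_bigr => x _.
have [i xi] := Si_cover x; rewrite (bigD1 i)//= xi big1 ?addr0// => j ji.
by case: ifP => // xj; rewrite (Si_disjoint xi xj) eqxx in ji.
Qed.

Lemma pairing_partition f :
  pairing f m = \sum_i mass m (Si i) * pairing f (cond m (Si i)).
Proof. by rewrite /pairing sum_partition; apply: eq_bigr => i _; rewrite mass_pairing_cond. Qed.

Lemma mass_partition : \sum_i mass m (Si i) = \sum_x m x.
Proof. by rewrite [RHS]sum_partition. Qed.

(** Jensen's inequality over the blocks: the variance of the block norms under the masses is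
    nonnegative. *)
Lemma mass_Lp_norm2_le f : \sum_x m x = 1 ->
  \sum_i mass m (Si i) * Lp_norm (cond m (Si i)) 2 f <= Lp_norm m 2 f.
Proof.
move=> m1; pose M i := mass m (Si i); pose n i := Lp_norm (cond m (Si i)) 2 f.
have M0 i : 0 <= M i by rewrite ltW// mass_pos.
have n0 i : 0 <= n i by exact: Lp_norm_ge0.
have M1 : \sum_i M i = 1 by rewrite mass_partition.
have m0 x : 0 <= m x by exact: ltW.
rewrite -(@ler_pXn2r _ 2)// ?nnegrE ?Lp_norm_ge0//; last first.
  by apply: sumr_ge0 => i _; exact: mulr_ge0 (M0 i) (n0 i).
rewrite -pairing_sqr// pairing_partition.
under [leRHS]eq_bigr do rewrite (pairing_sqr _ (cond_nonneg m_gt0 (Si_nonempty _))).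
pose a := \sum_i M i * n i.
change (a ^+ 2 <= \sum_i M i * n i ^+ 2).
have aE : \sum_i M i * n i = a by [].
clearbody a.
have : 0 <= \sum_i M i * (n i - a) ^+ 2.
  by apply: sumr_ge0 => i _; rewrite (mulr_ge0 (M0 i))// sqr_ge0.
have -> : \sum_i M i * (n i - a) ^+ 2 =
    \sum_i M i * n i ^+ 2 - 2 * a * (\sum_i M i * n i) + a ^+ 2 * \sum_i M i.
  by rewrite !mulr_sumr -sumrB -big_split/=; apply: eq_bigr => i _; ring.
rewrite M1 aE; lra.
Qed.

End Partition.

End BlockNorms.

(** For the cubic Taylor polynomial [P] of [exp (- x)], the product [exp x * P x] equals 1 at 0 and
    has derivative [- exp x * x^3 / 6]. Rational upper bounds for exponentials thereby become
    polynomial checks. *)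
Lemma expR_le_inv {R : realType} (x d : R) : 0 <= x -> 0 < d ->
  d <= 1 - x + x ^+ 2 / 2 - x ^+ 3 / 6 -> expR x <= d^-1.
Proof.
move=> x0 d0 dx; pose P (y : R) := 1 - y + y ^+ 2 / 2 - y ^+ 3 / 6.
suff : expR x * P x <= 1.
  move=> h; rewrite -[d^-1]mul1r ler_pdivlMr//; apply: le_trans h.
  by rewrite ler_wpM2l// expR_ge0.
have dP (y : R) : is_derive y 1 (fun y => expR y * P y) (expR y * (- (y ^+ 3 / 6))).
  have i1 := is_derive_id y (1 : R).
  have i2 := is_derive_mul i1 i1; have i3 := is_derive_mul i2 i1.
  have D := is_derive_mul (is_derive_expR y) (is_derive_sub (is_derive_add
    (is_derive_sub (is_derive_cst (1 : R) y (1 : R)) i1) (is_derive_mulr 2^-1 i2))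
    (is_derive_mulr 6^-1 i3)).
  have -> : (fun y => expR y * P y) = (fun y => expR y * (1 - y + y * y / 2 - y * y * y / 6)).
    by apply/funext => z; rewrite /P; congr (_ * _); field.
  by apply: (is_derive_eq D); rewrite /=; field.
have := @le_increment_closed R (fun y => expR y * P y) (fun=> 0) _ (fun=> 0) 0 x x0
  (fun y _ => dP y) (fun y _ => is_derive_cst (0 : R) y (1 : R)).
rewrite subrr /P expR0 mul1r => h; have : forall y : R, 0 < y < x -> expR y * - (y ^+ 3 / 6) <= 0.
  move=> y /andP[y0 _]; rewrite mulr_ge0_le0 ?expR_ge0// oppr_le0.
  by rewrite divr_ge0// exprn_ge0// ltW.
move=> /h; rewrite !expr0n/= !mul0r !subr0 addr0; lra.
Qed.

(** The last numerical step, with [k] and [kt] the integrals of the global and the block norms of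
    [H] and [n] the number of particles. The slack between 20/3 and 8 settles the terms with [k],
    and that between 3/2 and 2 the others. *)
Lemma variance_arith {R : realType} (k kt M' n : R) : 0 <= k -> 0 <= kt -> 1 <= M' -> 40 <= n -> 40 * kt <= n ->
  (kt <= 12^-1 -> M' <= 4) ->
  3 / 2 + 20 / 3 * k * M' ^+ 2 + (9 / 4 + 17 / 2 * kt) * (7 / 5 / n) *
    (3 / 2 * M' + 20 / 3 * k * M' ^+ 2) <=
  (2 + 8 * k * M' ^+ 2) * (1 + 16 * kt * M' ^+ 2 / n).
Proof.
move=> k0 kt0 M1 n40 ktn small.
have n0 : 0 < n by lra.
pose ni := n^-1.
have ni0 : 0 < ni by rewrite invr_gt0.
have nE : n * ni = 1 by rewrite divff// gt_eqF.
have ni40 : 40 * ni <= 1 by have := ler_wpM2r (ltW ni0) n40; rewrite nE.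
have M2 : M' <= M' ^+ 2 by rewrite expr2 ler_peMl// (le_trans ler01).
set X := M' ^+ 2 in M2 *; have X1 : 1 <= X by exact: le_trans M2.
rewrite -/ni.
have kX : 0 <= k * X by rewrite mulr_ge0// (le_trans ler01).
have ktX : 0 <= kt * ni * (X - 1) by rewrite !mulr_ge0 ?(ltW ni0)//; lra.
have ktni : 0 <= kt * ni by rewrite mulr_ge0 ?(ltW ni0).
have ktM : 0 <= kt * ni * (X - M') by rewrite !mulr_ge0 ?(ltW ni0)//; lra.
have A1 : 20 / 3 + 20 / 3 * ((9 / 4 + 17 / 2 * kt) * (7 / 5 * ni)) <= 8 * (1 + 16 * kt * X * ni).
  nra.
have A2 : 3 / 2 + 3 / 2 * ((9 / 4 + 17 / 2 * kt) * (7 / 5 * ni)) * M' <= 2 * (1 + 16 * kt * X * ni).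
  (* For small [kt] the correction [16 kt M'^2 / n] cannot absorb the term linear in [M']; then
     [M' <= 4] makes that term small against the slack 1/2. *)
  have [kts|ktl] := leP kt 12^-1.
    have M4 := small kts.
    have : ni * M' <= 10^-1.
      have : ni * M' <= ni * 4 by rewrite ler_pM2l.
      lra.
    nra.
  have : 12^-1 * ni * X <= kt * ni * X.
    by rewrite ler_pM2r ?(lt_le_trans ltr01)// ler_pM2r// ltW.
  (* This square trades the term linear in [M'] for the quadratic one, at a constant that
     [ni <= 1 / 40] makes negligible. *)
  have : 0 <= ni * (M' - 21 / 10) ^+ 2 by rewrite mulr_ge0 ?sqr_ge0// ltW.
  rewrite (_ : (M' - 21 / 10) ^+ 2 = X - 21 / 5 * M' + 441 / 100); last by rewrite /X; field.
  have niM : 0 <= ni * M' by rewrite mulr_ge0 ?(ltW ni0)// (le_trans ler01).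
  lra.
have := ler_wpM2l kX A1.
rewrite (_ : (2 + 8 * k * X) * (1 + 16 * kt * X * ni) =
  2 * (1 + 16 * kt * X * ni) + k * X * (8 * (1 + 16 * kt * X * ni))); last by ring.
move: A2; set P := (9 / 4 + _) * _; set Z := 1 + _; lra.
Qed.

(** * Covariances of the weighted empirical measure *)

Section Covariance.
Context {R : realType} {S I : finType}.
Variables (N : nat) (lam : R -> R) (L : R -> S -> S -> R) (H mu : R -> S -> R).
Variables (b : R -> S -> S -> R) (T omega : R) (Si : I -> {set S}).
Implicit Types (s t : R) (x y z : S) (f u v : S -> R) (g h w : R -> S -> R) (i j : I).
Hypothesis N_gt0 : (0 < N)%N.
Hypothesis lam_cont : continuous lam.
Hypothesis L_cont : forall y y', continuous (fun s => L s y y').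
Hypothesis H_cont : forall y, continuous (H ^~ y).
Hypothesis L_row : forall s y, \sum_y' L s y y' = 0.
Hypothesis Q_ge0 : forall s x y, 0 <= s <= T -> x != y -> 0 <= lam s * L s x y.
Hypothesis L_block : forall s i x y, 0 <= s <= T ->
  (x \in Si i) != (y \in Si i) -> L s x y = 0.
Hypothesis Si_disjoint : forall i j x, x \in Si i -> x \in Si j -> i = j.
Hypothesis Si_cover : forall x, exists i, x \in Si i.
Hypothesis mu_ge0 : forall s y, 0 <= s <= T -> 0 <= mu s y.
Hypothesis mu_sum : forall s, 0 <= s <= T -> \sum_y mu s y = 1.
Hypothesis mu_derive : forall s y, 0 <= s <= T ->
  is_derive s 1 (mu ^~ y) (- (H s y * mu s y)).
Hypothesis mu_inv : forall s y, 0 <= s <= T -> \sum_y' mu s y' * L s y' y = 0.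
Hypothesis H_bound : forall s y, 0 <= s <= T -> `|H s y| <= omega.
Hypothesis H_osc : forall s x y, 0 <= s <= T -> H s x - H s y <= omega.
Hypothesis b_ge0 : forall s y y', 0 <= s <= T -> 0 <= b s y y'.
Hypothesis bC : forall s y y', b s y y' = b s y' y.
Hypothesis b_psd : forall s f, 0 <= s <= T ->
  pairing f (mu s) ^+ 2 <= \sum_y \sum_y' b s y y' * (f y * f y').
Hypothesis b_derive : forall s (g h dg dh : R -> S -> R), 0 <= s <= T ->
  (forall y, is_derive s 1 (g ^~ y) (dg s y)) ->
  (forall y, is_derive s 1 (h ^~ y) (dh s y)) ->
  is_derive s 1 (fun s => \sum_y \sum_y' b s y y' * (g s y * h s y'))
    (\sum_y \sum_y' b s y y' *
      ((dg s y + drift lam L H s (g s) y) * h s y' +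
       g s y * (dh s y' + drift lam L H s (h s) y') +
       N%:R^-1 * (carre_du_champ lam L s (g s) (h s) y +
                  selection_square H s (g s) (h s) y y'))).
Hypothesis b_0 : forall g h : S -> R, \sum_y \sum_y' b 0 y y' * (g y * h y') =
  (1 - N%:R^-1) * (pairing g (mu 0) * pairing h (mu 0)) +
  N%:R^-1 * pairing (fun y => g y * h y) (mu 0).

Definition bsum s (F : S -> S -> R) : R := \sum_y \sum_y' b s y y' * F y y'.
Definition bil s u v : R := bsum s (fun y y' => u y * v y').
Definition cov s u v : R := bil s u v - pairing u (mu s) * pairing v (mu s).
Definition block i u : S -> R := fun y => if y \in Si i then u y else 0.

Let bw := backward lam L H.

(** As the kernel is symmetric, only symmetrised integrands need to be compared; [dpsi_le] depends
    on this. *)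
Lemma bsum_le_sym s (F G : S -> S -> R) : 0 <= s <= T ->
  (forall y y', F y y' + F y' y <= G y y' + G y' y) -> bsum s F <= bsum s G.
Proof.
move=> sT FG.
have sym K : bsum s K + bsum s K = \sum_y \sum_y' b s y y' * (K y y' + K y' y).
  rewrite {2}/bsum exchange_big/= -big_split/=; apply: eq_bigr => y _.
  by rewrite -big_split/=; apply: eq_bigr => y' _; rewrite (bC _ y' y) mulrDr.
suff : bsum s F + bsum s F <= bsum s G + bsum s G by lra.
rewrite !sym; apply: ler_sum => y _; apply: ler_sum => y' _.
by rewrite ler_wpM2l ?b_ge0.
Qed.

Lemma bsum_le s (F G : S -> S -> R) : 0 <= s <= T ->
  (forall y y', F y y' <= G y y') -> bsum s F <= bsum s G.
Proof. by move=> sT FG; apply: bsum_le_sym => // y y'; exact: lerD. Qed.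

Lemma bsumD s F G : bsum s (fun y y' => F y y' + G y y') = bsum s F + bsum s G.
Proof.
rewrite /bsum -big_split/=; apply: eq_bigr => y _.
by rewrite -big_split/=; apply: eq_bigr => y' _; rewrite mulrDr.
Qed.

Lemma bsumZ s c F : bsum s (fun y y' => c * F y y') = c * bsum s F.
Proof.
rewrite /bsum mulr_sumr; apply: eq_bigr => y _.
by rewrite mulr_sumr; apply: eq_bigr => y' _; rewrite mulrCA.
Qed.

Lemma eq_bsum s F G : (forall y y', F y y' = G y y') -> bsum s F = bsum s G.
Proof. by move=> FG; apply: eq_bigr => y _; apply: eq_bigr => y' _; rewrite FG. Qed.

Lemma bilC s u v : bil s u v = bil s v u.
Proof.
rewrite /bil /bsum exchange_big/=; apply: eq_bigr => y _; apply: eq_bigr => y' _.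
by rewrite bC mulrC mulrA [_ * v y]mulrC; ring.
Qed.

Lemma bil_ge0 s u v : 0 <= s <= T -> (forall y, 0 <= u y) -> (forall y, 0 <= v y) ->
  0 <= bil s u v.
Proof.
move=> sT u0 v0; apply: sumr_ge0 => y _; apply: sumr_ge0 => y' _.
by rewrite mulr_ge0 ?b_ge0// mulr_ge0.
Qed.

Lemma cov_lin2 s (c d : R) u v : cov s (fun y => c * u y - d * v y) (fun y => c * u y - d * v y) =
  c ^+ 2 * cov s u u - 2 * c * d * cov s u v + d ^+ 2 * cov s v v.
Proof.
have -> : cov s (fun y => c * u y - d * v y) (fun y => c * u y - d * v y) =
   bil s (fun y => c * u y - d * v y) (fun y => c * u y - d * v y) -
   (c * pairing u (mu s) - d * pairing v (mu s)) ^+ 2.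
  rewrite /cov expr2; congr (_ - _ * _); rewrite /pairing !mulr_sumr -sumrB;
  by apply: eq_bigr => y _; ring.
have -> : bil s (fun y => c * u y - d * v y) (fun y => c * u y - d * v y) =
  c ^+ 2 * bil s u u + (- c * d * bil s u v + (- c * d * bil s v u + d ^+ 2 * bil s v v)).
  by rewrite /bil -!bsumZ -!bsumD; apply: eq_bsum => y y'; ring.
by rewrite (bilC s v u) /cov; ring.
Qed.

Lemma cov_ge0 s u : 0 <= s <= T -> 0 <= cov s u u.
Proof. by move=> sT; rewrite subr_ge0 -expr2; exact: b_psd. Qed.

(** Cauchy-Schwarz for the nonnegative form [cov], in terms of upper bounds for the variances:
    expand the variance of [d u - c v] and divide by [c d]. *)
Lemma cov_cauchy s u v (E c d : R) : 0 <= s <= T -> 0 <= E -> 0 <= c -> 0 <= d ->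
  cov s u u <= E * c ^+ 2 -> cov s v v <= E * d ^+ 2 -> cov s u v <= E * (c * d).
Proof.
move=> sT E0 c0 d0 uu vv.
(* Degenerate case: if the covariance were positive, this [k] would give [k u' - v'] a variance of
   at most -1. *)
have deg u' v' : cov s u' u' <= 0 -> cov s u' v' <= 0.
  move=> u'0; rewrite leNgt; apply/negP => uv0.
  pose k := (cov s v' v' + 1) / (2 * cov s u' v').
  have := cov_ge0 (fun y => k * u' y - 1 * v' y) sT; rewrite cov_lin2.
  have := mulr_ge0_le0 (sqr_ge0 k) u'0.
  have -> : 2 * k * 1 * cov s u' v' = cov s v' v' + 1 by rewrite /k; field; rewrite gt_eqF.
  lra.
have [c00|cn0] := eqVneq c 0.
  by rewrite c00 mul0r mulr0; apply: deg; move: uu; rewrite c00 expr0n/= mulr0.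
have [d00|dn0] := eqVneq d 0.
  have CC : cov s u v = cov s v u by rewrite /cov bilC [_ * pairing v _]mulrC.
  by rewrite d00 !mulr0 CC; apply: deg; move: vv; rewrite d00 expr0n/= mulr0.
have cp : 0 < c by rewrite lt0r cn0. have dp : 0 < d by rewrite lt0r dn0.
have := cov_ge0 (fun y => d * u y - c * v y) sT; rewrite cov_lin2.
have := ler_wpM2l (sqr_ge0 d) uu; have := ler_wpM2l (sqr_ge0 c) vv.
move=> h1 h2 h3.
have : (c * d) * cov s u v <= (c * d) * (E * (c * d)) by nra.
by rewrite ler_pM2l ?mulr_gt0.
Qed.

(* The term [bil s 1 (g h)] cancels the carre du champ, so that [dpsi] involves
   neither [lam] nor [L]. *)
Definition psi g h s : R :=
  N%:R * bil s (g s) (h s) - bil s (fun=> 1) (fun y => g s y * h s y).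

Definition dpsi g h s : R := bsum s (fun y y' =>
  Num.max (H s y - H s y') 0 * ((g s y' - g s y) * (h s y' - h s y)) +
  (H s y - H s y') * (g s y' * h s y')).

Lemma is_derive_psi t g h s : t <= T -> bw t g -> bw t h -> 0 <= s <= t ->
  is_derive s 1 (psi g h) (dpsi g h s).
Proof.
rewrite /dpsi; move=> tT bg bh st; have sT : 0 <= s <= T by case/andP: st => -> /= /le_trans; apply.
pose dr w s y := - drift lam L H s (w s) y.
have D1 := @b_derive s g h (dr g) (dr h) sT (fun y => bg s y st) (fun y => bh s y st).
have D2 := @b_derive s (fun=> fun=> 1) (fun s y => g s y * h s y) (fun=> fun=> 0)
  (fun s y => dr g s y * h s y + g s y * dr h s y) sT (fun y => is_derive_cst (1 : R) s (1 : R))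
  (fun y => is_derive_mul (bg s y st) (bh s y st)).
apply: (is_derive_eq (is_derive_sub (is_derive_mull N%:R D1) D2)).
pose C := carre_du_champ lam L s (g s) (h s).
pose B1 := bsum s (fun y y' => C y).
have CC : bsum s (fun y y' => C y') = B1.
  rewrite /B1 /bsum exchange_big; apply: eq_bigr => y _; apply: eq_bigr => y' _.
  by rewrite bC.
pose X := bsum s (fun y y' =>
  Num.max (H s y - H s y') 0 * ((g s y' - g s y) * (h s y' - h s y))).
pose Y := bsum s (fun y y' => (H s y - H s y') * (g s y' * h s y')).
have N0 : N%:R != 0 :> R by rewrite pnatr_eq0 -lt0n.
(* The carre du champ [B1] occurs with factor [N / N] in the first term of [psi] and through the
   product rule in the second, so it cancels. *)
transitivity ((B1 + X) - (B1 - Y)); last by rewrite /X /Y bsumD; ring.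
congr (_ - _).
  rewrite /B1 /X -bsumD /bsum mulr_sumr; apply: eq_bigr => y _.
  rewrite mulr_sumr; apply: eq_bigr => y' _.
  by rewrite !addNr mul0r mulr0 !add0r mulrCA mulVKf// .
rewrite -CC; apply/eqP; rewrite eq_sym subr_eq -bsumD; apply/eqP; apply: eq_bsum => y y'.
rewrite add0r.
have -> : carre_du_champ lam L s (fun=> 1) (fun y => g s y * h s y) y = 0.
  by rewrite /carre_du_champ big1// => z _; rewrite subrr mul0r mulr0.
have -> : drift lam L H s (fun=> 1) y = - H s y.
  by rewrite /drift; under eq_bigr do rewrite mulr1; rewrite -mulr_sumr L_row; ring.
have -> : selection_square H s (fun=> 1) (fun y => g s y * h s y) y y' = 0.
  by rewrite /selection_square subrr mul0r mulr0.
suff E : drift lam L H s (fun y => g s y * h s y) y' =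
    C y' + drift lam L H s (g s) y' * h s y' + g s y' * drift lam L H s (h s) y'
    + H s y' * (g s y' * h s y') by rewrite E /dr; ring.
rewrite /drift /C /carre_du_champ.
have -> : \sum_z lam s * L s y' z * ((g s z - g s y') * (h s z - h s y')) =
    \sum_z lam s * L s y' z * (g s z * h s z) -
    g s y' * (\sum_z lam s * L s y' z * h s z) -
    h s y' * (\sum_z lam s * L s y' z * g s z) +
    g s y' * h s y' * (lam s * \sum_z L s y' z).
  by rewrite !mulr_sumr -!sumrB -big_split/=; apply: eq_bigr => z _; ring.
by rewrite L_row; ring.
Qed.

Lemma is_derive_bil1 t w s : t <= T -> bw t w -> 0 <= s <= t ->
  is_derive s 1 (fun s => bil s (fun=> 1) (w s)) (- bil s (H s) (w s)).
Proof.
move=> tT bww st; have sT : 0 <= s <= T by case/andP: st => -> /= /le_trans; apply.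
have D2 := @b_derive s (fun=> fun=> 1) w (fun=> fun=> 0)
  (fun s y => - drift lam L H s (w s) y) sT
  (fun y => is_derive_cst (1 : R) s (1 : R)) (fun y => bww s y st).
apply: (is_derive_eq D2); rewrite -mulN1r -bsumZ; apply: eq_bsum => y y'.
rewrite addNr mulr0 addr0 add0r.
have -> : carre_du_champ lam L s (fun=> 1) (w s) y = 0.
  by rewrite /carre_du_champ big1// => z _; rewrite subrr mul0r mulr0.
have -> : drift lam L H s (fun=> 1) y = - H s y.
  by rewrite /drift; under eq_bigr do rewrite mulr1; rewrite -mulr_sumr L_row; ring.
have -> : selection_square H s (fun=> 1) (w s) y y' = 0.
  by rewrite /selection_square subrr mul0r mulr0.
by ring.
Qed.

(** The initial particles are independent, and the diagonal contribution [pairing (g h)] is the same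
    in both terms of [psi]. *)
Lemma psi_initial t g h : 0 <= t <= T -> bw t g -> bw t h ->
  psi g h 0 = (N%:R - 1) * (pairing (g t) (mu t) * pairing (h t) (mu t)).
Proof.
move=> /andP[t0 tT] bg bh.
have T0 : 0 <= (0 : R) <= T by rewrite lexx (le_trans t0).
have N0 : N%:R != 0 :> R by rewrite pnatr_eq0 -lt0n.
rewrite -(pairing_backward_const mu_derive mu_inv (lexx 0) t0 tT bg).
rewrite -(pairing_backward_const mu_derive mu_inv (lexx 0) t0 tT bh).
rewrite /psi /bil /bsum !b_0.
have -> : pairing (fun=> 1) (mu 0) = 1.
  by rewrite /pairing; under eq_bigr do rewrite mul1r; exact: mu_sum.
have -> : pairing (fun y => 1 * (g 0 y * h 0 y)) (mu 0) = pairing (fun y => g 0 y * h 0 y) (mu 0).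
  by apply: eq_bigr => y _; rewrite mul1r.
set a1 := pairing (g 0) _; set a2 := pairing (h 0) _; set a3 := pairing _ _.
set n := N%:R in N0 *; clearbody n a1 a2 a3; by field.
Qed.

Let ordT s t : 0 <= s <= t -> t <= T -> 0 <= s <= T.
Proof. by case/andP=> -> /= /le_trans; apply. Qed.

(* For backward solutions supported in different blocks [dpsi] is nonpositive,
   because selection is the only interaction between them. *)
Lemma cov_separated t u v (A : {set S}) : 0 <= t <= T ->
  (forall s x y, 0 <= s <= T -> (x \in A) != (y \in A) -> L s x y = 0) ->
  (forall y, 0 <= u y) -> (forall y, 0 <= v y) ->
  (forall y, y \notin A -> u y = 0) -> (forall y, y \in A -> v y = 0) ->
  cov t u v <= 0.
Proof.
move=> /andP[t0 tT] LA u0 v0 uA vA.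
have LAt s x y : 0 <= s <= t -> (x \in A) != (y \in A) -> L s x y = 0.
  by move=> st; apply: LA; exact: ordT st tT.
have LAt' s x y : 0 <= s <= t -> (x \in ~: A) != (y \in ~: A) -> L s x y = 0.
  by move=> st; rewrite !inE => h; apply: (LAt s x y st); move: h; case: (x \in A); case: (y \in A).
have [g [gt bg]] := backward_exists lam_cont L_cont H_cont u t0.
have [h [ht bh]] := backward_exists lam_cont L_cont H_cont v t0.
have g0 := backward_ge0 lam_cont L_cont H_cont Q_ge0 tT bg.
have h0 := backward_ge0 lam_cont L_cont H_cont Q_ge0 tT bh.
have {}g0 s y : 0 <= s <= t -> 0 <= g s y by apply: g0 => z; rewrite gt.
have {}h0 s y : 0 <= s <= t -> 0 <= h s y by apply: h0 => z; rewrite ht.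
have bg' : bw t _ := backward_restrict bg LAt.
have bh' : bw t _ := backward_restrict bh LAt'.
set g' := (fun s y => _) in bg'; set h' := (fun s y => _) in bh'.
have gu y : g' t y = u y by rewrite /g' gt; case: ifP => // /negbT /uA.
have hv y : h' t y = v y.
  by rewrite /h' ht inE; case: ifP => // /negbFE /vA.
have gh s y : g' s y * h' s y = 0.
  by rewrite /g' /h' inE; case: (y \in A); rewrite ?mulr0 ?mul0r.
have g'0 s y : 0 <= s <= t -> 0 <= g' s y.
  by move=> st; rewrite /g'; case: ifP => // _; exact: g0.
have h'0 s y : 0 <= s <= t -> 0 <= h' s y.
  by move=> st; rewrite /h'; case: ifP => // _; exact: h0.
have : psi g' h' t - psi g' h' 0 <= (0 : R) - 0.
  apply: (@le_increment_closed R (psi g' h') (fun=> 0) (dpsi g' h') (fun=> 0) 0 t t0).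
  - by move=> s st; exact: is_derive_psi tT bg' bh' st.
  - move=> s /andP[s0 st]; have st' : 0 <= s <= t by rewrite !ltW.
    rewrite /= (_ : 0 = bsum s (fun _ _ => 0)); last first.
      by rewrite /bsum big1// => y _; rewrite big1// => y' _; rewrite mulr0.
    apply: bsum_le; first exact: ordT st' tT.
    move=> y y'; rewrite gh mulr0 addr0 mulr_ge0_le0 ?le_max ?lexx ?orbT//.
    (* Since [g' * h'] vanishes pointwise, only the mixed products survive, with a minus sign. *)
    rewrite (_ : _ * _ = g' s y' * h' s y' + g' s y * h' s y - (g' s y' * h' s y + g' s y * h' s y')); last by ring.
    rewrite !gh addr0 sub0r oppr_le0 addr_ge0// mulr_ge0// ?g'0 ?h'0//.
have tT' : 0 <= t <= T by rewrite t0.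
rewrite (psi_initial tT' bg' bh') subrr.
have -> : psi g' h' t = N%:R * bil t u v.
  rewrite /psi /bil; have -> : bsum t (fun y y' => 1 * (g' t y' * h' t y')) = 0.
    by rewrite /bsum big1// => y _; rewrite big1// => y' _; rewrite gh !mulr0.
  by rewrite subr0; congr (_ * _); apply: eq_bsum => y y'; rewrite gu hv.
have -> : pairing (g' t) (mu t) = pairing u (mu t) by apply: eq_bigr => y _; rewrite gu.
have -> : pairing (h' t) (mu t) = pairing v (mu t) by apply: eq_bigr => y _; rewrite hv.
rewrite /cov => h1.
have uv0 : 0 <= pairing u (mu t) * pairing v (mu t).
  by rewrite mulr_ge0//; apply: sumr_ge0 => y _; rewrite mulr_ge0// mu_ge0.
have N0 : 0 < N%:R :> R by rewrite ltr0n.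
have : N%:R * (bil t u v - pairing u (mu t) * pairing v (mu t)) <= 0 by move: h1 uv0; lra.
by rewrite pmulr_rle0.
Qed.

Lemma block_sum (u : S -> R) y : u y = \sum_i block i u y.
Proof.
have [i yi] := Si_cover y; rewrite (bigD1 i)//= /block yi big1 ?addr0// => j ji.
by case: ifP => // yj; rewrite (Si_disjoint yi yj) eqxx in ji.
Qed.

(** Expand both functions over the blocks. Pairs of different blocks are bounded by products of
    means through [cov_separated]; the diagonal pairs keep their covariance. *)
Lemma bil_le_blocks t u v : 0 <= t <= T -> (forall y, 0 <= u y) -> (forall y, 0 <= v y) ->
  bil t u v <= pairing u (mu t) * pairing v (mu t) + \sum_i cov t (block i u) (block i v).
Proof.
move=> tT u0 v0.
have blk i f y : (forall y, 0 <= f y) -> 0 <= block i f y.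
  by move=> f0; rewrite /block; case: ifP.
have E1 : bil t u v = \sum_i \sum_j bil t (block i u) (block j v).
  rewrite /bil (@eq_bsum t _ (fun y y' => \sum_i \sum_j block i u y * block j v y')).
    rewrite /bsum (eq_bigr (fun y => \sum_i \sum_j \sum_y' b t y y' * (block i u y * block j v y'))).
      rewrite exchange_big/=; apply: eq_bigr => i _; exact: exchange_big.
    move=> y _; rewrite (eq_bigr (fun y' => \sum_i \sum_j b t y y' * (block i u y * block j v y'))).
      rewrite exchange_big/=; apply: eq_bigr => i _; exact: exchange_big.
    by move=> y' _; rewrite mulr_sumr; apply: eq_bigr => i _; rewrite mulr_sumr.
  move=> y y'; rewrite (block_sum u) (block_sum v) mulr_suml; apply: eq_bigr => i _.
  by rewrite mulr_sumr.
have PE f : pairing f (mu t) = \sum_i pairing (block i f) (mu t).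
  rewrite /pairing exchange_big/=; apply: eq_bigr => y _.
  by rewrite -mulr_suml -block_sum.
rewrite E1 (PE u) (PE v) mulr_suml -big_split/=; apply: ler_sum => i _.
rewrite (bigD1 i)//= mulr_sumr [X in _ <= X + _](bigD1 i)//= /cov.
suff : \sum_(j | j != i) bil t (block i u) (block j v) <=
   \sum_(j | j != i) pairing (block i u) (mu t) * pairing (block j v) (mu t) by lra.
apply: ler_sum => j ji; rewrite -subr_le0.
apply: (cov_separated (A := Si i)) => //.
- by move=> s x y sT; exact: L_block.
- by move=> y; exact: blk.
- by move=> y; exact: blk.
- by move=> y /negbTE yi; rewrite /block yi.
- move=> y yi; rewrite /block; case: ifP => // yj.
  by rewrite (Si_disjoint yi yj) eqxx in ji.
Qed.

Let e217 : expR (2 / 17) <= 9 / 8 :> R.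
Proof.
have h : (9 / 8)^-1 <= 1 - 2 / 17 + (2 / 17) ^+ 2 / 2 - (2 / 17) ^+ 3 / 6 :> R by lra.
by have := expR_le_inv (_ : 0 <= 2 / 17) _ h; rewrite invrK; apply; lra.
Qed.

(** After symmetrisation this is the pointwise bound [(v - u)^2 + v^2 - u^2 <= 5/2 (u^2 + v^2)],
    whose defect is [1/2 (v + 2 u)^2 + 1/2 u^2]. *)
Lemma dpsi_le s g : 0 <= s <= T ->
  dpsi g g s <= 5 / 2 * bsum s (fun y y' => `|H s y - H s y'| * g s y' ^+ 2).
Proof.
move=> sT; rewrite -bsumZ; apply: bsum_le_sym => // y y'.
rewrite -[`|H s y' - H s y|]normrN opprB.
have -> : H s y' - H s y = - (H s y - H s y') by ring.
move: (H s y - H s y') (g s y) (g s y') => h u v.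
have P (k z1 z2 : R) : 0 <= k ->
    k * ((z2 - z1) * (z2 - z1)) + k * (z2 * z2) - k * (z1 * z1) <=
    5 / 2 * (k * z2 ^+ 2) + 5 / 2 * (k * z1 ^+ 2).
  move=> k0; rewrite -subr_ge0 (_ : _ - _ = k * (2^-1 * (z2 + 2 * z1) ^+ 2 + 2^-1 * z1 ^+ 2)); last by field.
  by rewrite mulr_ge0// addr_ge0// mulr_ge0// sqr_ge0.
have [h0|h0] := leP 0 h.
  rewrite (ger0_norm h0) (max_idPr _) ?oppr_le0//.
  by have := P h u v h0; lra.
have h0' := ltW h0; rewrite (ler0_norm h0') (max_idPl _) ?oppr_ge0//.
have := P (- h) v u; rewrite oppr_ge0 => /(_ h0'); lra.
Qed.

(** Gronwall's argument: by [is_derive_bil1] this quantity changes at rate [- H], and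
    [|H| <= omega]. *)
Lemma bil1_growth t tau s w : 0 <= tau -> tau <= s -> s <= t -> t <= T -> bw t w ->
  (forall s y, 0 <= s <= t -> 0 <= w s y) ->
  expR (omega * (tau - s)) * bil s (fun=> 1) (w s) <= bil tau (fun=> 1) (w tau).
Proof.
move=> tau0 taus st tT bww w0.
pose z r := expR (omega * (tau - r)) * bil r (fun=> 1) (w r).
pose dz r := - omega * expR (omega * (tau - r)) * bil r (fun=> 1) (w r) +
  expR (omega * (tau - r)) * - bil r (H r) (w r).
have : z s - z tau <= (0 : R) - 0.
  apply: (@le_increment_closed R z (fun=> 0) dz (fun=> 0) tau s taus).
  - move=> r /andP[taur rs]; apply: is_derive_mul; first exact: is_derive_expR_lin.
    by apply: (is_derive_bil1 tT bww); rewrite (le_trans tau0 taur) (le_trans rs).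
  - move=> r /andP[taur rs]; have rt : 0 <= r <= t.
      by rewrite (le_trans tau0 (ltW taur)) (le_trans (ltW rs)).
    have rT := ordT rt tT.
    have -> : dz r = - (expR (omega * (tau - r)) *
        (omega * bil r (fun=> 1) (w r) + bil r (H r) (w r))) by rewrite /dz; ring.
    rewrite oppr_le0 mulr_ge0 ?expR_ge0//.
    suff : bil r (H r) (w r) >= - omega * bil r (fun=> 1) (w r) by lra.
    rewrite -bsumZ; apply: bsum_le => // y y'; rewrite mul1r ler_wpM2r ?w0//.
    by have := H_bound y rT; rewrite ler_norml => /andP[].
rewrite /z subrr mulr0 expR0 mul1r subr0 subr_le0; exact.
Qed.

(* Close to the final time hypercontractivity is not available; on a window of
   length at most [2 / (17 omega)] the squared solution [g ^+ 2] is instead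
   compared with the solution [w] started from the square. *)
Lemma window_bound t tau g w : 0 <= tau -> tau <= t -> t <= T -> omega * (t - tau) <= 2 / 17 ->
  0 <= omega -> bw t g -> bw t w -> (forall y, w t y = g t y ^+ 2) ->
  N%:R * cov t (g t) (g t) <=
  psi g g tau - psi g g 0 + 3 / 2 * bil tau (fun=> 1) (w tau).
Proof.
move=> tau0 taut tT ot om0 bg bww wg.
have t0 := le_trans tau0 taut; have tT' : 0 <= t <= T by rewrite t0.
have w0 : forall s y, 0 <= s <= t -> 0 <= w s y.
  by apply: (backward_ge0 lam_cont L_cont H_cont Q_ge0 tT bww) => y; rewrite wg sqr_ge0.
pose beta := bil tau (fun=> 1) (w tau).
have e1 (s : R) : tau <= s <= t -> expR (omega * (t - s)) <= 9 / 8.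
  move=> /andP[s1 s2]; apply: le_trans e217; rewrite ler_expR; apply: le_trans ot.
  by rewrite ler_wpM2l// lerD2l lerN2.
have y_le s : tau <= s <= t -> bil s (fun=> 1) (w s) <= 9 / 8 * beta.
  move=> /andP[s1 s2]; have := bil1_growth tau0 s1 s2 tT bww w0; rewrite -/beta.
  have b0 : 0 <= bil s (fun=> 1) (w s).
    have st : 0 <= s <= t by rewrite (le_trans tau0).
    by apply: bil_ge0 => //; [exact: ordT st tT|move=> y; exact: w0].
  have : expR (omega * (s - tau)) <= 9 / 8.
    apply: le_trans e217; rewrite ler_expR; apply: le_trans ot.
    by rewrite ler_wpM2l// lerD2r.
  have E : expR (omega * (tau - s)) * expR (omega * (s - tau)) = 1.
    by rewrite -expRD -mulrDr subrKA subrr mulr0 expR0.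
  have := expR_ge0 (omega * (tau - s)); move: E.
  set e := expR _; set e' := expR _; set B := bil _ _ _ in b0 *; move=> E e0 e'le.
  have : 1 <= e * (9 / 8) by rewrite -[leLHS]E ler_wpM2l.
  move=> h1 h2; have := ler_wpM2r b0 h1; lra.
(* [81 / 64] is the square of 9/8: one factor compares [g^2] with [w], the other brings
   [bil s 1 (w s)] back to time [tau]. *)
have psi_inc : psi g g t - psi g g tau <= (5 / 2 * omega * (81 / 64) * beta) * t -
    (5 / 2 * omega * (81 / 64) * beta) * tau.
  apply: (@le_increment_closed R (psi g g) (fun s => (5 / 2 * omega * (81 / 64) * beta) * s)
    (dpsi g g) (fun s => (5 / 2 * omega * (81 / 64) * beta) * 1) tau t taut).
  - move=> s /andP[s1 s2]; apply: (is_derive_psi tT bg bg).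
    by rewrite (le_trans tau0 s1).
  move=> s /andP[s1 s2]; have s12 : tau <= s <= t by rewrite !ltW.
  have st : 0 <= s <= t by rewrite (le_trans tau0) ltW.
  have sT := ordT st tT; apply: (le_trans (dpsi_le g sT)).
  rewrite (_ : _ * 1 = 5 / 2 * (omega * (81 / 64 * beta))); last by ring.
  rewrite ler_pM2l; last by lra.
  apply: (@le_trans _ _ (omega * (9 / 8 * bil s (fun=> 1) (w s)))).
    rewrite -!bsumZ; apply: bsum_le => // y y'.
    apply: (ler_pM (normr_ge0 _) (sqr_ge0 _)).
      by rewrite ler_norml lerNl opprB !H_osc.
    rewrite mul1r; apply: (le_trans (backward_sqr lam_cont L_cont H_cont Q_ge0 L_row H_bound tT bg bww wg y' st)).
    by rewrite ler_wpM2r ?w0// e1.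
  rewrite ler_wpM2l//; have := y_le s s12; lra.
have beta0 : 0 <= beta.
  have taut' : 0 <= tau <= t by rewrite tau0.
  by apply: bil_ge0 => //; [exact: ordT taut' tT|move=> y; exact: w0].
have tt : tau <= t <= t by rewrite taut lexx.
have yt := y_le t tt.
have E0 := psi_initial tT' bg bg.
have Et : psi g g t = N%:R * bil t (g t) (g t) - bil t (fun=> 1) (w t).
  by rewrite /psi; congr (_ - _); apply: eq_bsum => y y'; rewrite wg expr2.
have m2 := sqr_ge0 (pairing (g t) (mu t)).
have obeta := ler_wpM2r beta0 ot.
have -> : N%:R * cov t (g t) (g t) = psi g g t + bil t (fun=> 1) (w t) - psi g g 0 -
    pairing (g t) (mu t) ^+ 2.
  by rewrite Et E0 /cov; ring.
(* The constant 3/2 exceeds [5/2 * 2/17 * 81/64 + 9/8]. *)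
rewrite -/beta; lra.
Qed.

Variables (p q r a : R).
Hypothesis omega_ge0 : 0 <= omega.
Hypothesis p_gt4 : 4 < p.
Hypothesis p_lt_q : p < q.
Hypothesis r_def : p^-1 = q^-1 + r^-1.
Hypothesis a_ge1 : ln ((2 * r - 1) / (p - 1)) <= a.
Hypothesis a_ge2 : ln ((p - 1) / (p / 2 - 1)) <= a.
Hypothesis Si_nonempty : forall i, exists x, x \in Si i.
Hypothesis mu_gt0 : forall s x, 0 < mu s x.
Hypothesis mu_cont : forall x, continuous (mu ^~ x).
Hypothesis L_balance : forall s x y, 0 <= s <= T -> mu s x * L s x y = mu s y * L s y x.

Let Q s x y := lam s * L s x y.

Hypothesis poincare_H : forall i s (phi : S -> R), 0 < T -> 0 <= s <= T ->
  - (\sum_(x in Si i) (H s x - block_mean_H (Si i) H mu s) * phi x ^+ 2 * mu s x) <=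
  4 / p * dirichlet_sum (Si i) Q mu s phi +
  (\sum_(x in Si i) phi x ^+ 2 * mu s x) / ((p + 3) * T).
Hypothesis log_sobolev : forall i s (phi : S -> R), 0 <= s <= T ->
  (forall x, x \in Si i -> 0 < phi x) ->
  17 / 8 * a * omega *
    (\sum_(x in Si i) phi x ^+ 2 * ln (phi x ^+ 2) * mu s x -
     (\sum_(x in Si i) phi x ^+ 2 * mu s x) *
     (ln (\sum_(x in Si i) phi x ^+ 2 * mu s x) - ln (mass (mu s) (Si i)))) <=
  dirichlet_sum (Si i) Q mu s phi.

Let m i s := mass (mu s) (Si i).
Let c i s := cond (mu s) (Si i).
Let nrm i s p' (f : S -> R) := m i s * Lp_norm (c i s) p' f.

Let p_gt0 : 0 < p. Proof. by have := p_gt4; lra. Qed.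
Let q_gt0 : 0 < q. Proof. by have := p_lt_q; have := p_gt0; lra. Qed.

Let r_inv_gt0 : 0 < r^-1.
Proof.
have -> : r^-1 = p^-1 - q^-1 by rewrite r_def; ring.
by rewrite subr_gt0 ltf_pV2.
Qed.

Let p_lt_r : p < r.
Proof.
have r0 : 0 < r by rewrite -invr_gt0.
by rewrite -ltf_pV2 ?posrE// r_def ltrDr invr_gt0.
Qed.

Let m_gt0 i s : 0 < m i s. Proof. exact: mass_pos. Qed.
Let c_ge0 i s x : 0 <= c i s x. Proof. exact: cond_nonneg. Qed.
Let c_sum i s : \sum_x c i s x = 1. Proof. exact: cond_sum1. Qed.
Let mu_ge s x : 0 <= mu s x. Proof. exact: ltW. Qed.
Let nrm_ge0 i s p' f : 0 <= nrm i s p' f.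
Proof. exact: mulr_ge0 (ltW (m_gt0 i s)) (Lp_norm_ge0 _ _ _). Qed.

Lemma block_H_osc i s x : 0 <= s <= T -> x \in Si i ->
  - omega <= H s x - block_mean_H (Si i) H mu s.
Proof.
move=> sT xi; rewrite -(ler_pM2r (m_gt0 i s)) mulrBl /block_mean_H.
rewrite divfK ?gt_eqF ?m_gt0// /m /mass !mulr_sumr -sumrB; apply: ler_sum => y _.
rewrite -mulrBl ler_wpM2r//; have := H_osc y x sT; lra.
Qed.

Section BlockBounds.
Variables (i : I) (t : R) (g : R -> S -> R).
Hypothesis T_gt0 : 0 < T.
Hypothesis tT : 0 <= t <= T.
Hypothesis bg : bw t g.
Hypothesis g_ge0 : forall y, 0 <= g t y.

Let Q_row s x : 0 <= s <= T -> \sum_y Q s x y = 0.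
Proof. by move=> _; rewrite -mulr_sumr L_row mulr0. Qed.

Let Q_balance s x y : 0 <= s <= T -> mu s x * Q s x y = mu s y * Q s y x.
Proof. by move=> sT; rewrite mulrCA L_balance// mulrCA. Qed.

Let Q_blk s x y : 0 <= s <= T -> x \in Si i -> y \notin Si i -> Q s x y = 0.
Proof. by move=> sT xi /negbTE yi; rewrite /Q (@L_block s i)// ?mulr0// xi yi. Qed.

Let backward_one : exists u : R -> S -> R, [/\ forall s x, 0 <= s <= t -> x \in Si i -> 0 < u s x,
  forall x, x \in Si i -> u t x = 1 & bw t u].
Proof.
have t0 : 0 <= t by case/andP: tT.
have tT1 : t <= T by case/andP: tT.
have [u [ut bu]] := backward_exists lam_cont L_cont H_cont (fun=> 1) t0.
exists u; split=> // s x st _.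
exact: (backward_gt0 lam_cont L_cont H_cont Q_ge0 L_row H_bound tT1 bu ut).
Qed.

Let g_nonneg s x : 0 <= s <= t -> x \in Si i -> 0 <= g s x.
Proof.
move=> st _; have tT1 : t <= T by case/andP: tT.
exact: (backward_ge0 lam_cont L_cont H_cont Q_ge0 tT1 bg g_ge0).
Qed.

Lemma nrm_bound s p1 : 0 <= s <= t -> 1 < p1 -> p1 <= p ->
  nrm i s p1 (g s) <= expR (7^-1) * nrm i t p1 (g t).
Proof.
move=> st p11 p1p; have [u [u0 u1 bu]] := backward_one.
have P4 := ltW p_gt4.
exact: (Lp_bound (Si_nonempty i) T_gt0 P4 (fun s x _ => mu_gt0 s x) Q_ge0
  Q_row Q_balance Q_blk mu_derive
  (fun s phi => @poincare_H i s phi T_gt0) tT g_nonneg (fun s x st _ => bg x st)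
  u0 u1 (fun s x st _ => bu s x st)).
Qed.

Lemma nrm_hypercontractive s delta p1 p2 : 0 <= s -> 0 < delta -> s + delta <= t ->
  17 * omega * delta = 2 -> 1 < p1 -> p1 <= p -> p1 < p2 -> ln ((p2 - 1) / (p1 - 1)) <= a ->
  nrm i s p2 (g s) <= expR (2 / 17 + 7^-1) * nrm i t p1 (g t).
Proof.
move=> s0 d0 sdt od p11 p1p p12 lna; have [u [u0 u1 bu]] := backward_one.
have P4 := ltW p_gt4.
have := (hypercontractive_bound (Si_nonempty i) T_gt0 omega_ge0 P4 (fun s x _ => mu_gt0 s x) Q_ge0
  Q_row Q_balance Q_blk mu_derive (fun s x => @block_H_osc i s x)
  (fun s phi => @poincare_H i s phi T_gt0) (fun s phi => @log_sobolev i s phi)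
  tT g_nonneg (fun s x st _ => bg x st)
  u0 u1 (fun s x st _ => bu s x st) s0 d0 sdt od p11 p1p p12 lna).
exact.
Qed.

End BlockBounds.

(** The unknown of the contraction argument. Nonnegative functions suffice, because the cross terms
    are majorised by [|H|] and squares before they are split into blocks. *)
Definition cov_bound i t (E : R) : Prop := forall s (phi : S -> R), 0 <= s <= t ->
  (forall y, 0 <= phi y) -> (forall y, y \notin Si i -> phi y = 0) ->
  cov s phi phi <= E * nrm i s p phi ^+ 2.

Let nrm_block i s p' u : nrm i s p' (block i u) = nrm i s p' u.
Proof.
have E : Lp_norm (c i s) p' (block i u) = Lp_norm (c i s) p' u.
  by apply: Lp_norm_cond_eq => x xi; rewrite /block xi.
change (m i s * Lp_norm (c i s) p' (block i u) = m i s * Lp_norm (c i s) p' u).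
by rewrite E.
Qed.

Lemma cov_block_le i s t u v (E : R) : t <= T -> 0 <= s <= t -> 0 <= E -> cov_bound i t E ->
  (forall y, 0 <= u y) -> (forall y, 0 <= v y) ->
  cov s (block i u) (block i v) <= E * (nrm i s p u * nrm i s p v).
Proof.
move=> tT st E0 HE u0 v0; have sT := ordT st tT.
rewrite -(nrm_block i s p u) -(nrm_block i s p v).
have b0 (w : S -> R) y : (forall y, 0 <= w y) -> 0 <= block i w y.
  by move=> w0; rewrite /block; case: ifP.
have b1 (w : S -> R) y : y \notin Si i -> block i w y = 0 by move=> /negbTE yi; rewrite /block yi.
apply: cov_cauchy => //; try exact: nrm_ge0.
- by apply: HE => // y; [exact: b0|exact: b1].
- by apply: HE => // y; [exact: b0|exact: b1].
Qed.

(** The rate due to products of means in [cross_bound]: one summand for [|H|] averaged globally, one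
    for [|H| phi^2] averaged on the block. The division compensates the squared mass contained in
    [nrm i s p phi ^+ 2]. *)
Definition window_rate i s : R := (Lp_norm (mu s) 2 (H s) + Lp_norm (c i s) 2 (H s)) / m i s.
Definition H_norm s : R := Lp_norm_max Si (mu s) q (H s).

Let H_norm_ge i s : Lp_norm (c i s) q (H s) <= H_norm s.
Proof. by rewrite /H_norm /Lp_norm_max (bigD1 i)//= le_max lexx. Qed.

Let pairing_sqr_nrm i s f : m i s * pairing (fun y => f y ^+ 2) (c i s) <=
  nrm i s p f ^+ 2 / m i s.
Proof.
have E := pairing_sqr f (fun x => c_ge0 i s x).
have l0 := Lp_norm_ge0 (c i s) 2 f.
have le : Lp_norm (c i s) 2 f <= Lp_norm (c i s) p f.
  by apply: Lp_norm_mono; [exact: c_ge0|exact: c_sum| |have := p_gt4; lra].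
move: E l0 le (m_gt0 i s); rewrite /nrm.
move: (pairing _ _) (Lp_norm _ 2 f) (Lp_norm _ p f) (m i s) => Z A B M -> A0 AB M0.
rewrite (_ : (M * B) ^+ 2 / M = M * B ^+ 2); last by field; rewrite gt_eqF.
by rewrite ler_pM2l// ler_pXn2r ?nnegrE ?(le_trans A0).
Qed.

Let cross_arith (x1 x2 x3 x4 M y1 y2 h e d : R) : 0 < M ->
  y1 * (M * x3) <= y1 * (4 / 3 * d / M) -> M * x4 <= y2 * (4 / 3 * d / M) ->
  x1 <= e * (h * (17 / 10 * d)) -> x2 <= e * (h * (17 / 10 * d)) ->
  y1 * (M * x3) + x1 + (M * x4 + x2) <=
  d * (4 / 3 * ((y1 + y2) / M) + 17 / 5 * (h * e)).
Proof.
move=> M0 s1 s2 t1 t2.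
rewrite (_ : d * _ = y1 * (4 / 3 * d / M) + y2 * (4 / 3 * d / M) +
  e * (h * (17 / 10 * d)) + e * (h * (17 / 10 * d))); last by field; rewrite gt_eqF.
lra.
Qed.

(** Products of means are estimated with the norms of [H] in [L^2] and of [phi] in [L^4], where
    [p > 4] enters. For the covariances [1/p = 1/q + 1/r] separates [H] in [L^q] from [phi^2] in
    [L^r], that is [phi] in [L^(2 r)]. *)
Lemma cross_bound s t phi (E d : I -> R) : t <= T -> 0 <= s <= t ->
  (forall i, 0 <= E i) -> (forall i, cov_bound i t (E i)) ->
  (forall y, 0 <= phi y) ->
  (forall i, nrm i s p phi ^+ 2 <= 4 / 3 * d i) ->
  (forall i, nrm i s (2 * r) phi ^+ 2 <= 17 / 10 * d i) ->
  bil s (fun y => `|H s y|) (fun y => phi y ^+ 2) +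
  bil s (fun=> 1) (fun y => `|H s y| * phi y ^+ 2) <=
  \sum_i d i * (4 / 3 * window_rate i s + 17 / 5 * (H_norm s * E i)).
Proof.
move=> tT st E0 HE phi0 h1 h2; have sT := ordT st tT.
have p0 := p_gt0; have q0 := q_gt0; have p4 := p_gt4; have pr := p_lt_r.
have r0 : 0 < r by lra.
have p1 : 1 <= p by lra.
have sqle (x y : R) : 0 <= x -> x <= y -> x ^+ 2 <= y ^+ 2.
  by move=> x0 xy; rewrite ler_pXn2r ?nnegrE// (le_trans x0).
have p20 : 0 < 2 * p by lra.
have p2r : 2 * p <= 2 * r by lra.
have sq0 (f : S -> R) y : 0 <= f y ^+ 2 by exact: sqr_ge0.
apply: (le_trans (lerD (bil_le_blocks sT (fun y => normr_ge0 (H s y)) (sq0 phi))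
  (bil_le_blocks sT (fun=> ler01) (fun y => mulr_ge0 (normr_ge0 (H s y)) (sq0 phi y))))).
have mu1 := mu_sum sT.
have -> : pairing (fun=> 1) (mu s) = 1.
  by rewrite /pairing; under eq_bigr do rewrite mul1r.
rewrite mul1r.
have pp := pairing_partition (fun x => mu_gt0 s x) Si_nonempty Si_disjoint Si_cover.
rewrite (pp (fun y => `|H s y| * phi y ^+ 2)) (pp (fun y => phi y ^+ 2)).
have HH2 : pairing (fun y => `|H s y|) (mu s) <= Lp_norm (mu s) 2 (H s).
  by apply: pairing_norm_le => //; lra.
set A := \sum_i _; set B := pairing _ _ in HH2 *.
have A0 : 0 <= A.
  apply: sumr_ge0 => i _; apply: (mulr_ge0 (ltW (m_gt0 i s))).
  by apply: sumr_ge0 => x _; exact: mulr_ge0 (sq0 phi x) (c_ge0 i s x).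
have BA : B * A <= Lp_norm (mu s) 2 (H s) * A by exact: ler_wpM2r.
apply: (le_trans (lerD (lerD BA (lexx _)) (lexx _))).
rewrite mulr_sumr -!big_split/=; apply: ler_sum => i _.
have m0 := m_gt0 i s.
have aux (M A' B' D : R) : 0 < M -> 0 <= A' -> A' <= B' -> (M * B') ^+ 2 <= D ->
    M * A' ^+ 2 <= D / M.
  move=> M0 A0' AB; rewrite ler_pdivlMr//; apply: le_trans.
  rewrite (_ : M * _ * M = (M * A') ^+ 2); last by ring.
  by rewrite ler_pXn2r ?nnegrE ?mulr_ge0 ?(ltW M0) ?(le_trans A0')// ler_pM2l.
have s1 : m i s * pairing (fun y => phi y ^+ 2) (c i s) <= 4 / 3 * d i / m i s.
  apply: (le_trans (pairing_sqr_nrm i s phi)); rewrite ler_pM2r ?invr_gt0//; exact: h1.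
have s2 : m i s * pairing (fun y => `|H s y| * phi y ^+ 2) (c i s) <=
    Lp_norm (c i s) 2 (H s) * (4 / 3 * d i / m i s).
  apply: (@le_trans _ _ (m i s * (Lp_norm (c i s) 2 (H s) * Lp_norm (c i s) 4 phi ^+ 2))).
    by rewrite ler_pM2l//; apply: pairing_norm_sqr_le => x; exact: c_ge0.
  rewrite mulrCA; apply: (ler_wpM2l (Lp_norm_ge0 _ _ _)).
  apply: (aux _ _ _ _ m0 (Lp_norm_ge0 _ _ _) _ (h1 i)).
  by apply: Lp_norm_mono; [exact: c_ge0|exact: c_sum| |exact: ltW].
have nb (f f' : S -> R) : nrm i s p (fun x => f x * f' x) <= m i s * (Lp_norm (c i s) q f * Lp_norm (c i s) r f').
  by apply: (ler_wpM2l (ltW m0)); apply: Lp_norm_holder => // x; exact: c_ge0.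
have Hq := H_norm_ge i s.
have n2r : m i s * Lp_norm (c i s) (2 * r) phi ^+ 2 * m i s <= 17 / 10 * d i.
  rewrite (_ : _ * m i s = nrm i s (2 * r) phi ^+ 2); first exact: h2.
  by rewrite /nrm; move: (Lp_norm _ _ _) (m i s) => A' M; ring.
have lr0 := Lp_norm_ge0 (c i s) (2 * r) phi.
have k1 : nrm i s p (fun y => `|H s y|) <= m i s * H_norm s.
  apply: (ler_wpM2l (ltW m0)); rewrite Lp_norm_norm; apply: le_trans Hq.
  by apply: Lp_norm_mono; [exact: c_ge0|exact: c_sum| |exact: ltW].
have k2 : nrm i s p (fun y => phi y ^+ 2) <= m i s * Lp_norm (c i s) (2 * r) phi ^+ 2.
  apply: (ler_wpM2l (ltW m0)); rewrite (Lp_norm_sqr _ (fun x => c_ge0 i s x) p0).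
  apply: (sqle _ _ (Lp_norm_ge0 _ _ _)).
  exact: (Lp_norm_mono phi (fun x => c_ge0 i s x) (c_sum i s) p20 p2r).
have k3 : nrm i s p (fun y => `|H s y| * phi y ^+ 2) <=
    m i s * (H_norm s * Lp_norm (c i s) (2 * r) phi ^+ 2).
  apply: (le_trans (nb _ _)); apply: (ler_wpM2l (ltW m0)).
  rewrite Lp_norm_norm (Lp_norm_sqr _ (fun x => c_ge0 i s x) r0).
  by apply: (ler_wpM2r (sqr_ge0 _)); exact: Hq.
have k4 : nrm i s p (fun=> 1) = m i s.
  by rewrite /nrm (Lp_norm_one (fun x => c_ge0 i s x) p0 (c_sum i s)) mulr1.
have H0 : 0 <= H_norm s by exact: le_trans (Lp_norm_ge0 _ _ _) Hq.
have Hn2 := Lp_norm_ge0 (mu s) 2 (H s).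
have t1 := cov_block_le tT st (E0 i) (HE i) (fun y => normr_ge0 (H s y)) (sq0 phi).
have t2 := cov_block_le tT st (E0 i) (HE i) (fun=> ler01)
  (fun y => mulr_ge0 (normr_ge0 (H s y)) (sq0 phi y)).
rewrite k4 in t2.
have t1' : cov s (block i (fun y => `|H s y|)) (block i (fun y => phi y ^+ 2)) <=
    E i * (H_norm s * (17 / 10 * d i)).
  apply: (le_trans t1); apply: (ler_wpM2l (E0 i)).
  apply: (@le_trans _ _ (m i s * H_norm s * (m i s * Lp_norm (c i s) (2 * r) phi ^+ 2))).
    by apply: ler_pM; rewrite ?nrm_ge0.
  apply: le_trans (ler_wpM2l H0 n2r).
  by rewrite le_eqVlt; apply/orP; left; apply/eqP; ring.
have t2' : cov s (block i (fun=> 1)) (block i (fun y => `|H s y| * phi y ^+ 2)) <=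
    E i * (H_norm s * (17 / 10 * d i)).
  apply: (le_trans t2); apply: (ler_wpM2l (E0 i)).
  apply: (le_trans (ler_wpM2l (ltW m0) k3)).
  apply: le_trans (ler_wpM2l H0 n2r).
  by rewrite le_eqVlt; apply/orP; left; apply/eqP; ring.
have s1' := ler_wpM2l Hn2 s1.
rewrite /window_rate; exact: (cross_arith m0 s1' s2 t1' t2').
Qed.

Let continuous_mass i : continuous (m i).
Proof. by move=> s; apply: continuous_bigsum => x _; exact: mu_cont. Qed.

Let continuous_inv_mass i : continuous (fun s => (m i s)^-1).
Proof. by move=> s; apply: (cvgV _ (@continuous_mass i s)); rewrite gt_eqF.
Qed.

Let continuous_cond i x : continuous (fun s => c i s x).
Proof.
move=> s; rewrite /c /cond; case: (x \in Si i); last exact: cst_continuous.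
by apply: continuous_for_mul; [exact: mu_cont|exact: continuous_inv_mass].
Qed.

Lemma continuous_window_rate i : continuous (window_rate i).
Proof.
move=> s; apply: continuous_for_mul; last exact: continuous_inv_mass.
have two0 : 0 < 2 :> R by [].
apply: continuous_for_add.
  exact: (continuous_Lp_norm two0 mu_ge (fun x => @mu_cont x s) (fun x => @H_cont x s)).
exact: (continuous_Lp_norm two0 (c_ge0 i) (fun x => @continuous_cond i x s) (fun x => @H_cont x s)).
Qed.

Lemma continuous_H_norm : continuous H_norm.
Proof.
move=> s; rewrite /H_norm /Lp_norm_max.
have D (l : seq I) : continuous_at s
    (fun s => \big[Num.max/0]_(i <- l) Lp_norm (cond (mu s) (Si i)) q (H s)).
  elim: l => [|i l IH].
    by under eq_fun do rewrite big_nil; exact: cst_continuous.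
  have -> : (fun s => \big[Num.max/0]_(j <- i :: l) Lp_norm (cond (mu s) (Si j)) q (H s)) =
      (fun s => Num.max (Lp_norm (c i s) q (H s))
        (\big[Num.max/0]_(j <- l) Lp_norm (cond (mu s) (Si j)) q (H s))).
    by apply/funext => s'; rewrite big_cons.
  apply: continuous_for_max IH.
  exact: (continuous_Lp_norm q_gt0 (c_ge0 i) (fun x => @continuous_cond i x s) (fun x => @H_cont x s)).
exact: D.
Qed.

(** The integral of [k] over [[0, t]], written so that it is differentiable in [t] also at 0. *)
Definition increment (k : R -> R) t : R := primitive k t - primitive k 0.

Lemma increment_mono (k : R -> R) s t : continuous k -> (forall s, 0 <= k s) ->
  0 <= s -> s <= t -> increment k s <= increment k t.
Proof.
move=> ck k0 s0 st.
rewrite lerD2r -subr_ge0 -[leLHS](subrr (0 : R)).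
apply: (@le_increment_closed R (fun=> 0) (primitive k) (fun=> 0) k s t st) => //.
by move=> x /andP[sx _]; apply: is_derive_primitive => //; lra.
Qed.

Lemma increment_ge0 (k : R -> R) t : continuous k -> (forall s, 0 <= k s) ->
  0 <= t -> 0 <= increment k t.
Proof.
move=> ck k0 t0; apply: le_trans (increment_mono ck k0 (lexx 0) t0).
by rewrite /increment subrr.
Qed.

Lemma window_rate_ge0 i s : 0 <= window_rate i s.
Proof. by rewrite divr_ge0 ?addr_ge0 ?Lp_norm_ge0// ltW ?m_gt0. Qed.

Lemma H_norm_ge0 s : 0 <= H_norm s.
Proof.
rewrite /H_norm /Lp_norm_max; elim/big_rec: _ => // i x _ x0.
by rewrite le_max x0 orbT.
Qed.

(** The logarithmic derivative of the mass is at least [- omega], so a window costs at most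
    [exp (2 / 17)]. *)
Lemma mass_window i tau t : 0 <= tau -> tau <= t -> t <= T -> omega * (t - tau) <= 2 / 17 ->
  m i tau <= 9 / 8 * m i t.
Proof.
move=> tau0 taut tT ot.
pose z s := expR (- omega * (t - s)) * m i s.
pose dz s := - - omega * expR (- omega * (t - s)) * m i s +
  expR (- omega * (t - s)) * \sum_(x in Si i) - (H s x * mu s x).
have : (0 : R) - 0 <= z t - z tau.
  apply: (@le_increment_closed R (fun=> 0) z (fun=> 0) dz tau t taut).
  - move=> s /andP[s1 s2]; have sT : 0 <= s <= T.
      by rewrite (le_trans tau0)// (le_trans s2).
    apply: is_derive_mul; first exact: is_derive_expR_lin.
    by apply: is_derive_bigsum => x _; exact: mu_derive.
  - move=> s /andP[s1 s2]; have sT : 0 <= s <= T.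
      by rewrite (le_trans tau0 (ltW s1)) (le_trans (ltW s2)).
    have -> : dz s = expR (- omega * (t - s)) * \sum_(x in Si i) (omega - H s x) * mu s x.
      have -> : \sum_(x in Si i) (omega - H s x) * mu s x =
          omega * m i s + \sum_(x in Si i) - (H s x * mu s x).
        by rewrite mulr_sumr -big_split/=; apply: eq_bigr => x _; ring.
      by rewrite /dz; ring.
    rewrite mulr_ge0 ?expR_ge0//; apply: sumr_ge0 => x _; apply: mulr_ge0 => //.
    by have := H_bound x sT; rewrite ler_norml subr_ge0 => /andP[].
rewrite subr0 subr_ge0 /z subrr mulr0 expR0 mul1r.
have E : expR (omega * (t - tau)) * expR (- omega * (t - tau)) = 1.
  by rewrite -expRD mulNr subrr expR0.
have e1 : expR (omega * (t - tau)) <= 9 / 8.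
  by apply: le_trans e217; rewrite ler_expR.
move=> h; have := ler_wpM2l (expR_ge0 (omega * (t - tau))) h.
rewrite mulrA E mul1r => /le_trans; apply.
by rewrite ler_pM2r ?m_gt0.
Qed.

Lemma window_start_le tau t w (E : I -> R) : t <= T -> 0 <= tau <= t ->
  (forall i, 0 <= E i) -> (forall i, cov_bound i t (E i)) ->
  (forall y, 0 <= w tau y) ->
  bil tau (fun=> 1) (w tau) <=
  pairing (w tau) (mu tau) + \sum_i E i * (m i tau * nrm i tau p (w tau)).
Proof.
move=> tT st E0 HE w0; have sT := ordT st tT.
apply: (le_trans (bil_le_blocks sT (fun=> ler01) w0)).
have -> : pairing (fun=> 1) (mu tau) = 1.
  by rewrite /pairing; under eq_bigr do rewrite mul1r; exact: mu_sum.
rewrite mul1r lerD2l; apply: ler_sum => i _.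
apply: (le_trans (cov_block_le tT st (E0 i) (HE i) (fun=> ler01) w0)).
rewrite {1}/nrm (Lp_norm_one (fun x => c_ge0 i tau x) p_gt0 (c_sum i tau)) mulr1.
exact: lexx.
Qed.

Let e27 : expR (7^-1) ^+ 2 <= 4 / 3 :> R.
Proof.
rewrite expr2 -expRD.
have h : (4 / 3)^-1 <= 1 - 2 / 7 + (2 / 7) ^+ 2 / 2 - (2 / 7) ^+ 3 / 6 :> R by lra.
have := expR_le_inv (_ : 0 <= 2 / 7) _ h; rewrite invrK (_ : 2 / 7 = 7^-1 + 7^-1).
  by apply; lra.
by field.
Qed.

Let e31 : expR (2 / 17 + 7^-1) <= 13 / 10 :> R.
Proof.
have h : (13 / 10)^-1 <= 1 - 31 / 119 + (31 / 119) ^+ 2 / 2 - (31 / 119) ^+ 3 / 6 :> R by lra.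
have := expR_le_inv (_ : 0 <= 31 / 119) _ h; rewrite invrK (_ : 31 / 119 = 2 / 17 + 7^-1).
  by apply; lra.
by field.
Qed.

Let e62 : expR (2 / 17 + 7^-1) ^+ 2 <= 17 / 10 :> R.
Proof.
rewrite expr2 -expRD.
have h : (17 / 10)^-1 <= 1 - 62 / 119 + (62 / 119) ^+ 2 / 2 - (62 / 119) ^+ 3 / 6 :> R by lra.
have := expR_le_inv (_ : 0 <= 62 / 119) _ h.
rewrite invrK (_ : 62 / 119 = 2 / 17 + 7^-1 + (2 / 17 + 7^-1)).
  by apply; lra.
by field.
Qed.

Let sqr_bound (x y e k : R) : 0 <= x -> 0 <= y -> x <= e * y -> e ^+ 2 <= k ->
  x ^+ 2 <= k * y ^+ 2.
Proof.
move=> x0 y0 xy ek; apply: (@le_trans _ _ ((e * y) ^+ 2)).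
  by rewrite ler_pXn2r ?nnegrE// (le_trans x0).
by rewrite exprMn ler_wpM2r// sqr_ge0.
Qed.

Let pairing_sqr_le t f : pairing (fun y => f y ^+ 2) (mu t) <= \sum_i nrm i t p f ^+ 2 / m i t.
Proof.
rewrite (pairing_partition (fun x => mu_gt0 t x) Si_nonempty Si_disjoint Si_cover).
by apply: ler_sum => i _; exact: pairing_sqr_nrm.
Qed.

(** Here [10/3 = 5/2 * 4/3] and [17/2 = 5/2 * 17/5] come from [dpsi_le] and [cross_bound]; the last
    window contributes [3/2] and [9/4 = 3/2 * 3/2]. *)
Definition variance_rhs t f (E : I -> R) : R := \sum_i nrm i t p f ^+ 2 *
  (3 / 2 / m i t + 10 / 3 * increment (window_rate i) t +
   (9 / 4 + 17 / 2 * increment H_norm t) * E i).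

(** [psi] is controlled by [cross_bound] up to one window before [t], and by [window_bound] from
    there on. *)
Lemma variance_bound t f (E : I -> R) : 0 <= t <= T ->
  (forall i, 0 <= E i) -> (forall i, cov_bound i t (E i)) ->
  N%:R * cov t f f <= variance_rhs t f E.
Proof.
move=> tT E0 HE; have /andP[t0 tT1] := tT.
(* Three backward solutions: [g] from [f] itself, [w] from [f^2] for the last window, and [h] from
   [|f|], which dominates [|g|] and is nonnegative as the block estimates demand. *)
have [g [gt bg]] := backward_exists lam_cont L_cont H_cont f t0.
have [w [wt bww]] := backward_exists lam_cont L_cont H_cont (fun y => f y ^+ 2) t0.
have [h [ht bh]] := backward_exists lam_cont L_cont H_cont (fun y => `|f y|) t0.
have wg y : w t y = g t y ^+ 2 by rewrite wt gt.
have wt0 y : 0 <= w t y by rewrite wt sqr_ge0.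
have ht0 y : 0 <= h t y by rewrite ht.
have w0 := backward_ge0 lam_cont L_cont H_cont Q_ge0 tT1 bww wt0.
have h0 := backward_ge0 lam_cont L_cont H_cont Q_ge0 tT1 bh ht0.
have covE : cov t (g t) (g t) = cov t f f by have -> : g t = f by apply/funext.
have K0 := increment_ge0 continuous_H_norm H_norm_ge0 t0.
have L0 i := increment_ge0 (@continuous_window_rate i) (window_rate_ge0 i) t0.
have pE s : 0 <= s <= t -> pairing (w s) (mu s) = pairing (fun y => f y ^+ 2) (mu t).
  move=> /andP[s0 st]; rewrite (pairing_backward_const mu_derive mu_inv s0 st tT1 bww).
  by apply: eq_bigr => y _; rewrite wt.
(* If [[0, t]] fits into one window, the window starts at time 0, where independence reduces [bil]
   to a mean. *)
have [small|large] := leP (omega * t) (2 / 17).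
  have small' : omega * (t - 0) <= 2 / 17 by rewrite subr0.
  have := window_bound (lexx 0) t0 tT1 small' omega_ge0 bg bww wg.
  rewrite covE subrr add0r => /le_trans; apply.
  have -> : bil 0 (fun=> 1) (w 0) = pairing (w 0) (mu 0).
    rewrite /bil /bsum b_0.
    have -> : pairing (fun=> 1) (mu 0) = 1.
      rewrite /pairing; under eq_bigr do rewrite mul1r; apply: mu_sum.
      by rewrite lexx (le_trans t0).
    rewrite mul1r (_ : pairing (fun y => 1 * w 0 y) _ = pairing (w 0) (mu 0)).
      by rewrite mulrBl mul1r subrK.
    by apply: eq_bigr => y _; rewrite mul1r.
  rewrite pE ?lexx//; apply: (le_trans (ler_wpM2l _ (pairing_sqr_le t f))) => //.
  rewrite mulr_sumr; apply: ler_sum => i _.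
  rewrite mulrCA; apply: (ler_wpM2l (sqr_ge0 _)).
  have a1 : 0 <= 10 / 3 * increment (window_rate i) t by rewrite mulr_ge0.
  have a2 : 0 <= (9 / 4 + 17 / 2 * increment H_norm t) * E i.
    by rewrite mulr_ge0// addr_ge0// mulr_ge0.
  by rewrite -addrA lerDl addr_ge0.
have om0 : 0 < omega.
  rewrite lt0r omega_ge0 andbT; apply/eqP => o0; move: large; rewrite o0 mul0r; lra.
pose delta : R := 2 / (17 * omega).
have d0 : 0 < delta by rewrite divr_gt0// mulr_gt0.
have od : 17 * omega * delta = 2 by rewrite /delta; field; rewrite gt_eqF.
pose tau := t - delta.
have tau0 : 0 <= tau.
  rewrite subr_ge0 /delta ler_pdivrMr ?mulr_gt0// (_ : t * _ = 17 * (omega * t)); last by ring.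
  by move: large; lra.
have taut : tau <= t by rewrite gerBl ltW.
have tdt : tau + delta = t by rewrite /tau subrK.
have T_gt0 : 0 < T.
  apply: lt_le_trans tT1; rewrite -tdt; exact: ltr_wpDl.
have ot : omega * (t - tau) <= 2 / 17.
  have -> : t - tau = delta by rewrite /tau; ring.
  by rewrite /delta le_eqVlt; apply/orP; left; apply/eqP; field; rewrite gt_eqF.
have taut' : 0 <= tau <= t by rewrite tau0.
pose n i := nrm i t p f ^+ 2.
have p4 := p_gt4; have pr := p_lt_r; have p0 := p_gt0.
have p11 : 1 < p by lra. have p2r : p < 2 * r by lra.
have hp1 : 1 < p / 2 by lra. have hp2 : p / 2 <= p by lra.
have hp3 : p / 2 < p by lra. have hp0 : 0 < p / 2 by lra.
have nh i : nrm i t p (h t) = nrm i t p f.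
  have -> : h t = (fun y => `|f y|) by apply/funext.
  by rewrite /nrm Lp_norm_norm.
have nw i : nrm i t (p / 2) (w t) = n i / m i t.
  have -> : w t = (fun y => f y ^+ 2) by apply/funext.
  rewrite /n /nrm (Lp_norm_sqr f (fun x => c_ge0 i t x) hp0).
  rewrite (_ : 2 * (p / 2) = p); last by field.
  by move: (m_gt0 i t) (Lp_norm _ _ _); move: (m i t) => M M0 l; field; rewrite gt_eqF.
have hb i s : 0 <= s <= t -> nrm i s p (h s) ^+ 2 <= 4 / 3 * n i.
  move=> st; have := nrm_bound i T_gt0 tT bh ht0 st p11 (lexx p).
  rewrite nh => H1; exact: sqr_bound (nrm_ge0 _ _ _ _) (nrm_ge0 _ _ _ _) H1 e27.
have hh i s : 0 <= s <= tau -> nrm i s (2 * r) (h s) ^+ 2 <= 17 / 10 * n i.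
  move=> /andP[s0 st]; have sdt : s + delta <= t by rewrite -tdt lerD2r.
  have := nrm_hypercontractive i T_gt0 tT bh ht0 s0 d0 sdt od p11 (lexx p) p2r a_ge1.
  rewrite nh => H1; exact: sqr_bound (nrm_ge0 _ _ _ _) (nrm_ge0 _ _ _ _) H1 e62.
have tdt' : tau + delta <= t by rewrite tdt.
(* The end value [f^2] is controlled in [L^(p / 2)], so [w] has to gain integrability from [p / 2]
   to [p]; this is the role of [a_ge2]. *)
have wb i : nrm i tau p (w tau) <= 13 / 10 * (n i / m i t).
  have := nrm_hypercontractive i T_gt0 tT bww wt0 tau0 d0 tdt' od hp1 hp2 hp3 a_ge2.
  rewrite nw => /le_trans; apply; apply: ler_wpM2r e31.
  by rewrite divr_ge0 ?sqr_ge0 ?(ltW (m_gt0 i t)).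
have beta_le : bil tau (fun=> 1) (w tau) <= \sum_i n i * (1 / m i t + 3 / 2 * E i).
  have w0tau y : 0 <= w tau y by exact: w0.
  apply: (le_trans (window_start_le tT1 taut' E0 HE w0tau)).
  rewrite pE//; apply: (le_trans (lerD (pairing_sqr_le t f) (lexx _))).
  rewrite -big_split/=; apply: ler_sum => i _.
  have M0 := m_gt0 i t.
  (* The product [9/8 * 13/10 = 117/80] stays below the 3/2 that is claimed. *)
  have h1 : m i tau * nrm i tau p (w tau) <= 9 / 8 * m i t * (13 / 10 * (n i / m i t)).
    apply: ler_pM; [exact: ltW (m_gt0 i tau)|exact: nrm_ge0| |exact: wb].
    exact: (mass_window i tau0 taut tT1 ot).
  have h2 := ler_wpM2l (E0 i) h1.
  have n0 : 0 <= n i by exact: sqr_ge0.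
  have En := mulr_ge0 (E0 i) n0.
  move: h2; rewrite -/(n i).
  rewrite (_ : 9 / 8 * m i t * (13 / 10 * (n i / m i t)) = 117 / 80 * n i); last first.
    by move: (m i t) M0 (n i) => M M0 n'; field; rewrite gt_eqF.
  rewrite (_ : n i * (1 / m i t + _) = n i / m i t + 3 / 2 * (E i * n i)); last by ring.
  rewrite (_ : E i * (117 / 80 * n i) = 117 / 80 * (E i * n i)); last by ring.
  by move: En; move: (E i * _) (E i * n i) (n i / m i t) => x y z En H1; rewrite lerD2l; lra.
pose G s := \sum_i n i * (10 / 3 * primitive (window_rate i) s + 17 / 2 * E i * primitive H_norm s).
pose dG s := \sum_i n i * (10 / 3 * window_rate i s + 17 / 2 * E i * H_norm s).
have derG s : 0 <= s -> is_derive s 1 G (dG s).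
  move=> s0; have s1 : -1 < s by lra.
  apply: is_derive_bigsum => i _; apply: is_derive_mull; apply: is_derive_add.
    by apply: is_derive_mull; apply: is_derive_primitive => //; exact: continuous_window_rate.
  by apply: is_derive_mull; apply: is_derive_primitive => //; exact: continuous_H_norm.
have dG0 s : 0 <= dG s.
  apply: sumr_ge0 => i _; apply: (mulr_ge0 (sqr_ge0 _)); apply: addr_ge0.
    by rewrite mulr_ge0// window_rate_ge0.
  by rewrite !mulr_ge0 ?H_norm_ge0.
have psi_inc : psi g g tau - psi g g 0 <= G tau - G 0.
  apply: (@le_increment_closed R (psi g g) G (dpsi g g) dG 0 tau tau0).
  - move=> s /andP[s0 st]; apply: (is_derive_psi tT1 bg bg).
    by rewrite s0 (le_trans st).
  - by move=> s /andP[s0 _]; exact: derG.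
  - move=> s /andP[/ltW s0 /ltW st]; have s_t : 0 <= s <= t by rewrite s0 (le_trans st).
    have stau : 0 <= s <= tau by rewrite s0.
    have sT := ordT s_t tT1; apply: (le_trans (dpsi_le g sT)).
    have gh y : `|g s y| <= h s y.
      apply: (backward_abs lam_cont L_cont H_cont Q_ge0 tT1 bg bh) => // z.
      by rewrite gt ht.
    have cb := cross_bound tT1 s_t E0 HE (fun y => h0 s y s_t) (fun i => hb i s s_t)
      (fun i => hh i s stau).
    have -> : dG s = 5 / 2 * \sum_i n i * (4 / 3 * window_rate i s + 17 / 5 * (H_norm s * E i)).
      by rewrite mulr_sumr; apply: eq_bigr => i _; field.
    rewrite ler_pM2l; last by lra.
    apply: le_trans cb; rewrite /bil -bsumD; apply: bsum_le => // y y'.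
    have gs : g s y' ^+ 2 <= h s y' ^+ 2.
      by rewrite -real_normK ?num_real// ler_pXn2r ?nnegrE ?h0.
    rewrite mul1r -mulrDl; apply: ler_pM => //; first exact: sqr_ge0.
    exact: ler_normB.
have G_inc : G tau - G 0 <= G t - G 0.
  rewrite lerD2r -subr_ge0 -[leLHS](subrr (0 : R)).
  apply: (@le_increment_closed R (fun=> 0) G (fun=> 0) dG tau t taut) => //.
  by move=> s /andP[s1 _]; apply: derG; exact: le_trans s1.
have := window_bound tau0 taut tT1 ot omega_ge0 bg bww wg.
rewrite covE => /le_trans; apply.
have GE : G t - G 0 = \sum_i n i * (10 / 3 * increment (window_rate i) t +
    17 / 2 * E i * increment H_norm t).
  by rewrite /G -sumrB; apply: eq_bigr => i _; rewrite /increment; ring.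
have -> : variance_rhs t f E = (G t - G 0) + 3 / 2 * \sum_i n i * (1 / m i t + 3 / 2 * E i).
  rewrite GE mulr_sumr -big_split/=; apply: eq_bigr => i _; rewrite -/(n i); by field; rewrite gt_eqF ?m_gt0.
move: beta_le psi_inc G_inc; rewrite /psi.
move: (bil tau _ _) (\sum_i _) (G t) (G tau) (G 0) => x1 x2 x3 x4 x5.
lra.
Qed.

Let nrm_off i s p' (phi : S -> R) : 0 < p' -> (forall y, y \in Si i -> phi y = 0) ->
  nrm i s p' phi = 0.
Proof.
move=> p'0 phi0; rewrite /nrm (@Lp_norm_cond_eq R S (mu s) (Si i) p' phi (fun=> 0) phi0).
rewrite /Lp_norm big1 ?powR0 ?mulr0 ?invr_eq0 ?gt_eqF// => x _.
by rewrite normr0 powR0 ?mul0r// gt_eqF.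
Qed.

Let one_cont : forall s, 0 <= s <= T -> continuous_at s (fun s => bil s (fun=> 1) (fun=> 1)).
Proof.
move=> s sT.
have D := @b_derive s (fun=> fun=> 1) (fun=> fun=> 1) (fun=> fun=> 0) (fun=> fun=> 0) sT
  (fun y => is_derive_cst (1 : R) s (1 : R)) (fun y => is_derive_cst (1 : R) s (1 : R)).
exact: is_derive_continuous D.
Qed.

(** A crude a priori bound that makes the least admissible constant finite, without which it could
    not be absorbed. On the compact time interval [mu] is bounded below, so a p-norm controls every
    value of [phi]. *)
Lemma cov_bound_exists : exists2 E, 0 <= E & forall i, cov_bound i T E.
Proof.
have [C C0 muC] : exists2 C, 0 < C & forall x s, 0 <= s <= T -> `|(mu s x)^-1| <= C.
  apply: continuous_segment_bounded_fin => x s _.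
  by apply: (cvgV _ (@mu_cont x s)); rewrite gt_eqF.
have [D D0 bD] : exists2 D, 0 < D & forall s, 0 <= s <= T -> `|bil s (fun=> 1) (fun=> 1)| <= D.
  by apply: continuous_segment_bounded => s; rewrite in_itv/=; exact: one_cont.
exists (D * C ^+ 2); first by rewrite mulr_ge0 ?sqr_ge0 ?ltW.
move=> i s phi sT phi0 phiS.
have p1 : 1 <= p by have := p_gt4; lra.
pose Y := C * nrm i s p phi.
have Y0 : 0 <= Y by exact: mulr_ge0 (ltW C0) (nrm_ge0 _ _ _ _).
have phiY y : phi y <= Y.
  have [yi|/phiS->//] := boolP (y \in Si i).
  have := Lp_norm_cond_ge (mu_gt0 s) (Si_nonempty i) phi p1 yi.
  rewrite (ger0_norm (phi0 y)) -/(m i s) -/(c i s) -/(nrm i s p phi).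
  have := muC y s sT; rewrite ger0_norm ?invr_ge0// => h1 h2.
  have := ler_wpM2l (ltW C0) h2; rewrite -/Y; apply: le_trans.
  rewrite mulrCA -[leLHS]mulr1; apply: (ler_wpM2l (phi0 y)).
  by rewrite -(@ler_pM2r _ (mu s y)^-1) ?invr_gt0// mul1r mulfK ?gt_eqF.
apply: (@le_trans _ _ (bil s phi phi)).
  by rewrite /cov gerBl -expr2 sqr_ge0.
apply: (@le_trans _ _ (Y ^+ 2 * bil s (fun=> 1) (fun=> 1))).
  by rewrite -bsumZ; apply: bsum_le => // y y'; rewrite !mulr1 expr2 ler_pM.
rewrite (_ : _ * nrm i s p phi ^+ 2 = Y ^+ 2 * D); last by rewrite /Y; ring.
apply: (ler_wpM2l (sqr_ge0 _)).
exact: le_trans (ler_norm _) (bD s sT).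
Qed.

Section Absorption.
Variables (t M : R).
Hypothesis tT : 0 <= t <= T.
Hypothesis N_ge : 40 * Num.max (increment H_norm t) 1 <= N%:R.
Hypothesis M_ratio : forall i s s', 0 <= s -> s <= s' -> s' <= t -> m i s' <= M * m i s.

Let N40 : 40 <= N%:R :> R.
Proof. by apply: le_trans N_ge; rewrite ler_peMr// le_max lexx orbT. Qed.

Let K40 : 40 * increment H_norm t <= N%:R.
Proof. by apply: le_trans N_ge; rewrite ler_pM2l// le_max lexx. Qed.

Let t0 : 0 <= t. Proof. by case/andP: tT. Qed.
Let tT1 : t <= T. Proof. by case/andP: tT. Qed.

(** Uniform over earlier times [s]: there [1 / m i s] is at most [M / m i t]. *)
Definition block_rate i : R := 3 / 2 * (M / m i t) + 10 / 3 * increment (window_rate i) t.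

Let M_ge0 i : 0 <= M.
Proof.
have h := M_ratio i (lexx 0) (lexx 0) t0.
by rewrite -(pmulr_lge0 _ (m_gt0 i 0)) (le_trans _ h)// ltW.
Qed.

Let block_rate_ge0 i : 0 <= block_rate i.
Proof.
rewrite addr_ge0// mulr_ge0// ?divr_ge0 ?(M_ge0 i)// ?(ltW (m_gt0 i t))//.
exact: increment_ge0 (@continuous_window_rate i) (window_rate_ge0 i) t0.
Qed.

Let contraction : R := (9 / 4 + 17 / 2 * increment H_norm t) / N%:R.

(** From [N >= 40] and [N >= 40 K] one gets [9/160 + 17/80 = 43/160]. *)
Let contraction_le : contraction <= 27 / 100.
Proof.
have n40 := N40; have k40 := K40.
rewrite ler_pdivrMr; last by lra.
lra.
Qed.

Let contraction_ge0 : 0 <= contraction.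
Proof.
rewrite divr_ge0// addr_ge0// mulr_ge0//.
exact: increment_ge0 continuous_H_norm H_norm_ge0 t0.
Qed.

(** For a function supported in one block all other norms in [variance_rhs] vanish, so the estimate
    closes on that block. *)
Lemma cov_bound_step (E : I -> R) i : (forall i, 0 <= E i) -> (forall i, cov_bound i t (E i)) ->
  cov_bound i t (block_rate i / N%:R + contraction * E i).
Proof.
move=> E0 HE s phi st phi0 phiS; have sT := ordT st tT1.
have n0 : 0 < N%:R :> R by rewrite ltr0n.
have /andP[s0 st1] := st.
have HEs j : cov_bound j s (E j).
  by move=> s1 psi /andP[s10 s1s]; apply: HE; rewrite s10 (le_trans s1s).
have := variance_bound phi sT E0 HEs; rewrite /variance_rhs (bigD1 i)//= [X in _ + X]big1 ?addr0; last first.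
  move=> j ji; rewrite nrm_off ?expr0n ?mul0r ?p_gt0// => y yj; apply: phiS.
  by apply/negP => yi; move: ji; rewrite (Si_disjoint yi yj) eqxx.
rewrite mulrC -ler_pdivlMr// => /le_trans; apply.
rewrite -[leLHS]mulrA [leLHS]mulrC; apply: ler_wpM2r; first exact: sqr_ge0.
rewrite (_ : block_rate i / N%:R + contraction * E i = (block_rate i +
  (9 / 4 + 17 / 2 * increment H_norm t) * E i) / N%:R); last by rewrite /contraction; ring.
rewrite ler_pM2r ?invr_gt0// /block_rate.
have h1 : (m i s)^-1 <= M / m i t.
  rewrite ler_pdivlMr ?m_gt0// mulrC ler_pdivrMr ?m_gt0//.
  exact: M_ratio.
have h2 := increment_mono (@continuous_window_rate i) (window_rate_ge0 i) s0 st1.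
have h3 := increment_mono continuous_H_norm H_norm_ge0 s0 st1.
have h4 := ler_wpM2r (E0 i) h3.
move: h1 h2 h4; move: (increment _ s) (increment _ t) => x y.
move: (increment _ s) (increment _ t) ((m i s)^-1) (M / m i t) (E i) => z z' u u' e h1 h2 h4.
lra.
Qed.

(* The least admissible constant [e] satisfies [e <= block_rate / N + contraction * e]
   by the previous lemma, and [contraction <= 27 / 100]. *)
Lemma cov_bound_absorbed i : cov_bound i t (7 / 5 * (block_rate i / N%:R)).
Proof.
have n0 : 0 < N%:R :> R by rewrite ltr0n.
have [E00 E00ge HE00] := cov_bound_exists.
pose B j : set R := [set E | 0 <= E /\ cov_bound j t E].
have B0 j : B j !=set0.
  exists E00; split=> // s phi /andP[s0 st]; apply: HE00.
  by rewrite s0 (le_trans st).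
have Blb j : has_lbound (B j) by exists 0 => E [].
pose e j := inf (B j).
have e0 j : 0 <= e j by apply: lb_le_inf => // E [].
have He j : cov_bound j t (e j).
  move=> s phi st phi0 phiS.
  (* The infimum is itself admissible: divide by the norm if it is positive, and use any member of
     [B j] if it is 0. *)
  have := sqr_ge0 (nrm j s p phi); rewrite le_eqVlt => /predU1P[n00|np].
    have [E [E0 HE]] := B0 j.
    by have := HE s phi st phi0 phiS; rewrite -n00 !mulr0.
  rewrite -ler_pdivrMr//; apply: lb_le_inf => // E [E0 HE].
  by rewrite ler_pdivrMr//; exact: HE.
have step := @cov_bound_step e i e0 He.
have r0 : 0 <= block_rate i / N%:R by rewrite divr_ge0// block_rate_ge0.
have ce0 := mulr_ge0 contraction_ge0 (e0 i).
have le1 : e i <= block_rate i / N%:R + contraction * e i.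
  by apply: ge_inf => //; split=> //; exact: addr_ge0.
(* [1 / (1 - 27/100)] is below 7/5. *)
have le2 : e i <= 7 / 5 * (block_rate i / N%:R).
  have := ler_wpM2r (e0 i) contraction_le; move: le1 r0.
  by move: (block_rate i / N%:R) (contraction * e i) (e i) => x y z; lra.
move=> s phi st phi0 phiS; apply: (le_trans (He i s phi st phi0 phiS)).
by apply: ler_wpM2r le2; exact: sqr_ge0.
Qed.

Let H2 s := Lp_norm (mu s) 2 (H s).

Let continuous_H2 : continuous H2.
Proof.
move=> s; have two0 : 0 < 2 :> R by [].
exact: (continuous_Lp_norm two0 mu_ge (fun x => @mu_cont x s) (fun x => @H_cont x s)).
Qed.

(** Weighted by squared masses, the block rates add up to a global [L^2] norm: ratios of masses at
    times [t] and [s] are replaced by [M], the remaining masses sum to 1, and [mass_Lp_norm2_le]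
    collects the conditional norms. *)
Lemma window_rate_sum_le : 1 <= M ->
  \sum_i m i t ^+ 2 * increment (window_rate i) t <= 2 * M ^+ 2 * increment H2 t.
Proof.
move=> M1; rewrite /increment mulrBr; under eq_bigr do rewrite mulrBr.
rewrite sumrB.
apply: (@le_increment_closed R (fun s => \sum_i m i t ^+ 2 * primitive (window_rate i) s)
  (fun s => 2 * M ^+ 2 * primitive H2 s) (fun s => \sum_i m i t ^+ 2 * window_rate i s)
  (fun s => 2 * M ^+ 2 * H2 s) 0 t t0).
- move=> s /andP[s0 _]; apply: is_derive_bigsum => i _; apply: is_derive_mull.
  by apply: is_derive_primitive; [exact: continuous_window_rate|lra].
- move=> s /andP[s0 _]; apply: is_derive_mull.
  by apply: is_derive_primitive; [exact: continuous_H2|lra].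
move=> s /andP[/ltW s0 /ltW st].
have sT : 0 <= s <= T by rewrite s0 (le_trans st).
have M0 : 0 <= M by exact: le_trans M1.
have H20 : 0 <= H2 s by exact: Lp_norm_ge0.
apply: (@le_trans _ _ (\sum_i (M * (m i t * H2 s) + M ^+ 2 * (m i s * Lp_norm (c i s) 2 (H s))))).
  apply: ler_sum => i _; rewrite /window_rate -/(H2 s) mulrDl mulrDr.
  have ms := m_gt0 i s; have mt := m_gt0 i t; have R1 := M_ratio i s0 st (lexx t).
  have L0 := Lp_norm_ge0 (c i s) 2 (H s).
  apply: lerD.
    rewrite (_ : _ * (_ / _) = (m i t / m i s) * (m i t * H2 s)); last by ring.
    apply: ler_wpM2r; first by rewrite mulr_ge0// ltW.
    by rewrite ler_pdivrMr.
  rewrite (_ : _ * (_ / _) = (m i t / m i s) ^+ 2 * (m i s * Lp_norm (c i s) 2 (H s))).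
    apply: ler_wpM2r; first by rewrite mulr_ge0// ltW.
    by rewrite ler_pXn2r ?nnegrE ?divr_ge0 ?(ltW mt) ?(ltW ms)// ler_pdivrMr.
  by move: ms; move: (m i s) (m i t) (Lp_norm _ _ _) => x y z x0; field; rewrite gt_eqF.
rewrite big_split/= -!mulr_sumr -mulr_suml.
have tE : \sum_i m i t = 1.
  rewrite -(mu_sum tT); exact: (mass_partition (mu t) Si_disjoint Si_cover).
have h2 := mass_Lp_norm2_le (fun x => mu_gt0 s x) Si_nonempty Si_disjoint Si_cover (H s) (mu_sum sT).
rewrite tE mul1r; have h3 := ler_wpM2l (sqr_ge0 M) h2.
apply: (le_trans (lerD (lexx _) h3)); rewrite -/(H2 s).
rewrite (_ : 2 * M ^+ 2 * H2 s = M ^+ 2 * H2 s + M ^+ 2 * H2 s); last by ring.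
rewrite lerD2r; apply: ler_wpM2r => //.
by rewrite expr2 ler_peMl.
Qed.

Lemma particle_variance_le f : 1 <= M -> (increment H_norm t <= 12^-1 -> M <= 4) ->
  (forall i, Lp_norm (c i t) p f <= 1) ->
  cov t f f <= (2 + 8 * increment H2 t * M ^+ 2) / N%:R *
    (1 + 16 * increment H_norm t * M ^+ 2 / N%:R).
Proof.
move=> M1 M4 f1.
have n0 : 0 < N%:R :> R by rewrite ltr0n.
have E0 i : 0 <= 7 / 5 * (block_rate i / N%:R).
  by rewrite mulr_ge0// divr_ge0// block_rate_ge0.
have V := variance_bound f tT E0 cov_bound_absorbed.
have kt0 := increment_ge0 continuous_H_norm H_norm_ge0 t0.
have k0 : 0 <= increment H2 t.
  by apply: increment_ge0 continuous_H2 _ t0 => s; exact: Lp_norm_ge0.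
have W := window_rate_sum_le M1.
have tE : \sum_i m i t = 1.
  rewrite -(mu_sum tT); exact: (mass_partition (mu t) Si_disjoint Si_cover).
have V2 : variance_rhs t f (fun i => 7 / 5 * (block_rate i / N%:R)) <=
  3 / 2 * \sum_i m i t + 10 / 3 * (\sum_i m i t ^+ 2 * increment (window_rate i) t) +
  (9 / 4 + 17 / 2 * increment H_norm t) * (7 / 5 / N%:R) *
   (3 / 2 * M * (\sum_i m i t) + 10 / 3 * (\sum_i m i t ^+ 2 * increment (window_rate i) t)).
  rewrite !(mulr_sumr, =^~ big_split)/= /variance_rhs; apply: ler_sum => i _.
  have M0 := m_gt0 i t.
  have L0 := increment_ge0 (@continuous_window_rate i) (window_rate_ge0 i) t0.
  have n1 : nrm i t p f ^+ 2 <= m i t ^+ 2.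
    rewrite ler_pXn2r ?nnegrE ?nrm_ge0 ?(ltW M0)// /nrm -[leRHS]mulr1.
    by rewrite ler_pM2l.
  apply: (le_trans (ler_wpM2r _ n1)).
    rewrite addr_ge0//; last by rewrite mulr_ge0// addr_ge0// mulr_ge0.
    by rewrite addr_ge0// ?divr_ge0 ?(ltW M0)// mulr_ge0.
  rewrite le_eqVlt; apply/orP; left; apply/eqP; rewrite /block_rate.
  move: M0; move: (m i t) (increment _ t) (increment _ t) => x y z x0.
  by move: n0; move: (N%:R : R) => n n0; field; rewrite !gt_eqF.
have FA := variance_arith k0 kt0 M1 N40 K40 M4.
rewrite -(ler_pM2l n0); apply: (le_trans V); apply: (le_trans V2).
rewrite tE !mulr1.
rewrite (_ : N%:R * _ = (2 + 8 * increment H2 t * M ^+ 2) *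
    (1 + 16 * increment H_norm t * M ^+ 2 / N%:R)); last first.
  by move: n0; move: (N%:R : R) (1 + _) (2 + _) => n x y n0; field; rewrite gt_eqF.
apply: le_trans FA; set w := \sum_i _ in W *.
have W' : 10 / 3 * w <= 20 / 3 * increment H2 t * M ^+ 2 by move: W; lra.
apply: lerD; first by rewrite lerD2l.
by apply: ler_wpM2l; [rewrite mulr_ge0// ?addr_ge0 ?mulr_ge0 ?divr_ge0// ltW|rewrite lerD2l].
Qed.

End Absorption.

(** The logarithmic derivative of a block mass is minus the conditional mean of [H], which the [L^q]
    norm dominates. *)
Lemma mass_ratio_le i s s' t : 0 <= s -> s <= s' -> s' <= t -> t <= T ->
  m i s' <= expR (increment H_norm t) * m i s.
Proof.
move=> s0 ss' s't tT.
pose z r := expR (- 1 * (primitive H_norm r - primitive H_norm s)) * m i r.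
pose dz r := expR (- 1 * (primitive H_norm r - primitive H_norm s)) * (- 1 * (H_norm r - 0)) * m i r +
  expR (- 1 * (primitive H_norm r - primitive H_norm s)) * \sum_(x in Si i) - (H r x * mu r x).
have h : z s' - z s <= (0 : R) - 0.
  apply: (@le_increment_closed R z (fun=> 0) dz (fun=> 0) s s' ss').
  - move=> v /andP[sv vs']; have v0 := le_trans s0 sv.
    have vT : 0 <= v <= T by rewrite v0 (le_trans vs')// (le_trans s't).
    apply: is_derive_mul; last by apply: is_derive_bigsum => x _; exact: mu_derive.
    apply: is_derive_comp1; apply: is_derive_mull; apply: is_derive_sub.
    by apply: is_derive_primitive; [exact: continuous_H_norm|lra].
  - move=> v /andP[sv vs']; rewrite /dz.
    have p1 : 1 <= q by have := p_lt_q; have := p_gt4; lra.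
    have := normr_pairing_le (H v) (c_ge0 i v) (c_sum i v) p1.
    move=> /le_trans/(_ (H_norm_ge i v)); rewrite ler_norml => /andP[hp _].
    have E : \sum_(x in Si i) - (H v x * mu v x) = - (m i v * pairing (H v) (c i v)).
      by rewrite /m /c mass_pairing_cond// sumrN.
    rewrite E; set e := expR _.
    rewrite (_ : _ + _ = - (e * (m i v * (H_norm v + pairing (H v) (c i v))))); last by ring.
    rewrite oppr_le0 mulr_ge0 ?expR_ge0// mulr_ge0 ?(ltW (m_gt0 i v))//; lra.
have zs : z s = m i s by rewrite /z subrr mulr0 expR0 mul1r.
rewrite zs subrr subr_le0 in h.
pose P := primitive H_norm s' - primitive H_norm s.
have e1 : expR P * expR (- 1 * P) = 1 by rewrite -expRD mulN1r subrr expR0.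
have {}h : m i s' <= expR P * m i s.
  rewrite -[leLHS]mul1r -e1 -mulrA; exact: (ler_wpM2l (expR_ge0 P) h).
apply: (le_trans h); apply: (ler_wpM2r (ltW (m_gt0 i s))); rewrite ler_expR /increment.
rewrite /P.
have s't0 := increment_mono continuous_H_norm H_norm_ge0 (le_trans s0 ss') s't.
have := increment_ge0 continuous_H_norm H_norm_ge0 s0.
move: s't0; rewrite /increment; lra.
Qed.

(** The supremum in [tilde_eps] runs over times [s <= t]; the estimate is made at time [s] and its
    right-hand side increases with time. *)
Lemma particle_variance_bound t s f M : 0 <= s -> s <= t -> t <= T ->
  40 * Num.max (increment H_norm t) 1 <= N%:R -> 1 <= M ->
  (forall i r r', 0 <= r -> r <= r' -> r' <= t -> m i r' <= M * m i r) ->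
  (forall i, Lp_norm (c i s) p f <= 1) ->
  cov s f f <= (2 + 8 * increment (fun s => Lp_norm (mu s) 2 (H s)) t * M ^+ 2) / N%:R *
    (1 + 16 * increment H_norm t * M ^+ 2 / N%:R).
Proof.
move=> s0 st tT Nt M1 Mr f1; have sT : 0 <= s <= T by rewrite s0 (le_trans st).
have ks := increment_mono continuous_H_norm H_norm_ge0 s0 st.
have ks0 := increment_ge0 continuous_H_norm H_norm_ge0 s0.
have cH2 : continuous (fun s => Lp_norm (mu s) 2 (H s)).
  move=> v; have two0 : 0 < 2 :> R by [].
  exact: (continuous_Lp_norm two0 mu_ge (fun x => @mu_cont x v) (fun x => @H_cont x v)).
have H20 (v : R) : 0 <= Lp_norm (mu v) 2 (H v) by exact: Lp_norm_ge0.
have k2 := increment_mono cH2 H20 s0 st.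
have k20 := increment_ge0 cH2 H20 s0.
(* Both entries bound the mass ratios; the second gives [M' <= 4] when the integral of [H_norm] is
   small, as [variance_arith] requires. *)
pose M' := Num.min M (expR (increment H_norm s)).
have M'1 : 1 <= M' by rewrite le_min M1 -expR0 ler_expR.
have M'M : M' <= M by rewrite ge_min lexx.
have Ns : 40 * Num.max (increment H_norm s) 1 <= N%:R.
  apply: le_trans Nt; rewrite ler_pM2l// ge_max !le_max ks lexx !orbT//.
have M'r i (v v' : R) : 0 <= v -> v <= v' -> v' <= s -> m i v' <= M' * m i v.
  move=> v0 vv' v's; rewrite /M'; case: (leP M) => _.
    by apply: Mr => //; exact: le_trans st.
  by apply: mass_ratio_le => //; exact: le_trans tT.
have M'4 : increment H_norm s <= 12^-1 -> M' <= 4.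
  move=> h; apply: (@le_trans _ _ (expR 12^-1)).
    by rewrite /M' ge_min ler_expR h orbT.
  have h1 : 4^-1 <= 1 - 12^-1 + 12^-1 ^+ 2 / 2 - 12^-1 ^+ 3 / 6 :> R by lra.
  by have := expR_le_inv (_ : 0 <= 12^-1) _ h1; rewrite invrK; apply; lra.
have V := particle_variance_le sT Ns M'r M'1 M'4 f1.
apply: (le_trans V).
have n0 : 0 < N%:R :> R by rewrite ltr0n.
have MM : M' ^+ 2 <= M ^+ 2 by rewrite ler_pXn2r ?nnegrE ?(le_trans ler01)// (le_trans M'1).
have X0 := sqr_ge0 M'.
apply: ler_pM.
- by rewrite divr_ge0 ?(ltW n0)// addr_ge0// mulr_ge0// mulr_ge0.
- by rewrite addr_ge0// divr_ge0 ?(ltW n0)// mulr_ge0// mulr_ge0.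
- rewrite ler_pM2r ?invr_gt0// lerD2l -!mulrA ler_pM2l//.
  exact: ler_pM.
- rewrite lerD2l ler_pM2r ?invr_gt0// -!mulrA ler_pM2l//.
  exact: ler_pM.
Qed.

End Covariance.

(** * Reduction of the theorem to two-sided time *)

Section Extension.
Context {R : realType}.
Implicit Types (g : R -> R) (d t : R).

Lemma continuous_from_clamp g a : {within `[a, +oo[, continuous g} ->
  continuous (fun t => g (Num.max a t)).
Proof.
move=> /subspace_continuousP cg t.
have A s : `[a, +oo[%classic (Num.max a s) by rewrite /= in_itv/= andbT le_max lexx.
have C : Num.max a s @[s --> t] --> Num.max a t.
  by apply: continuous_max; [exact: cst_continuous|exact: cvg_id].
apply: cvg_comp (cg _ (A t)) => B BB.
have CB := C _ BB; apply: (@filterS _ (nbhs t) _ _ _ _ CB) => s /=.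
by apply; exact: A.
Qed.

(* Turns the one-sided derivative [d] of [g] at time 0 into a two-sided one. *)
Definition extend_from g d t : R := if t < 0 then g 0 + t * d else g t.

Lemma extend_fromE g d t : 0 <= t -> extend_from g d t = g t.
Proof. by move=> t0; rewrite /extend_from ltNge t0. Qed.

Lemma is_derive_extend_from g (dg : R -> R) t : 0 <= t ->
  (forall t, 0 <= t -> has_derivative_from 0 g t (dg t)) ->
  is_derive t 1 (extend_from g (dg 0)) (dg t).
Proof.
move=> t0 gd; move: t0; rewrite le_eqVlt => /predU1P[<-|t0]; last first.
  apply: (@near_eq_is_derive _ _ _ g).
    near=> s; rewrite extend_fromE//; near: s.
    by apply: (cvgr_ge t) => //; exact: cvg_id.
  exact: has_derivative_from_is_derive t0 (gd t (ltW t0)).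
have D : (fun h : R => h^-1 *: (extend_from g (dg 0) (h *: (1 : R) + 0) -
    extend_from g (dg 0) 0)) @ (0 : R)^' --> dg 0.
  apply/cvgrPdist_le => e e0.
  have /cvgrPdist_le/(_ e e0) := gd 0 (lexx 0).
  rewrite /nbhs/= /within/= => -[r /= r0 H]; exists r => //= h /= hr h0.
  rewrite /extend_from ltxx /GRing.scale/= mulr1 addr0.
  case: ltP => [hn|hp].
    rewrite (_ : _ - _ * _ = 0) ?normr0 ?(ltW e0)//.
    by rewrite addrAC subrr add0r mulrA mulVf// mul1r subrr.
  have := H h hr h0; rewrite /= in_itv/= hp/= subr0 [_ / h]mulrC; exact.
split; first by apply/cvg_ex; exists (dg 0); exact: D.
exact: cvg_lim.
Unshelve. all: by end_near. Qed.

Lemma continuous_extend_from g (dg : R -> R) :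
  (forall t, 0 <= t -> has_derivative_from 0 g t (dg t)) ->
  continuous (extend_from g (dg 0)).
Proof.
move=> gd t; have [t0|t0] := leP 0 t.
  exact: is_derive_continuous (is_derive_extend_from t0 gd).
have E : \forall s \near t, (fun s => g 0 + s * dg 0) s = extend_from g (dg 0) s.
  near=> s; rewrite /extend_from ifT//; near: s.
  by apply: (cvgr_lt t) => //; exact: cvg_id.
have C : continuous_at t (fun s => g 0 + s * dg 0).
  apply: continuous_for_add; first exact: cst_continuous.
  by apply: continuous_for_mul; [exact: cvg_id|exact: cst_continuous].
rewrite /continuous_at [X in _ --> X]/extend_from t0.
exact: cvg_trans (near_eq_cvg E) C.
Unshelve. all: by end_near. Qed.

Lemma derivative_from_is_derive g h t d : 0 <= t -> (forall s, 0 <= s -> g s = h s) ->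
  is_derive t 1 h d -> derivative_from 0 g t = d.
Proof.
move=> t0 gh hd.
have [hdv hE] := hd.
have D : (fun e : R => e^-1 *: (h (e *: (1 : R) + t) - h t)) @ (0 : R)^' --> d.
  by rewrite -hE; exact: hdv.
have D2 : (g u - g t) / (u - t) @[u --> within `[0, +oo[ t^'] --> d.
  apply/cvgrPdist_le => e e0.
  have /cvgrPdist_le/(_ e e0)[r /= r0 H] := D.
  exists r => //= u tu ut; rewrite /= in_itv/= andbT => u0.
  have := H (u - t); rewrite /= sub0r normrN distrC => /(_ tu).
  rewrite subr_eq0 => /(_ ut); rewrite /GRing.scale/= mulr1 subrK [_ * (h u - h t)]mulrC.
  by rewrite (gh u u0) (gh t t0).
(* [lim] can be identified because the punctured half-line accumulates at [t] from the right, even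
   for [t = 0]. *)
have PF : ProperFilter (within `[0, +oo[ t^').
  apply: Build_ProperFilter_ex => B [r /= r0 H].
  exists (t + r / 2); apply: H => /=.
  - by rewrite opprD addrA subrr sub0r normrN gtr0_norm ?divr_gt0//; lra.
  - by rewrite -subr_eq0 addrAC subrr add0r gt_eqF ?divr_gt0.
  - by rewrite in_itv/= andbT addr_ge0// divr_ge0 ?ltW.
exact: cvg_lim D2.
Qed.

End Extension.

Section GibbsExtension.
Context {R : realType} {S : finType}.
Variables (mu U : R -> S -> R).
Implicit Types (t : R) (x y : S).
Hypothesis mu_gt0 : forall t x, 0 <= t -> 0 < mu t x.
Hypothesis mu_sum1 : forall t, 0 <= t -> \sum_x mu t x = 1.
Hypothesis mu_gibbs : forall t x, 0 <= t ->
  mu t x = (\sum_y expR (- U t y) * mu 0 y)^-1 * expR (- U t x) * mu 0 x.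
Hypothesis U_C1 : forall x, C1_from 0 (fun t : R => U t x).

(** The energy is extended, not the measure: the Gibbs form then keeps the extended weights positive
    and normalisable at negative times. *)
Definition ext_U t x : R :=
  extend_from (fun t => U t x) (derivative_from 0 (fun t => U t x) 0) t.

Definition ext_dU t x : R := derivative_from 0 (fun t => U t x) (Num.max 0 t).

Definition ext_weight t x : R := expR (- ext_U t x) * mu 0 x.

Definition ext_mu t x : R := (\sum_y ext_weight t y)^-1 * ext_weight t x.

Definition ext_H t x : R := ext_dU t x - pairing (ext_dU t) (ext_mu t).

Let weight_gt0 t x : 0 < ext_weight t x.
Proof. by rewrite mulr_gt0 ?expR_gt0 ?mu_gt0. Qed.

Let total_gt0 t : 0 < \sum_y ext_weight t y.
Proof.
have [y _|S0] := pickP (fun _ : S => true).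
  by rewrite (bigD1 y)//= ltr_pwDl// sumr_ge0// => z _; exact: ltW.
have := mu_sum1 (lexx 0); rewrite big1; last by move=> y; have := S0 y.
by move=> /eqP; rewrite eq_sym oner_eq0.
Qed.

Lemma ext_mu_gt0 t x : 0 < ext_mu t x.
Proof. by rewrite mulr_gt0 ?invr_gt0. Qed.

Lemma ext_mu_sum t : \sum_x ext_mu t x = 1.
Proof. by rewrite -mulr_sumr mulVf// gt_eqF. Qed.

Lemma ext_muE t x : 0 <= t -> ext_mu t x = mu t x.
Proof.
move=> t0; rewrite mu_gibbs// /ext_mu /ext_weight /ext_U extend_fromE// mulrA.
by congr (_^-1 * _ * _); apply: eq_bigr => y _; rewrite extend_fromE.
Qed.

Lemma continuous_ext_mu x : continuous (ext_mu ^~ x).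
Proof.
have cW y : continuous (ext_weight ^~ y).
  move=> t; apply: continuous_for_mul; last exact: cst_continuous.
  apply: (continuous_comp (f := fun t => - ext_U t y) (g := expR)); last exact: continuous_expR.
  by apply: continuousN; exact: (@continuous_extend_from _ (fun t => U t y) _ (U_C1 y).1 t).
move=> t; apply: continuous_for_mul; last exact: cW.
apply: (cvgV (f := fun t => \sum_y ext_weight t y)); first by rewrite gt_eqF.
by apply: continuous_bigsum => y _; exact: cW.
Qed.

Lemma continuous_ext_H x : continuous (ext_H ^~ x).
Proof.
have cU y : continuous (ext_dU ^~ y) by exact: continuous_from_clamp (U_C1 y).2.
move=> t; apply: continuous_for_sub; first exact: cU.
apply: continuous_bigsum => y _; apply: continuous_for_mul; first exact: cU.
exact: continuous_ext_mu.
Qed.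

Lemma is_derive_ext_mu t x : 0 <= t ->
  is_derive t 1 (ext_mu ^~ x) (- (ext_H t x * ext_mu t x)).
Proof.
move=> t0.
have dU y : is_derive t 1 (ext_U ^~ y) (ext_dU t y).
  rewrite /ext_dU (max_idPr t0).
  exact: is_derive_extend_from t0 (U_C1 y).1.
have dW y : is_derive t 1 (ext_weight ^~ y) (- ext_dU t y * ext_weight t y).
  have D := is_derive_mulr (mu 0 y)
    (is_derive_comp1 (g := fun t => - ext_U t y) (is_derive_expR (- ext_U t y))
      (is_derive_opp (dU y))).
  by apply: (is_derive_eq D); rewrite /ext_weight; ring.
have dZ := @is_derive_bigsum R S (index_enum S) xpredT _ _ t (fun y _ => dW y).
have Z0 : \sum_y ext_weight t y != 0 by rewrite gt_eqF.
have dI := is_deriveV Z0 dZ.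
apply: (is_derive_eq (is_derive_mul dI (dW x))).
have PE : pairing (ext_dU t) (ext_mu t) =
    (\sum_y ext_weight t y)^-1 * \sum_y ext_dU t y * ext_weight t y.
  by rewrite mulr_sumr; apply: eq_bigr => y _; rewrite /ext_mu mulrCA.
have NE : \sum_y - ext_dU t y * ext_weight t y = - \sum_y ext_dU t y * ext_weight t y.
  by rewrite -sumrN; apply: eq_bigr => y _; rewrite mulNr.
rewrite /ext_H PE NE /ext_mu /GRing.scale/=.
by move: (\sum_y ext_weight t y) (\sum_y _) Z0 => Z D Z0; field.
Qed.

Lemma pairing_ext_H t : pairing (ext_H t) (ext_mu t) = 0.
Proof.
rewrite /pairing /ext_H; under eq_bigr do rewrite mulrBl.
by rewrite sumrB -mulr_sumr ext_mu_sum mulr1 subrr.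
Qed.

Lemma neg_dlogE t x : 0 <= t -> neg_dlog mu t x = ext_H t x.
Proof.
move=> t0; have m0 := ext_mu_gt0 t x.
have D := is_derive_comp1 (g := ext_mu ^~ x) (is_derive1_ln m0) (is_derive_ext_mu x t0).
rewrite /neg_dlog (derivative_from_is_derive t0 _ D).
  by field; rewrite gt_eqF.
by move=> s s0; rewrite ext_muE.
Qed.

End GibbsExtension.

(** * Functional inequalities read off the constants A, B and gamma *)

Section QuotientSupTheory.
Context {R : realType} {V : Type}.
Implicit Types (F : set V) (num den : V -> R) (f : V) (c l : R).

Lemma quotient_sup_ge F num den z : quotients F num den z -> (z <= quotient_sup F num den)%E.
Proof.
move=> Qz; rewrite /quotient_sup ifF; first exact: ereal_sup_ubound.
by apply/negbTE/negP => /asboolP Q0; rewrite Q0 in Qz.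
Qed.

Lemma quotient_sup_neqNy F num den : quotient_sup F num den != -oo%E.
Proof.
rewrite /quotient_sup; case: ifPn => //; move=> /asboolP/eqP/set0P[z Qz].
have := ereal_sup_ubound Qz; case: Qz => f _ [[_ ->]|[_ _ ->]]; apply: contraTneq => ->.
  by rewrite leeNy_eq.
by rewrite leeNy_eq.
Qed.

(** The factor [c] stays outside because the supremum may be infinite. For [c = 0] the convention
    [0 * +oo = 0] leaves [0 <= l]; for [c > 0] finiteness excludes a zero denominator under a
    positive numerator. *)
Lemma quotient_sup_bound F num den f c l : F f -> 0 <= den f -> 0 <= c ->
  (c%:E * quotient_sup F num den <= l%:E)%E -> c * num f <= l * den f.
Proof.
move=> Ff den0; rewrite le_eqVlt => /predU1P[<-|c0].
  by rewrite mul0e lee_fin mul0r => l0; exact: mulr_ge0.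
have [den00|denN0] := eqVneq (den f) 0.
  have [num0 _|num0] := leP (num f) 0; first by rewrite den00 mulr0 mulr_ge0_le0// ltW.
  have Qy : quotients F num den +oo%E by exists f => //; right.
  have := quotient_sup_ge Qy; rewrite leye_eq => /eqP ->.
  by rewrite gt0_muley ?lte_fin// leye_eq.
have Qz : quotients F num den (num f / den f)%:E by exists f => //; left.
have := quotient_sup_ge Qz => h1 h2.
have := le_trans (lee_wpmul2l (ltW (_ : (0 < c%:E)%E)) h1) h2.
rewrite lte_fin => /(_ c0); rewrite -EFinM lee_fin mulrA ler_pdivrMr//.
by rewrite lt0r denN0.
Qed.

End QuotientSupTheory.

Section LocalInequalities.
Context {R : realType} {S : finType}.
Variables (m H : S -> R) (L : S -> S -> R) (A : {set S}).
Implicit Types (phi f : S -> R) (lam p T c : R).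
Hypothesis m_gt0 : forall x, 0 < m x.
Hypothesis A_ne : exists x, x \in A.
Hypothesis L_ge0 : forall x y, x != y -> 0 <= L x y.

Let mA := cond m A.
Let mA_ge0 x : 0 <= mA x. Proof. exact: cond_nonneg. Qed.
Let mA_sum : \sum_x mA x = 1. Proof. exact: cond_sum1. Qed.

Lemma dirichlet_ge0 phi : 0 <= dirichlet m L A phi.
Proof.
rewrite /dirichlet mulr_ge0// sumr_ge0// => x _; apply: sumr_ge0 => y _.
have [->|xy] := eqVneq x y; first by rewrite subrr expr0n !mul0r.
by rewrite mulr_ge0 ?mA_ge0// mulr_ge0 ?sqr_ge0// L_ge0.
Qed.

Lemma dirichlet_affine phi k c : dirichlet m L A (fun x => k * (phi x - c)) =
  k ^+ 2 * dirichlet m L A phi.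
Proof.
rewrite /dirichlet mulrCA; congr (_ * _); rewrite mulr_sumr; apply: eq_bigr => x _.
by rewrite mulr_sumr; apply: eq_bigr => y _; ring.
Qed.

Lemma pairing_cond_eq0 f : (forall x, x \in A -> f x = 0) -> pairing f mA = 0.
Proof.
move=> f0; apply: big1 => x _; rewrite /mA /cond.
by case: ifP => [/f0 ->|_]; rewrite ?mul0r ?mulr0.
Qed.

Lemma pairing_H_loc : pairing (H_loc m H A) mA = 0.
Proof.
rewrite /pairing /H_loc; under eq_bigr do rewrite mulrBl.
by rewrite sumrB -mulr_sumr mA_sum mulr1 subrr.
Qed.

(** Split [phi] into its mean and a centred part [f]. As [H_loc] has mean 0, there remain a
    quadratic term in [f], governed by A, and a cross term between the mean and [f], governed by
    B. *)
Lemma poincare_from_constants lam p T phi : 0 < p -> 0 < T ->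
  ((p / 4)%:E * const_A m H L A + (p * (p + 3) / 4 * T)%:E * const_B m H L A <= lam%:E)%E ->
  - pairing (fun x => H_loc m H A x * phi x ^+ 2) mA <=
  4 / p * (lam * dirichlet m L A phi) +
  pairing (fun x => phi x ^+ 2) mA / ((p + 3) * T).
Proof.
move=> p0 T0.
have cA0 : 0 < p / 4 by rewrite divr_gt0.
have k0 : 0 < (p + 3) * T by rewrite mulr_gt0// addr_gt0.
have cB0 : 0 < p * (p + 3) / 4 * T by rewrite mulr_gt0// divr_gt0// mulr_gt0// addr_gt0.
have := quotient_sup_neqNy (calS0 m A) (fun f => - pairing (fun x => H_loc m H A x * f x ^+ 2) mA)
  (dirichlet m L A).
have := quotient_sup_neqNy (calS0 m A) (fun f => `|pairing (fun x => H_loc m H A x * f x) mA| ^+ 2)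
  (dirichlet m L A).
rewrite -/(const_A m H L A) -/(const_B m H L A).
case EA : (const_A m H L A) => [a| |]; case EB : (const_B m H L A) => [b| |] // _ _;
  rewrite ?gt0_muley ?lte_fin// ?addye// ?addey//; try by rewrite leye_eq.
rewrite -!EFinM -EFinD lee_fin => ab.
have [mean meanE] : exists mean : R, pairing phi mA = mean by exists (pairing phi mA).
pose f x := 1 * (phi x - mean).
have Ef : dirichlet m L A f = dirichlet m L A phi by rewrite dirichlet_affine expr1n mul1r.
have D0 := dirichlet_ge0 phi.
have fmean : pairing f mA = 0.
  rewrite /pairing /f; under eq_bigr do rewrite mul1r mulrBl.
  by rewrite sumrB -mulr_sumr mA_sum mulr1 -/(pairing phi mA) meanE subrr.
pose X2 := pairing (fun x => H_loc m H A x * f x ^+ 2) mA.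
pose X1 := pairing (fun x => H_loc m H A x * f x) mA.
have phi2 : pairing (fun x => H_loc m H A x * phi x ^+ 2) mA = X2 + 2 * mean * X1.
  transitivity (X2 + 2 * mean * X1 + mean ^+ 2 * pairing (H_loc m H A) mA); last first.
    by rewrite pairing_H_loc mulr0 addr0.
  rewrite /X2 /X1 /pairing !mulr_sumr -!big_split/=; apply: eq_bigr => x _.
  by rewrite /f; ring.
have mean2 : mean ^+ 2 <= pairing (fun x => phi x ^+ 2) mA.
  have : 0 <= pairing (fun x => f x ^+ 2) mA.
    by apply: sumr_ge0 => x _; rewrite mulr_ge0 ?sqr_ge0.
  have -> : pairing (fun x => f x ^+ 2) mA =
      pairing (fun x => phi x ^+ 2) mA - 2 * mean * pairing phi mA + mean ^+ 2 * \sum_x mA x.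
    rewrite /pairing !mulr_sumr -sumrB -big_split/=; apply: eq_bigr => x _.
    by rewrite /f; ring.
  by rewrite mA_sum meanE; lra.
have [bX1 bX2] : X1 ^+ 2 <= b * dirichlet m L A phi /\ - X2 <= a * dirichlet m L A phi.
  (* [calS0] excludes functions that vanish on the block; for those all terms are 0. *)
  have [/existsP[x /andP[xA fx]]|/existsPn f0] := boolP [exists x, (x \in A) && (f x != 0)].
    have Sf : calS0 m A f by split=> //; exists x.
    have Df : 0 <= dirichlet m L A f by rewrite Ef.
    have A1 : (1%:E * const_A m H L A <= a%:E)%E by rewrite EA mul1e.
    have B1 : (1%:E * const_B m H L A <= b%:E)%E by rewrite EB mul1e.
    have := quotient_sup_bound Sf Df ler01 A1; have := quotient_sup_bound Sf Df ler01 B1.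
    by rewrite !mul1r Ef real_normK ?num_real.
  have f0' x : x \in A -> f x = 0.
    by move=> xA; have := f0 x; rewrite xA/= negbK => /eqP.
  have Df0 : dirichlet m L A phi = 0.
    rewrite -Ef /dirichlet big1 ?mulr0// => x xA; rewrite big1// => y yA.
    by rewrite !f0'// subrr expr0n !mul0r.
  rewrite Df0 !mulr0 /X1 /X2 !pairing_cond_eq0 ?expr0n ?oppr0//.
    by move=> x /f0' ->; rewrite expr0n mulr0.
  by move=> x /f0' ->; rewrite mulr0.
rewrite phi2.
set D := dirichlet m L A phi in D0 bX1 bX2 *; set P := pairing _ _ in mean2 *.
clearbody D P X1 X2.
pose k := (p + 3) * T.
have h1 : mean ^+ 2 / k <= P / k by rewrite ler_pM2r ?invr_gt0.
(* Young's inequality with weight [k = (p + 3) * T], the origin of the coefficient of [const_B]. *)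
have h2 : - (2 * mean * X1) <= mean ^+ 2 / k + k * X1 ^+ 2.
  rewrite -subr_ge0 (_ : _ - _ = k^-1 * (mean + k * X1) ^+ 2); last by rewrite /k; field; rewrite !gt_eqF// addr_gt0.
  by rewrite mulr_ge0 ?sqr_ge0// invr_ge0 ltW.
have h3 := ler_wpM2l (ltW k0) bX1.
have h4 : a * D + k * (b * D) <= 4 / p * (lam * D).
  rewrite (_ : a * D + _ = 4 / p * ((p / 4 * a + p * (p + 3) / 4 * T * b) * D)); last first.
    by rewrite /k; field; rewrite gt_eqF.
  by rewrite ler_pM2l ?divr_gt0// ler_wpM2r.
move: h1 h2 h3 h4; rewrite -/k; lra.
Qed.

(** Rescale [phi] to unit second moment; the logarithm of the scaling factor, [- ln n / 2], supplies
    the second part of the entropy. *)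
Lemma log_sobolev_from_constant lam c phi : 0 <= c ->
  (c%:E * const_gamma m L A <= lam%:E)%E -> 0 <= lam -> (forall x, x \in A -> 0 < phi x) ->
  c * (pairing (fun x => phi x ^+ 2 * ln (phi x)) mA -
       2^-1 * (pairing (fun x => phi x ^+ 2) mA * ln (pairing (fun x => phi x ^+ 2) mA))) <=
  lam * dirichlet m L A phi.
Proof.
move=> c0 cg lam0 phi0; set n := pairing (fun x => phi x ^+ 2) mA.
have n0 : 0 < n.
  have [y yA] := A_ne; rewrite /n /pairing (bigD1 y)//= ltr_pwDl//.
    rewrite mulr_gt0 ?exprn_gt0 ?phi0// /mA /cond yA divr_gt0//.
    exact: mass_pos.
  by apply: sumr_ge0 => x _; rewrite mulr_ge0 ?sqr_ge0.
pose k := (Num.sqrt n)^-1; have s0 : 0 < Num.sqrt n by rewrite sqrtr_gt0.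
have k0 : 0 < k by rewrite invr_gt0.
have kn : k ^+ 2 * n = 1.
  by rewrite /k exprVn sqr_sqrtr ?(ltW n0)// mulVf// gt_eqF.
pose f x := k * (phi x - 0).
have Ef : dirichlet m L A f = k ^+ 2 * dirichlet m L A phi by rewrite dirichlet_affine.
have lnk : ln k = - (2^-1 * ln n).
  rewrite /k lnV ?posrE//; congr (- _).
  have -> : ln n = ln (Num.sqrt n) + ln (Num.sqrt n).
    by rewrite -lnM ?posrE// -expr2 sqr_sqrtr// ltW.
  by field.
have fE : pairing (fun x => f x ^+ 2 * ln `|f x|) mA =
    k ^+ 2 * (pairing (fun x => phi x ^+ 2 * ln (phi x)) mA - 2^-1 * (n * ln n)).
  transitivity (k ^+ 2 * (pairing (fun x => phi x ^+ 2 * ln (phi x)) mA + ln k * n)); last first.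
    by rewrite lnk; ring.
  rewrite /n /pairing mulrDr !mulr_sumr -big_split/=; apply: eq_bigr => x _.
  rewrite /mA /cond; case: ifP => xA; last by rewrite !mulr0 addr0.
  rewrite /f subr0 gtr0_norm ?mulr_gt0 ?phi0// lnM ?posrE ?phi0//; ring.
have f2 : pairing (fun x => f x ^+ 2) mA = 1.
  by rewrite -kn /n /pairing mulr_sumr; apply: eq_bigr => x _; rewrite /f; ring.
have k2 : 0 < k ^+ 2 by rewrite exprn_gt0.
rewrite -(ler_pM2l k2) [leRHS]mulrCA -Ef mulrCA -fE.
have Df : 0 <= dirichlet m L A f by exact: dirichlet_ge0.
(* The function constant to 1 on the block is outside [calS1], and its entropy is 0. *)
have [/existsP[x /andP[xA fx]]|/existsPn f1] := boolP [exists x, (x \in A) && (f x != 1)].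
  have Sf : calS1 m A f by split=> //; exists x.
  exact: quotient_sup_bound Sf Df c0 cg.
have E : pairing (fun x => f x ^+ 2 * ln `|f x|) mA = 0.
  apply: pairing_cond_eq0 => x xA; have := f1 x; rewrite xA/= negbK => /eqP ->.
  by rewrite normr1 ln1 mulr0.
rewrite E mulr0; exact: mulr_ge0 lam0 Df.
Qed.

End LocalInequalities.

Section LocalForms.
Context {R : realType} {S : finType}.
Variables (A : {set S}) (mu H : R -> S -> R) (s : R).
Implicit Types (phi : S -> R).
Hypothesis mu_gt0 : forall x, 0 < mu s x.
Hypothesis A_ne : exists x, x \in A.

Lemma dirichlet_sumE (Q : R -> S -> S -> R) (lam : R) (L : S -> S -> R) phi :
  (forall x y, Q s x y = lam * L x y) ->
  dirichlet_sum A Q mu s phi = mass (mu s) A * (lam * dirichlet (mu s) L A phi).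
Proof.
move=> QE; rewrite /dirichlet_sum /dirichlet.
have -> : \sum_(x in A) \sum_(y in A) (phi y - phi x) ^+ 2 * Q s x y * mu s x =
    mass (mu s) A * (lam * \sum_(x in A) \sum_(y in A)
      (phi y - phi x) ^+ 2 * L x y * cond (mu s) A x).
  rewrite !mulr_sumr; apply: eq_bigr => x xA; rewrite !mulr_sumr; apply: eq_bigr => y _.
  by rewrite QE /cond xA; field; rewrite gt_eqF// mass_pos.
by ring.
Qed.

Lemma block_mean_HE : block_mean_H A H mu s = pairing (H s) (cond (mu s) A).
Proof. by rewrite pairing_cond. Qed.

End LocalForms.

Section Oscillation.
Context {R : realType} {S : finType}.
Implicit Types (f : S -> R) (H : R -> S -> R).

Let has_sup_range f : S -> has_sup (range f).
Proof.
move=> x; split; first by exists (f x), x.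
by exists (\sum_y `|f y|) => _ [y _ <-]; rewrite (bigD1 y)//= ler_wpDr ?ler_norm ?sumr_ge0.
Qed.

Let has_inf_range f : S -> has_inf (range f).
Proof.
move=> x; split; first by exists (f x), x.
exists (- \sum_y `|f y|) => _ [y _ <-]; rewrite lerNl (bigD1 y)//= ler_wpDr ?sumr_ge0//.
by rewrite lerNl lerNnormlW.
Qed.

Lemma osc_ge f x y : f x - f y <= osc f.
Proof.
apply: lerB; [apply: (sup_upper_bound (has_sup_range f x))|apply: (ge_inf (has_inf_range f x).2)].
  by exists x.
by exists y.
Qed.

Lemma osc_le f c : S -> (forall x, `|f x| <= c) -> osc f <= 2 * c.
Proof.
move=> x fc; rewrite mulrDl mul1r; apply: lerD.
  apply: ge_sup; first exact: (has_sup_range f x).1.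
  by move=> _ [y _ <-]; exact: le_trans (ler_norm _) (fc y).
rewrite lerNl; apply: lb_le_inf; first exact: (has_inf_range f x).1.
by move=> _ [y _ <-]; have := fc y; rewrite ler_norml => /andP[].
Qed.

Lemma sup_osc_ge H T s x y : (forall z, continuous (H ^~ z)) -> 0 <= s <= T ->
  H s x - H s y <= sup_osc H T.
Proof.
move=> cH sT; apply: (le_trans (osc_ge _ _ _)).
have [C C0 HC] : exists2 C, 0 < C & forall z s, 0 <= s <= T -> `|H s z| <= C.
  by apply: continuous_segment_bounded_fin => z r _; exact: cH.
apply: sup_upper_bound; last by exists s => //=; rewrite in_itv/=.
split; first by exists (osc (H s)), s => //=; rewrite in_itv/=.
exists (2 * C) => _ [r /= rT <-]; apply: osc_le => // z; apply: HC.
by rewrite in_itv/= in rT.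
Qed.

End Oscillation.

(** The ratio [(2 p - 2) / (p - 2)] is the one for passing from [p / 2] to [p]; it exceeds 1, whence
    the sign. *)
Lemma exponent_const_bounds {R : realType} (p ptil r : R) : 4 < p -> p < r ->
  [/\ ln ((2 * r - 1) / (p - 1)) <= exponent_const p ptil r,
      ln ((p - 1) / (p / 2 - 1)) <= exponent_const p ptil r &
      0 <= exponent_const p ptil r].
Proof.
move=> p4 pr.
have h1 : 0 < (2 * r - 1) / (p - 1) by rewrite divr_gt0; lra.
have h2 : 0 < (2 * p - 2) / (p - 2) by rewrite divr_gt0; lra.
have pE : (p - 1) / (p / 2 - 1) = (2 * p - 2) / (p - 2).
  by field; rewrite !gt_eqF//=; lra.
have le2 : ln ((p - 1) / (p / 2 - 1)) <= exponent_const p ptil r.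
  by rewrite pE /exponent_const ler_ln ?posrE ?lt_max ?h2 ?orbT// !le_max lexx orbT.
split=> //.
  by rewrite /exponent_const ler_ln ?posrE ?lt_max ?h1// !le_max lexx.
apply: le_trans le2; rewrite ln_ge0// ler_pdivlMr; lra.
Qed.

Theorem theorem2p10 (R : realType) (S : finType)
  (mu U : R -> S -> R) (L : R -> S -> S -> R) (lam : R -> R)
  (mu_gt0 : forall (t : R) x, 0 <= t -> 0 < mu t x)
  (mu_sum1 : forall (t : R), 0 <= t -> \sum_x mu t x = 1)
  (mu_gibbs : forall (t : R) x, 0 <= t ->
     mu t x = (\sum_y expR (- U t y) * mu 0 y)^-1 * expR (- U t x) * mu 0 x)
  (U_C1 : forall x, C1_from 0 (fun t : R => U t x))
  (L_Q : forall (t : R), 0 <= t -> Qmatrix (L t))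
  (L_cont : forall x y, {within `[0, +oo[, continuous (fun t : R => L t x y)})
  (L_balance : forall (t : R) x y, 0 <= t -> mu t x * L t x y = mu t y * L t y x)
  (lam_ge0 : forall (t : R), 0 <= t -> 0 <= lam t)
  (lam_cont : {within `[0, +oo[, continuous lam})
  (N : nat) (d : measure_display) (Omega : measurableType d)
  (P : probability Omega R) (X : R -> Omega -> state S N)
  (X_markov : markov_process P X (product_weight (mu 0))
                (particle_gen lam L (neg_dlog mu)))
  (I : finType) (Si : I -> {set S})
  (Si_nonempty : forall i, exists x, x \in Si i)
  (Si_disjoint : forall i j x, x \in Si i -> x \in Si j -> i = j)
  (Si_cover : forall x, exists i, x \in Si i)
  (L_block : forall (t : R) i j x y, 0 <= t -> i != j -> x \in Si i -> y \in Si j ->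
     L t x y = 0)
  (t0 q p ptil r : R)
  (t0_ge0 : 0 <= t0)
  (q_gt6 : 6 < q)
  (p_bounds : 4 * q / (q - 2) < p < q)
  (ptil_def : ptil^-1 = q^-1 + 2 * p^-1)
  (r_def : p^-1 = q^-1 + r^-1)
  (N_large : 40 * Num.max (tilde_K mu (neg_dlog mu) Si t0 q) 1 <= N%:R)
  (lam_large : forall (s : R), 0 <= s <= t0 ->
     (maxe
        ((p / 4)%:E * tilde_A mu (neg_dlog mu) L Si s +
         (p * (p + 3) / 4 * t0)%:E * tilde_B mu (neg_dlog mu) L Si s)
        ((17 / 4 * exponent_const p ptil r * sup_osc (neg_dlog mu) t0)%:E *
         tilde_gamma mu L Si s)
      <= (lam s)%:E)%E) :
  forall (t : R), 0 <= t <= t0 ->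
    (tilde_eps P X mu (neg_dlog mu) Si t p <=
     ((2 + 8 * K mu (neg_dlog mu) t 2 * tilde_M mu Si t ^+ 2) * N%:R^-1 *
      (1 + 16 * tilde_K mu (neg_dlog mu) Si t q * tilde_M mu Si t ^+ 2 * N%:R^-1))%:E)%E.
Proof.
move=> t /andP[t_ge0 t_le].
pose m := ext_mu mu U; pose H := ext_H mu U.
pose Lc (s : R) := L (Num.max 0 s); pose lc (s : R) := lam (Num.max 0 s).
have max0 (s : R) : 0 <= Num.max 0 s by rewrite le_max lexx.
have m_gt0 (s : R) x : 0 < m s x by exact: ext_mu_gt0.
have m_sum (s : R) : \sum_x m s x = 1 by exact: ext_mu_sum.
have m_cont x : continuous (m ^~ x) by exact: continuous_ext_mu.
have H_cont x : continuous (H ^~ x) by exact: continuous_ext_H.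
have mE (s : R) : 0 <= s -> mu s = m s by move=> s0; apply/funext => x; rewrite /m ext_muE.
have HE (s : R) : 0 <= s -> neg_dlog mu s = H s.
  by move=> s0; apply/funext => x; rewrite /H (neg_dlogE mu_gt0 mu_sum1 mu_gibbs U_C1).
have LE (s : R) : 0 <= s -> Lc s = L s by move=> s0; rewrite /Lc (max_idPr s0).
have lE (s : R) : 0 <= s -> lc s = lam s by move=> s0; rewrite /lc (max_idPr s0).
have Lc_cont x y : continuous (fun s => Lc s x y) by exact: (continuous_from_clamp (@L_cont x y)).
have lc_cont : continuous lc by exact: (continuous_from_clamp lam_cont).
have Lc_row (s : R) x : \sum_y Lc s x y = 0 by exact: (L_Q _ (max0 s)).2.
have Lc_ge0 (s : R) x y : x != y -> 0 <= Lc s x y by exact: (L_Q _ (max0 s)).1.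
have lc_ge0 (s : R) : 0 <= lc s by exact: lam_ge0.
have q_gt0 : 0 < q by lra.
have p4 : 4 < p.
  case/andP: p_bounds => h _; apply: lt_trans h.
  by rewrite ltr_pdivlMr; lra.
have pq : p < q by case/andP: p_bounds.
have p0 : 0 < p by lra.
have p30 : 0 < p + 3 by lra.
have N_gt0 : (0 < N)%N.
  rewrite -(ltr0n R); apply: lt_le_trans N_large.
  by rewrite mulr_gt0// lt_max ltr01 orbT.
have in_ge0 (T s : R) : 0 <= s <= T -> 0 <= s by case/andP.
have m_derive (s : R) x : 0 <= s <= t0 -> is_derive s 1 (m ^~ x) (- (H s x * m s x)).
  by move=> /in_ge0 s0; exact: (is_derive_ext_mu mu_gt0 mu_sum1 U_C1).
have m_bal (s : R) x y : 0 <= s <= t0 -> m s x * Lc s x y = m s y * Lc s y x.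
  by move=> /in_ge0 s0; rewrite -mE// LE// L_balance.
have m_inv (s : R) y : 0 <= s <= t0 -> \sum_y' m s y' * Lc s y' y = 0.
  move=> sT; under eq_bigr do rewrite m_bal//.
  by rewrite -mulr_sumr Lc_row mulr0.
have Lc_block (s : R) i x y : 0 <= s <= t0 -> (x \in Si i) != (y \in Si i) -> Lc s x y = 0.
  move=> _; have [j xj] := Si_cover x; have [k yk] := Si_cover y.
  have [jk|jk] := eqVneq j k; last by move=> _; exact: (L_block _ j k).
  rewrite -jk in yk; move=> xy; exfalso; move: xy.
  suff -> : (x \in Si i) = (y \in Si i) by rewrite eqxx.
  by apply/idP/idP => [xi|yi]; [rewrite (Si_disjoint _ _ _ xi xj)|rewrite (Si_disjoint _ _ _ yi yk)].
have Q_ge0 (s : R) x y : 0 <= s <= t0 -> x != y -> 0 <= lc s * Lc s x y.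
  by move=> _ xy; rewrite mulr_ge0 ?Lc_ge0.
pose omega := sup_osc (neg_dlog mu) t0.
have omegaE : omega = sup_osc H t0.
  rewrite /omega /sup_osc; congr sup; apply/seteqP; split=> _ [s /= sT <-]; exists s => //;
    by rewrite HE//; move: sT; rewrite in_itv/= => /andP[].
have H_osc (s : R) x y : 0 <= s <= t0 -> H s x - H s y <= omega.
  by move=> sT; rewrite omegaE; exact: sup_osc_ge.
(* [H s] has mean 0, so each of its values is an average of differences and is bounded by the
   oscillation. *)
have H_bound (s : R) y : 0 <= s <= t0 -> `|H s y| <= omega.
  move=> sT; have H0 : pairing (H s) (m s) = 0 by exact: pairing_ext_H.
  have E : \sum_z (H s y - H s z) * m s z = H s y.
    under eq_bigr do rewrite mulrBl.
    by rewrite sumrB -mulr_sumr m_sum mulr1 -/(pairing (H s) (m s)) H0 subr0.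
  rewrite -E; apply: le_trans (ler_norm_sum _ _ _) _.
  rewrite -[leRHS]mulr1 -(m_sum s) mulr_sumr; apply: ler_sum => z _.
  rewrite normrM (ger0_norm (ltW (m_gt0 s z))) ler_wpM2r ?(ltW (m_gt0 s z))//.
  by rewrite ler_norml lerNl opprB !H_osc.
have omega_ge0 : 0 <= omega.
  have [x _|S0] := pickP (fun _ : S => true).
    by have := @H_osc 0 x x; rewrite subrr lexx; apply.
  by have := m_sum 0; rewrite big1 => [/eqP|x _]; [rewrite eq_sym oner_eq0|have := S0 x].
have X_markov' : markov_process P X (product_weight (m 0)) (particle_gen lam L (neg_dlog mu)).
  by rewrite -mE.
have GE (s : R) (phi : state S N -> R) (x : state S N) : 0 <= s -> particle_gen lam L (neg_dlog mu) s phi x = particle_gen lc Lc H s phi x.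
  by move=> s0; rewrite /particle_gen LE// lE// HE.
have [b [b_ge0 bC b_E b_derive b_0]] := particle_second_moment N_gt0 lc_cont Lc_cont H_cont
  Lc_row t0_ge0 m_derive m_inv (m_sum 0) X_markov' GE.
have b_psd (s : R) f : 0 <= s <= t0 -> pairing f (m s) ^+ 2 <= \sum_y \sum_y' b s y y' * (f y * f y').
  move=> sT; rewrite -subr_ge0 -lee_fin -b_E//.
  by apply: expectation_ge0 => w; rewrite sqr_ge0.
pose a := exponent_const p ptil r.
have r_gt0 : 0 < r.
  rewrite -invr_gt0 (_ : r^-1 = p^-1 - q^-1); last by rewrite r_def; ring.
  by rewrite subr_gt0 ltf_pV2 ?posrE//; lra.
have pr : p < r.
  by rewrite -ltf_pV2 ?posrE// r_def ltrDr invr_gt0.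
have [a_ge1 a_ge2 a_ge0] := exponent_const_bounds ptil p4 pr.
rewrite -/a in a_ge1 a_ge2 a_ge0.
have bigmax_ge (F : I -> \bar R) i : (F i <= \big[maxe/-oo]_(j : I) F j)%E.
  by rewrite (bigD1 i)//= le_max lexx.
have poincare i (s : R) (phi : S -> R) : 0 < t0 -> 0 <= s <= t0 ->
    - (\sum_(x in Si i) (H s x - block_mean_H (Si i) H m s) * phi x ^+ 2 * m s x) <=
    4 / p * dirichlet_sum (Si i) (fun s x y => lc s * Lc s x y) m s phi +
    (\sum_(x in Si i) phi x ^+ 2 * m s x) / ((p + 3) * t0).
  move=> T0 sT; have s0 := in_ge0 _ _ sT.
  have := lam_large s sT; rewrite ge_max => /andP[+ _].
  have cA0 : (0 <= (p / 4)%:E)%E by rewrite lee_fin divr_ge0// ltW.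
  have cB0 : (0 <= (p * (p + 3) / 4 * t0)%:E)%E by rewrite lee_fin mulr_ge0// divr_ge0// mulr_ge0// ltW.
  move=> /(le_trans (leeD (lee_wpmul2l cA0 (bigmax_ge _ i)) (lee_wpmul2l cB0 (bigmax_ge _ i)))).
  rewrite mE// HE// -LE// -lE// => lamAB.
  have := poincare_from_constants (m_gt0 s) (Si_nonempty i) (Lc_ge0 s) phi p0 T0 lamAB.
  have M0 := mass_pos (m_gt0 s) (Si_nonempty i).
  rewrite -(ler_pM2l M0) mulrN (mass_pairing_cond (m_gt0 s) (Si_nonempty i)).
  rewrite mulrDr [_ * (pairing _ _ / _)]mulrA (mass_pairing_cond (m_gt0 s) (Si_nonempty i)).
  rewrite (dirichlet_sumE (L := Lc s) (lam := lc s) (m_gt0 s) (Si_nonempty i))//.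
  by rewrite block_mean_HE [_ * (4 / p * _)]mulrCA.
have log_sob i (s : R) (phi : S -> R) : 0 <= s <= t0 -> (forall x, x \in Si i -> 0 < phi x) ->
  17 / 8 * a * omega *
    (\sum_(x in Si i) phi x ^+ 2 * ln (phi x ^+ 2) * m s x -
     (\sum_(x in Si i) phi x ^+ 2 * m s x) *
     (ln (\sum_(x in Si i) phi x ^+ 2 * m s x) - ln (mass (m s) (Si i)))) <=
  dirichlet_sum (Si i) (fun s x y => lc s * Lc s x y) m s phi.
  move=> sT phi0; have s0 := in_ge0 _ _ sT.
  have := lam_large s sT; rewrite ge_max => /andP[_].
  have c0 : 0 <= 17 / 4 * a * omega by rewrite !mulr_ge0.
  have c0' : (0 <= (17 / 4 * a * omega)%:E)%E by rewrite lee_fin.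
  move=> /(le_trans (lee_wpmul2l c0' (bigmax_ge _ i))).
  rewrite mE// -LE// -lE// => lamG.
  have := log_sobolev_from_constant (m_gt0 s) (Si_nonempty i) (Lc_ge0 s) c0 lamG (lc_ge0 s) phi0.
  have M0 := mass_pos (m_gt0 s) (Si_nonempty i).
  have MP f := mass_pairing_cond (m_gt0 s) (Si_nonempty i) f.
  rewrite -(ler_pM2l M0) (dirichlet_sumE (L := Lc s) (lam := lc s) (m_gt0 s) (Si_nonempty i))//.
  apply: le_trans; rewrite -(MP (fun x => phi x ^+ 2)).
  (* The logarithm of a square doubles, which turns 17/4 into 17/8. *)
  have E2 : \sum_(x in Si i) phi x ^+ 2 * ln (phi x ^+ 2) * m s x =
      2 * (mass (m s) (Si i) * pairing (fun x => phi x ^+ 2 * ln (phi x)) (cond (m s) (Si i))).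
    rewrite MP mulr_sumr; apply: eq_bigr => x xA.
    by rewrite lnXn ?phi0// -mulr_natl; ring.
  rewrite E2; have n0 : 0 < pairing (fun x => phi x ^+ 2) (cond (m s) (Si i)).
    rewrite -(pmulr_rgt0 _ M0) MP; have [y yA] := Si_nonempty i.
    rewrite (bigD1 y)//= ltr_pwDl//; first by rewrite mulr_gt0// exprn_gt0// phi0.
    by apply: sumr_ge0 => x _; rewrite mulr_ge0 ?sqr_ge0// ltW.
  rewrite lnM ?posrE//.
  move: (mass _ _) (pairing _ _) (pairing _ _) (ln _) (ln _) => M u v lM lv.
  by rewrite le_eqVlt; apply/orP; left; apply/eqP; field.
have IK (k k' : R -> R) (s : R) : continuous k -> (forall s, 0 <= s -> k' s = k s) -> 0 <= s ->
    \int[lebesgue_measure]_(x in `[0, s]) k' x = increment k s.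
  move=> ck kk s0; rewrite /increment -(Rintegral_primitive ck (lerN10 R) s0).
  apply: eq_Rintegral => x; rewrite inE/= in_itv/= => /andP[x0 _]; exact: kk.
have KtE (s : R) : 0 <= s -> tilde_K mu (neg_dlog mu) Si s q = increment (H_norm H m Si q) s.
  move=> s0; have hc := continuous_H_norm H_cont p4 pq Si_nonempty m_gt0 m_cont.
  have hk (v : R) : 0 <= v -> Lp_norm_max Si (mu v) q (neg_dlog mu v) = H_norm H m Si q v.
    by move=> v0; rewrite (mE v v0) (HE v v0).
  by rewrite /tilde_K (IK _ _ _ hc hk s0).
have KE (s : R) : 0 <= s -> K mu (neg_dlog mu) s 2 = increment (fun s => Lp_norm (m s) 2 (H s)) s.
  move=> s0; have hk (v : R) : 0 <= v -> Lp_norm (mu v) 2 (neg_dlog mu v) = Lp_norm (m v) 2 (H v).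
    by move=> v0; rewrite (mE v v0) (HE v v0).
  have hc : continuous (fun s => Lp_norm (m s) 2 (H s)).
    move=> v; have two0 : 0 < 2 :> R by [].
    exact: (continuous_Lp_norm two0 (fun v x => ltW (m_gt0 v x)) (fun x => @m_cont x v) (fun x => @H_cont x v)).
  by rewrite /K (IK _ _ _ hc hk s0).
pose M := tilde_M mu Si t.
(* [sup] is meaningful only on bounded sets: masses are at most 1 and, by continuity, bounded away
   from 0 on [[0, t]]. *)
have has_ratio i : has_sup [set z | exists r s : R,
    [/\ 0 <= r, r <= s, s <= t & z = mass (mu s) (Si i) / mass (mu r) (Si i)]].
  split; first by exists (mass (mu 0) (Si i) / mass (mu 0) (Si i)), 0, 0.
  have [C C0 HC] : exists2 C, 0 < C & forall s, 0 <= s <= t -> `|(mass (m s) (Si i))^-1| <= C.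
    apply: continuous_segment_bounded => s _.
    apply: (cvgV (f := fun s => mass (m s) (Si i))); first by rewrite gt_eqF// mass_pos.
    by apply: continuous_bigsum => x _; exact: m_cont.
  exists C => _ [u [s [u0 us st ->]]]; have s0 := le_trans u0 us.
  rewrite !mE//; apply: (@le_trans _ _ (1 * (mass (m u) (Si i))^-1)).
    apply: ler_wpM2r; first by rewrite invr_ge0 ltW// mass_pos.
    rewrite -[leRHS](m_sum s) [leRHS](bigID (mem (Si i)))/= lerDl.
    by apply: sumr_ge0 => x _; exact: ltW.
  rewrite mul1r; apply: le_trans (ler_norm _) (HC u _).
  by rewrite u0 (le_trans us).
have M_ge i : sup [set z | exists r s : R,
    [/\ 0 <= r, r <= s, s <= t & z = mass (mu s) (Si i) / mass (mu r) (Si i)]] <= M.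
  by rewrite /M /tilde_M (bigD1 i)//= le_max lexx.
have M_ratio i (u u' : R) : 0 <= u -> u <= u' -> u' <= t ->
    mass (m u') (Si i) <= M * mass (m u) (Si i).
  move=> u0 uu' u't; have u'0 := le_trans u0 uu'.
  rewrite -ler_pdivrMr ?mass_pos//; apply: le_trans (M_ge i).
  apply: (sup_upper_bound (has_ratio i)); exists u, u'; split=> //.
  by rewrite !mE.
have M1 : 1 <= M.
  have [x _|S0] := pickP (fun _ : S => true); last first.
    by have := m_sum 0; rewrite big1 => [/eqP|x _]; [rewrite eq_sym oner_eq0|have := S0 x].
  have [i _] := Si_cover x; have M0 := mass_pos (m_gt0 0) (Si_nonempty i).
  by have := M_ratio i 0 0 (lexx 0) (lexx 0) t_ge0; rewrite -[X in X <= _]mul1r ler_pM2r.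
have Nt : 40 * Num.max (increment (H_norm H m Si q) t) 1 <= N%:R.
  apply: le_trans N_large; rewrite KtE// ler_pM2l// ge_max !le_max lexx orbT andbT.
  apply/orP; left; apply: increment_mono => //.
    exact: (continuous_H_norm H_cont p4 pq Si_nonempty m_gt0 m_cont).
  by move=> s; exact: H_norm_ge0.
apply: ge_ereal_sup => _ [s [f [/andP[s0 st] f1 ->]]].
have sT : 0 <= s <= t0 by rewrite s0 (le_trans st).
rewrite mE// in f1 *.
have WE w : weighted_empirical (neg_dlog mu) (X ^~ w) s = weighted_empirical H (X ^~ w) s.
  apply/funext => y.
  have IE : \int[lebesgue_measure]_(v in `[0, s]) pairing (neg_dlog mu v) (empirical (X v w)) =
      \int[lebesgue_measure]_(v in `[0, s]) pairing (H v) (empirical (X v w)).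
    by apply: eq_Rintegral => v; rewrite inE/= in_itv/= => /andP[v0 _]; rewrite (HE v v0).
  by rewrite /weighted_empirical IE.
have -> : (fun w => (`|pairing f (weighted_empirical (neg_dlog mu) (X ^~ w) s) - pairing f (m s)| ^+ 2)%R) =
    (fun w => (`|pairing f (weighted_empirical H (X ^~ w) s) - pairing f (m s)| ^+ 2)%R).
  by apply/funext => w; rewrite WE.
rewrite (b_E s f sT) lee_fin (KE t t_ge0) (KtE t t_ge0).
have fi i : Lp_norm (cond (m s) (Si i)) p f <= 1.
  by apply: le_trans f1; rewrite /Lp_norm_max (bigD1 i)//= le_max lexx.
exact: (particle_variance_bound N_gt0 lc_cont Lc_cont H_cont Lc_row Q_ge0 Lc_block Si_disjoint
  Si_cover (fun s y _ => ltW (m_gt0 s y)) (fun s _ => m_sum s) m_derive m_inv H_bound H_osc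
  b_ge0 bC b_psd b_derive b_0 omega_ge0 p4 pq r_def a_ge1 a_ge2 Si_nonempty m_gt0 m_cont
  m_bal poincare log_sob s0 st t_le Nt M1 M_ratio fi).
Qed.
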